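(* In algorithm NEON-$\mathcal A$ for $\min_{x\in\mathbb{R}^d}F(x)=\mathrm E_\xi[f(x;\xi)]$, let $\mathcal A(x_j)$ be implemented by $$y_j=\text{SCSG-epoch}(x_j,\mathbf S_1,b),\qquad z_j=y_j,$$ with $|\mathbf S_1|=\widetilde O\left(\max(1/\epsilon^2,1/(\gamma^{9/2}b^{1/2}))\right)$. Then $\varepsilon(\epsilon,\alpha)=\Omega(\epsilon^{4/3}/b^{1/3})$ and $\mathrm E[T_a]=\widetilde O\left(\max(1/\epsilon^2,1/(\gamma^{9/2}b^{1/2}))\right)$. With high probability, the resulting algorithm NEON-SCSG finds an $(\epsilon,\gamma)$-second-order stationary point with an expected total IFO complexity of $$\widetilde O\left(\max\left(\frac{b^{1/3}}{\epsilon^{4/3}},\frac1{\gamma^3}\right)\left(T_n+\frac1{\epsilon^2}+\frac1{\gamma^{9/2}b^{1/2}}\right)\right).$$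
   Context: Standing assumptions: each $f(\cdot;\xi)$ is twice differentiable with $L_1$-Lipschitz gradient and $L_2$-Lipschitz Hessian (spectral norm); $F(x_1)-\min F\le\Delta<\infty$ for the initial point; $\mathrm E[\exp(\|\nabla f(x;\xi)-\nabla F(x)\|^2/G^2)]\le\exp(1)$ for some $G>0$; $\mathrm E\|\nabla f(x;\xi)-\nabla F(x)\|^2\le V$ for some $V>0$. IFO complexity is the number of evaluations of stochastic gradients $\nabla f(x;\xi)$. $\widetilde O$ hides logarithmic factors and problem constants (for $|\mathbf S_1|$ it denotes a sample size of that order with suitable constants). An $(\epsilon,\gamma)$-second-order stationary point is $x$ with $\|\nabla F(x)\|\le\epsilon$ and $\lambda_{\min}(\nabla^2F(x))\ge-\gamma$ (the paper's general guarantee yields these up to constant factors, $O(\epsilon)$ and $2\gamma$). For a sample set $\mathcal S$, $F_{\mathcal S}(x)=\frac1{|\mathcal S|}\sum_{\xi\in\mathcal S}f(x;\xi)$. Algorithm NEON-$\mathcal A$ with input $x_1$: for $j=1,2,\dots$: compute $(y_j,z_j)=\mathcal A(x_j)$; if the first-order condition at $y_j$ is not met, set $x_{j+1}=z_j$; else compute $u_j$ by the NEON procedure applied to $F_{\mathcal S_2}$ at $y_j$ (independent mini-batch $\mathcal S_2$); if $u_j=0$ return $y_j$, else set $x_{j+1}=y_j-\frac{c\gamma\bar\xi}{L_2}\frac{u_j}{\|u_j\|}$ with a Rademacher variable $\bar\xi\in\{1,-1\}$. The first-order condition is $\|\nabla F_{\mathbf S}(y_j)\|\le\epsilon$ for a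 mini-batch $\mathbf S$ independent of $y_j$ with $\|\nabla F(y_j)-\nabla F_{\mathbf S}(y_j)\|\le\epsilon/2$ (cost $T_c=\widetilde O(1/\epsilon^2)$). The NEON procedure is a randomized first-order procedure (NEON: from uniformly random $u_0$ in a small ball, gradient descent $u_{\tau+1}=u_\tau-\eta'(\nabla F_{\mathcal S_2}(y_j+u_\tau)-\nabla F_{\mathcal S_2}(y_j))$, or its Nesterov-accelerated version NEON$^+$) with parameters and $|\mathcal S_2|$ chosen so that: if $\lambda_{\min}(\nabla^2F(y_j))\le-\gamma$, with high probability it returns $u_j\neq0$ with $u_j^\top\nabla^2F(y_j)u_j/\|u_j\|^2\le-c\gamma$ ($c$ the inverse of a logarithmic factor); if it returns $0$, with high probability $\lambda_{\min}(\nabla^2F(y_j))\ge-2\gamma$. $T_n$ is the total IFO complexity of the NEON call and ensuing update, which satisfies that if $\lambda_{\min}(\nabla^2F(y_j))\le-\gamma$ then $\mathrm E[F(x_{j+1})-F(y_j)]\le-C\gamma^3$ for some $C>0$; $T_n=\widetilde O(1/\gamma^3)$ with NEON and $\widetilde O(1/\gamma^{2.5})$ with NEON$^+$. $T_a$ is the total IFO complexity of $\mathcal A(x)$. $\varepsilon(\epsilon,\alpha)$ (a function of $\epsilon$ and a parameter $\alpha>0$) denotes the decrease guaranteed by $\mathcal A$: $\|\nabla F(y_j)\|\ge\epsilon$ implies $\mathrm E[F(z_j)-F(x_j)]\le-\varepsilon(\epsilon,\alpha)$. Procedure $\text{SCSG-epoch}(x,\mathbf S_1,b)$, with $\mathbf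 S_1$ an independent set of samples and $b\le|\mathbf S_1|$ a mini-batch size: let $m_1=|\mathbf S_1|$, $\eta=\frac{c'}{L_1}(m_1/b)^{-2/3}$ with a constant $c'\le1/6$; set $x_0=x$, compute $\nabla F_{\mathbf S_1}(x_0)$, and draw $N\sim\mathrm{Geom}(m_1/(m_1+b))$, i.e. $\Pr(N=k)=q^k(1-q)$, $k=0,1,\dots$, $q=m_1/(m_1+b)$. For $k=1,\dots,N$: draw a fresh mini-batch $\mathcal S_k$ of $b$ samples independent of $\mathbf S_1$, set $v_k=\nabla F_{\mathcal S_k}(x_{k-1})-\nabla F_{\mathcal S_k}(x_0)+\nabla F_{\mathbf S_1}(x_0)$ and $x_k=x_{k-1}-\eta v_k$. Return $x_N$.
   Formalization: NEON is also assumed sound at every point: w.h.p. a nonzero u_j has u_j^T∇²F(y_j)u_j/‖u_j‖² ≤ −cγ even if λ_min > −γ (else the algorithm may never return); ‖∇F(y_j)‖ ≥ ε is read in mean square. *)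

(* Defs.v *)
From HB Require Import structures.
From mathcomp Require Import all_boot all_order all_algebra.
From mathcomp Require Import all_classical all_reals all_analysis.

Set Implicit Arguments.
Unset Strict Implicit.
Unset Printing Implicit Defensive.

Import Order.TTheory GRing.Theory Num.Theory.
Import numFieldNormedType.Exports.

Local Open Scope classical_set_scope.
Local Open Scope ring_scope.

Section calculus.
Context {R : realType} {d : nat}.
Implicit Types (x y v : 'rV[R]_d) (h : 'rV[R]_d -> R) (A : 'M[R]_d).

(* The library norm on 'rV_d is the sup norm; differentiability does not
   depend on the choice, the Lipschitz constants do. *)
Definition enorm v : R := Num.sqrt (\sum_i v 0 i ^+ 2).

Definition grad h x : 'rV[R]_d := \row_i 'D_(delta_mx 0 i) h x.

Definition hess h x : 'M[R]_d := 'J (grad h) x.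

Definition spectral_norm A : R :=
  sup [set enorm (v *m A) | v in [set v | enorm v <= 1]].

(* Only used for d > 0 and A a Hessian, hence symmetric: the infimum is then
   over a finite nonempty set. *)
Definition lambda_min A : R := inf [set l | eigenvalue A l].

Definition curvature h y v : R :=
  (v *m hess h y *m v^T) 0 0 / enorm v ^+ 2.

Definition twice_differentiable h : Prop :=
  (forall x, differentiable h x) /\ (forall x, differentiable (grad h) x).

Definition second_order_stationary h (e g : R) x : Prop :=
  enorm (grad h x) <= e /\ - g <= lambda_min (hess h x).

End calculus.

Definition borel_rV (R : realType) (d : nat) :=
  g_sigma_algebraType (@open 'rV[R]_d).

Section stochastic_objective.
Context {R : realType} {d : nat} {dX : measure_display} {Xi : measurableType dX}.
Variables (D : probability Xi R) (f : 'rV[R]_d -> Xi -> R).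

Definition objective (x : 'rV[R]_d) : R := fine ('E_D[f x])%E.

Definition minibatch (s : seq Xi) (x : 'rV[R]_d) : R :=
  (size s)%:R^-1 * \sum_(xi <- s) f x xi.

Record standing_assumptions (L1 L2 Delta G V : R) (x1 : 'rV[R]_d) : Prop :=
 StandingAssumptions {
  sa_measurable : measurable_fun setT
    (fun p : borel_rV R d * Xi => f p.1 p.2) ;
  sa_integrable : forall x, D.-integrable setT (EFin \o f x) ;
  sa_differentiable : forall xi, twice_differentiable (f^~ xi) ;
  sa_grad_lipschitz : forall xi x y,
    enorm (grad (f^~ xi) x - grad (f^~ xi) y) <= L1 * enorm (x - y) ;
  sa_hess_lipschitz : forall xi x y,
    spectral_norm (hess (f^~ xi) x - hess (f^~ xi) y) <= L2 * enorm (x - y) ;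
  sa_initial_gap : exists xmin, (forall x, objective xmin <= objective x) /\
    objective x1 - objective xmin <= Delta ;
  sa_subgaussian : forall x,
    (\int[D]_xi (expR (enorm (grad (f^~ xi) x - grad objective x) ^+ 2
                       / G ^+ 2))%:E <= (expR 1)%:E)%E ;
  sa_variance : forall x,
    (\int[D]_xi (enorm (grad (f^~ xi) x - grad objective x) ^+ 2)%:E
     <= V%:E)%E }.

End stochastic_objective.

(* A deterministic first-order procedure: it interacts with a function only by
   adaptively querying its value and gradient. *)
Inductive fo_proc (R : realType) (d : nat) : Type :=
| Return of 'rV[R]_d
| Query of 'rV[R]_d & (R -> 'rV[R]_d -> fo_proc R d).

Section first_order_procedure.
Context {R : realType} {d : nat}.
Variable h : 'rV[R]_d -> R.

Fixpoint run (p : fo_proc R d) : 'rV[R]_d :=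
  match p with
  | Return u => u
  | Query x k => run (k (h x) (grad h x))
  end.

Fixpoint queries (p : fo_proc R d) : nat :=
  match p with
  | Return _ => 0%N
  | Query x k => (queries (k (h x) (grad h x))).+1
  end.

End first_order_procedure.

Section scsg_epoch.
Context {R : realType} {d : nat} {dX : measure_display} {Xi : measurableType dX}.
Variables (f : 'rV[R]_d -> Xi -> R) (L1 c' : R).
(* [s k] is the k-th inner mini-batch (k >= 1); [N] the drawn epoch length. *)
Variables (S1 : seq Xi) (b : nat) (N : nat) (s : nat -> seq Xi).

Definition scsg_stepsize : R :=
  c' / L1 * ((size S1)%:R / b%:R) `^ (- (2 / 3)).

Fixpoint scsg_iter (x0 : 'rV[R]_d) (k : nat) : 'rV[R]_d :=
  if k is i.+1 then
    let x := scsg_iter x0 i in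
    let v := grad (minibatch f (s k)) x - grad (minibatch f (s k)) x0
             + grad (minibatch f S1) x0 in
    x - scsg_stepsize *: v
  else x0.

Definition scsg_epoch (x : 'rV[R]_d) : 'rV[R]_d := scsg_iter x N.

(* One gradient per sample of S1, then b at x_{k-1} and b at x_0 for each k. *)
Definition scsg_cost : nat := (size S1 + 2 * b * N)%N.

End scsg_epoch.

(* A run of NEON-A for fixed realizations of all the draws; iterations are
   numbered from 0.  [A j x] is the pair (y_j, z_j) computed by the j-th call
   of the base procedure at x, [Ta j] its cost. *)
Section neon_A.
Context {R : realType} {d : nat} {dX : measure_display} {Xi : measurableType dX}.
Variables (f : 'rV[R]_d -> Xi -> R) (L2 eps gamma c : R).
Variables (A : nat -> 'rV[R]_d -> 'rV[R]_d * 'rV[R]_d) (Ta : nat -> nat).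
Variables (S S2 : nat -> seq Xi) (neon : nat -> 'rV[R]_d -> fo_proc R d).
Variables (zeta : nat -> R) (x1 : 'rV[R]_d).

Definition first_order_met (j : nat) (y : 'rV[R]_d) : bool :=
  enorm (grad (minibatch f (S j)) y) <= eps.

Definition neon_direction (j : nat) (y : 'rV[R]_d) : 'rV[R]_d :=
  run (minibatch f (S2 j)) (neon j y).

Definition neon_cost (j : nat) (y : 'rV[R]_d) : nat :=
  (size (S2 j) * queries (minibatch f (S2 j)) (neon j y))%N.

(* Equal to y when the direction is 0, since 0^-1 = 0. *)
Definition neon_update (j : nat) (y : 'rV[R]_d) : 'rV[R]_d :=
  let u := neon_direction j y in
  y - (c * gamma * zeta j / L2) *: ((enorm u)^-1 *: u).

(* The sequence is continued after the algorithm has returned; only the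
   iterations satisfying [reached] belong to the run. *)
Fixpoint neonA_x (j : nat) : 'rV[R]_d :=
  if j is i.+1 then
    let yz := A i (neonA_x i) in
    if first_order_met i yz.1 then neon_update i yz.1 else yz.2
  else x1.

Definition neonA_y (j : nat) : 'rV[R]_d := (A j (neonA_x j)).1.

Definition returns_at (j : nat) : bool :=
  first_order_met j (neonA_y j) && (neon_direction j (neonA_y j) == 0).

Definition reached (j : nat) : bool := [forall i : 'I_j, ~~ returns_at i].

Definition neonA_returns (y : 'rV[R]_d) : Prop :=
  exists j, [/\ reached j, returns_at j & y = neonA_y j].

Definition iteration_cost (j : nat) : nat :=
  (Ta j + size (S j)
   + (if first_order_met j (neonA_y j) then neon_cost j (neonA_y j) else 0))%N.

Definition total_cost : \bar R :=
  (\sum_(0 <= j <oo) (if reached j then (iteration_cost j)%:R else 0)%:E)%E.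

End neon_A.

(* What a sample of iteration j is used for: the batch S1 and the k-th inner
   batch of the epoch, the first-order check, the NEON batch. *)
Inductive role : Type := Epoch | Inner of nat | Check | Curv.

Inductive source : Type :=
| SampleSrc of nat & role & nat
| LengthSrc of nat
| SeedSrc of nat
| SignSrc of nat.

Section randomness.
Context {R : realType} {dO dX dU : measure_display}.
Context {Omega : measurableType dO} (P : probability Omega R).
Context (Xi : measurableType dX) (U : measurableType dU).

Record draws : Type := Draws {
  sample : nat -> role -> nat -> {RV P >-> Xi} ;
  epoch_length : nat -> {RV P >-> nat} ;
  seed : nat -> {RV P >-> U} ;
  sign : nat -> {RV P >-> R} }.

Definition source_sigma (W : draws) (s : source) : set (set Omega) :=
  match s with
  | SampleSrc j r i => g_sigma_algebra_preimage (sample W j r i)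
  | LengthSrc j => g_sigma_algebra_preimage (epoch_length W j)
  | SeedSrc j => g_sigma_algebra_preimage (seed W j)
  | SignSrc j => g_sigma_algebra_preimage (sign W j)
  end.

Definition mutually_independent (I : Type) (E : I -> set (set Omega)) : Prop :=
  forall (n : nat) (i : 'I_n -> I) (B : 'I_n -> set Omega),
    injective i -> (forall k, E (i k) (B k)) ->
    P (\bigcap_k B k) = (\prod_(k < n) P (B k))%E.

(* [seed W j] carries all the internal randomness of the j-th NEON call. *)
Record valid_draws (D : probability Xi R) (m1 b : nat) (W : draws) : Prop :=
 ValidDraws {
  vd_sample : forall j r i (B : set Xi), measurable B ->
    P (sample W j r i @^-1` B) = D B ;
  vd_length : forall j k,
    let q : R := m1%:R / (m1%:R + b%:R) in
    P (epoch_length W j @^-1` [set k]) = (q ^+ k * (1 - q))%:E ;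
  vd_sign_pos : forall j, P (sign W j @^-1` [set 1]) = (2^-1)%:E ;
  vd_sign_neg : forall j, P (sign W j @^-1` [set -1]) = (2^-1)%:E ;
  vd_independent : mutually_independent (source_sigma W) }.

Definition batch (W : draws) (j : nat) (r : role) (n : nat) (w : Omega) :
  n.-tuple Xi := [tuple sample W j r i w | i < n].

End randomness.

Section neon_scsg.
Context {R : realType} {d : nat} {dO dX dU : measure_display}.
Context {Omega : measurableType dO} {P : probability Omega R}.
Context {Xi : measurableType dX} {U : measurableType dU}.
Variables (D : probability Xi R) (f : 'rV[R]_d -> Xi -> R).
Variables (L1 L2 c' c eps gamma : R) (m1 b s n2 : nat).
Variables (neon : U -> 'rV[R]_d -> fo_proc R d) (W : draws P Xi U).
Variable x1 : 'rV[R]_d.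

Let F := objective D f.

Definition scsg_call (w : Omega) (j : nat) (x : 'rV[R]_d) :
    'rV[R]_d * 'rV[R]_d :=
  let y := scsg_epoch f L1 c' (batch W j Epoch m1 w) b (epoch_length W j w)
             (fun k => batch W j (Inner k) b w) x in
  (y, y).

Definition scsg_call_cost (w : Omega) (j : nat) : nat :=
  scsg_cost (batch W j Epoch m1 w) b (epoch_length W j w).

Definition check_batch (w : Omega) (j : nat) : seq Xi := batch W j Check s w.
Definition curv_batch (w : Omega) (j : nat) : seq Xi := batch W j Curv n2 w.
Definition neon_call (w : Omega) (j : nat) : 'rV[R]_d -> fo_proc R d :=
  neon (seed W j w).
Definition signs (w : Omega) (j : nat) : R := sign W j w.

Definition neon_scsg_direction (w : Omega) : nat -> 'rV[R]_d -> 'rV[R]_d :=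
  neon_direction f (curv_batch w) (neon_call w).

Definition neon_scsg_update (w : Omega) : nat -> 'rV[R]_d -> 'rV[R]_d :=
  neon_update f L2 gamma c (curv_batch w) (neon_call w) (signs w).

Definition neon_scsg_returns (w : Omega) : 'rV[R]_d -> Prop :=
  neonA_returns f L2 eps gamma c (scsg_call w) (check_batch w) (curv_batch w)
    (neon_call w) (signs w) x1.

Definition neon_scsg_cost (w : Omega) : \bar R :=
  total_cost f L2 eps gamma c (scsg_call w) (scsg_call_cost w) (check_batch w)
    (curv_batch w) (neon_call w) (signs w) x1.

(* [p] is the failure probability tolerated in "with high probability". *)
Definition check_guarantee (p : R) : Prop :=
  forall j y,
    (P [set w |
        (eps / 2 < enorm (grad F y - grad (minibatch f (check_batch w j)) y))%R]
     <= p%:E)%E.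

Record neon_guarantee (C Tn p : R) : Prop := NeonGuarantee {
  ng_measurable_run : measurable_fun setT
    (fun a : borel_rV R d * (n2.-tuple Xi * U) =>
       run (minibatch f a.2.1) (neon a.2.2 a.1) : borel_rV R d) ;
  ng_measurable_queries : measurable_fun setT
    (fun a : borel_rV R d * (n2.-tuple Xi * U) =>
       queries (minibatch f a.2.1) (neon a.2.2 a.1)) ;
  ng_cost : forall w j y,
    (neon_cost f (curv_batch w) (neon_call w) j y)%:R <= Tn ;
  ng_detects : forall j y, lambda_min (hess F y) <= - gamma ->
    ((1 - p)%:E <= P [set w | (neon_scsg_direction w j y != 0 /\
       curvature F y (neon_scsg_direction w j y) <= - (c * gamma))%R])%E ;
  (* Nonzero answers are sound wherever NEON is called: without this, a
     procedure that never answers 0 would meet the other clauses, and the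
     algorithm would never return. *)
  ng_sound : forall j y,
    (P [set w | (neon_scsg_direction w j y != 0 /\
       - (c * gamma) < curvature F y (neon_scsg_direction w j y))%R] <= p%:E)%E ;
  ng_certifies : forall j y,
    (P [set w | (neon_scsg_direction w j y = 0 /\
       lambda_min (hess F y) < - (2 * gamma))%R] <= p%:E)%E ;
  ng_decrease : forall j y, lambda_min (hess F y) <= - gamma ->
    (\int[P]_w (F (neon_scsg_update w j y) - F y)%:E
     <= (- (C * gamma ^+ 3))%:E)%E }.

End neon_scsg.

(* [dec] is a decrease guaranteed by a randomized base procedure A.  As the
   point y returned by A is random, "|grad F y| >= e" is read in mean square;
   in particular it covers the case where it holds almost surely. *)
Definition guarantees_decrease (R : realType) (d : nat) (dO : measure_display)
    (Omega : measurableType dO) (P : probability Omega R) (F : 'rV[R]_d -> R)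
    (A : Omega -> 'rV[R]_d -> 'rV[R]_d * 'rV[R]_d) (e dec : R) : Prop :=
  forall x,
    ((e ^+ 2)%:E <= \int[P]_w (enorm (grad F (A w x).1) ^+ 2)%:E)%E ->
    (\int[P]_w (F (A w x).2 - F x)%:E <= (- dec)%:E)%E.

(* The logarithmic factors hidden by soft-O are the powers of this quantity. *)
Definition log_factor (R : realType) (d : nat) (eps gamma delta : R) : R :=
  1 + ln d%:R + ln eps^-1 + ln gamma^-1 + ln delta^-1.

Definition iteration_bound (R : realType) (eps gamma : R) (b : nat) : R :=
  Num.max (b%:R `^ (1 / 3) / eps `^ (4 / 3)) (1 / gamma ^+ 3).

Definition epoch_size_bound (R : realType) (eps gamma : R) (b : nat) : R :=
  Num.max (1 / eps ^+ 2) (1 / (gamma `^ (9 / 2) * b%:R `^ (1 / 2))).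

(* Main.v *)
(* Write Fm = F - min F, tau = (b / m1)^(1/3) and a = c' / (2 L1 tau).  For an
   SCSG epoch, the potential Fm(x_k) + lam |x_k - x_0|^2 decreases in mean up
   to the error of grad F_S1; summing against the geometric law of N gives
     E [Fm(y) + a |grad F(y)|^2] <= Fm(x) + a V / m1.
   At the point y the check and NEON use draws independent of the epoch.  When
   the check fails although |grad F(y)| <= eps / 2 (probability <= fail), or
   |grad F(y)| > eps / 2 (paid for by a |grad F(y)|^2), or NEON answers u <> 0
   (a mean gain c^3 gamma^3 / (3 L2^2), from the symmetric third-order bound on
   F(y + v) + F(y - v) - 2 F(y), unless the answer is unsound), the iteration
   does not stop.  Hence, for mu of order 1 / J up to logarithms,
     E [Fm(x_{j+1}) + mu 1_{no stop at j}] <= Fm(x_j) + mu / 2.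
   Summing over the run, the probabilities rho_j of reaching iteration j add up
   to at most 2 Delta / mu + 2.  This bounds the mean cost, by Wald's argument,
   and the failure probability, since at each reached iteration a stop at a
   point that is not second-order stationary has probability <= fail. *)
From HB Require Import structures.
Require Import Defs.
From mathcomp Require Import all_boot all_order all_algebra.
From mathcomp Require Import all_classical all_reals all_analysis.
From mathcomp Require Import measurable_realfun.
From mathcomp Require Import ring lra.
Import Order.TTheory GRing.Theory Num.Theory.
Import numFieldNormedType.Exports.
Local Open Scope classical_set_scope.
Local Open Scope ring_scope.

Set Implicit Arguments.
Unset Strict Implicit.
Unset Printing Implicit Defensive.

(** The guarantees for the check, NEON and one epoch hold at a fixed point, but the run applies them
    at random points. The transfer is by Tonelli: [history W J] is [Omega] with the sigma-algebra of
    the draws in [J], and for disjoint [J1], [J2] the diagonal [w |-> (w, w)] carries [P] to a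
    product measure, so that one group of draws is frozen while the other is averaged. The price is
    joint measurability of every ingredient, obtained from difference quotients of step [1/(n+1)].
    Along the run [F] enters only through [F - Fmin], which keeps the integrands nonnegative.

    [F] is defined as an integral; its gradient and Hessian are identified by integrating Taylor
    bounds whose constants do not depend on the sample.

    The scale is [j = bound_root]: [J = j^2] and, with [B = b^(1/6)], [M = (j / B)^3]. With
    [lam = Lam^r], the choice is [mu = m0 / (lam^3 J)], because the NEON gain contains [c^3] and
    [c >= 1 / (K lam)]. The noise [a V / m1] scales like [m1^(-2/3) b^(-1/3)]; a factor [lam^6] in
    [m1] brings it below [mu / 4]. *)

Local Notation mfunT := (measurable_fun setT).

Lemma le_of_eq (dsp : Order.disp_t) (T : porderType dsp) (a b : T) : a = b -> (a <= b)%O.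
Proof. by move=> ->. Qed.

(** A remainder of order [|v|^2] is [o(v)], and a continuous linear candidate is then the
    differential. Inequalities between integrals thus suffice to differentiate an expectation. *)
Lemma quadratic_remainder_diff (R : realType) (V W : normedModType R)
    (f : V -> W) x (L : {linear V -> W}) (C : R) :
  continuous L -> (forall v, `|f (x + v) - f x - L v| <= C * `|v| ^+ 2) ->
  differentiable f x /\ 'd f x = L :> (_ -> _).
Proof.
move=> Lc fL.
have fo : f \o shift x = cst (f x) + L +o_ 0 id.
  apply/eqaddoP => e e0 /=; near=> v.
  rewrite -[leLHS]/(`|f (v + x) - (f x + L v)|) opprD addrA [v + x]addrC.
  apply: le_trans (fL v) _; apply: (@le_trans _ _ ((`|C| * `|v|) * `|v|)).
    by rewrite -mulrA -expr2 ler_wpM2r ?sqr_ge0// ler_norm.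
  (* [|C| + 1] replaces [C], whose sign is unknown, so that the radius [e / (|C| + 1)] is
     positive. *)
  rewrite ler_wpM2r//; apply: (@le_trans _ _ ((`|C| + 1) * `|v|)).
    by rewrite ler_wpM2r// lerDl.
  have C1 : 0 < `|C| + 1 by rewrite ltr_wpDl.
  rewrite -ler_pdivlMl// mulrC; near: v; apply: cvgr0_norm_le; last exact: divr_gt0.
  exact: cvg_id.
have dE := diff_unique Lc fo.
by split => //; apply/diff_locallyP; split; rewrite dE.
Unshelve. all: by end_near. Qed.

(** * Euclidean inner product and norm on row vectors *)

Section euclid.
Context {R : realType} {d : nat}.
Implicit Types (u v w x y : 'rV[R]_d).

Definition dot u v : R := \sum_i u 0 i * v 0 i.

Lemma dotC u v : dot u v = dot v u.
Proof. by apply: eq_bigr => i _; rewrite mulrC. Qed.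

Lemma dotDl u v w : dot (u + v) w = dot u w + dot v w.
Proof. by rewrite -big_split/=; apply: eq_bigr => i _; rewrite mxE mulrDl. Qed.

Lemma dotZl a u v : dot (a *: u) v = a * dot u v.
Proof. by rewrite mulr_sumr; apply: eq_bigr => i _; rewrite mxE mulrA. Qed.

Lemma dotNl u v : dot (- u) v = - dot u v.
Proof. by rewrite -scaleN1r dotZl mulN1r. Qed.

Lemma dotBl u v w : dot (u - v) w = dot u w - dot v w.
Proof. by rewrite dotDl dotNl. Qed.

Lemma dotDr u v w : dot u (v + w) = dot u v + dot u w.
Proof. by rewrite dotC dotDl !(dotC _ u). Qed.

Lemma dotZr a u v : dot u (a *: v) = a * dot u v.
Proof. by rewrite dotC dotZl dotC. Qed.

Lemma dotNr u v : dot u (- v) = - dot u v.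
Proof. by rewrite dotC dotNl dotC. Qed.

Lemma dotBr u v w : dot u (v - w) = dot u v - dot u w.
Proof. by rewrite dotDr dotNr. Qed.

Lemma dot0l v : dot 0 v = 0.
Proof. by rewrite -(scale0r 0) dotZl mul0r. Qed.

Lemma dot_delta u i : dot u (delta_mx 0 i) = u 0 i.
Proof.
rewrite /dot (bigD1 i)//= big1 ?addr0; first by rewrite mxE !eqxx mulr1.
by move=> j /negbTE ji; rewrite mxE eqxx ji mulr0.
Qed.

Lemma dot_mulmx u v : (u *m v^T) 0 0 = dot u v.
Proof. by rewrite mxE; apply: eq_bigr => i _; rewrite mxE. Qed.

Lemma enorm_sqr v : enorm v ^+ 2 = dot v v.
Proof.
rewrite /enorm sqr_sqrtr; first by apply: eq_bigr => i _; rewrite expr2.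
by apply: sumr_ge0 => i _; rewrite sqr_ge0.
Qed.

Lemma enorm_ge0 v : 0 <= enorm v.
Proof. exact: sqrtr_ge0. Qed.
#[local] Hint Resolve enorm_ge0 : core.

Lemma enormZ a v : enorm (a *: v) = `|a| * enorm v.
Proof.
apply/eqP; rewrite -(eqrXn2 (n := 2))// ?mulr_ge0//.
by rewrite exprMn !enorm_sqr dotZl dotZr real_normK ?num_real// expr2 mulrA.
Qed.

Lemma enormN v : enorm (- v) = enorm v.
Proof. by rewrite -scaleN1r enormZ normrN normr1 mul1r. Qed.

Lemma enorm0 : enorm (0 : 'rV[R]_d) = 0.
Proof. by rewrite -(scale0r 0) enormZ normr0 mul0r. Qed.

Lemma enorm_eq0 v : enorm v = 0 -> v = 0.
Proof.
move=> /(congr1 (fun a => a ^+ 2)); rewrite enorm_sqr expr0n/= /dot => /eqP.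
rewrite psumr_eq0; last by move=> i _; rewrite -expr2 sqr_ge0.
move=> /allP h; apply/rowP => i; rewrite mxE; apply/eqP.
by have := h i (mem_index_enum _); rewrite -expr2 sqrf_eq0.
Qed.

Lemma enormD_sqr u v :
  enorm (u + v) ^+ 2 = enorm u ^+ 2 + 2 * dot u v + enorm v ^+ 2.
Proof. by rewrite !enorm_sqr dotDl !dotDr (dotC v u); ring. Qed.

Lemma enormB_sqr u v :
  enorm (u - v) ^+ 2 = enorm u ^+ 2 - 2 * dot u v + enorm v ^+ 2.
Proof. by rewrite enormD_sqr dotNr enormN; ring. Qed.

Lemma dot_le u v : dot u v <= enorm u * enorm v.
Proof.
have [->|u0] := eqVneq u 0; first by rewrite dot0l enorm0 mul0r.
have [->|v0] := eqVneq v 0; first by rewrite dotC dot0l enorm0 mulr0.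
have pu : 0 < enorm u by rewrite lt0r enorm_ge0 andbT; apply: contra_neq u0 => /enorm_eq0.
have pv : 0 < enorm v by rewrite lt0r enorm_ge0 andbT; apply: contra_neq v0 => /enorm_eq0.
have := sqr_ge0 (enorm (enorm v *: u - enorm u *: v)).
rewrite enormB_sqr !enormZ !ger0_norm// dotZl dotZr => h.
have : 0 <= 2 * (enorm u * enorm v) * (enorm u * enorm v - dot u v).
  by apply: le_trans h _; apply: le_of_eq; ring.
by rewrite pmulr_rge0 ?subr_ge0// !mulr_gt0.
Qed.

Lemma normr_dot_le u v : `|dot u v| <= enorm u * enorm v.
Proof.
rewrite ler_norml dot_le andbT lerNl -dotNl.
by apply: le_trans (dot_le _ _) _; rewrite enormN.
Qed.

Lemma enorm_triangle u v : enorm (u + v) <= enorm u + enorm v.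
Proof.
rewrite -(ler_pXn2r (n := 2))// ?nnegrE ?addr_ge0// enormD_sqr.
by have := dot_le u v; nra.
Qed.

Lemma normr_coord_le_norm v i : `|v 0 i| <= `|v|.
Proof. by rewrite [leRHS]/Num.norm /= mx_normrE; apply/bigmax_geP; right => /=; exists (0, i). Qed.

Lemma enorm_le_norm v : enorm v ^+ 2 <= d%:R * `|v| ^+ 2.
Proof.
rewrite enorm_sqr /dot.
apply: (@le_trans _ _ (\sum_(i < d) `|v| ^+ 2)).
  apply: ler_sum => i _; rewrite -expr2 -[leLHS](real_normK (num_real _)).
  by apply: lerXn2r; rewrite ?nnegrE// normr_coord_le_norm.
by rewrite sumr_const card_ord mulr_natl.
Qed.

Lemma dot_linear u : linear (dot u).
Proof. by move=> a v w; rewrite dotDr dotZr. Qed.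

HB.instance Definition _ u := GRing.isLinear.Build R _ R _ (dot u) (dot_linear u).

Lemma linear_rV_continuous (W : normedModType R) (f : {linear 'rV[R]_d -> W}) :
  continuous f.
Proof.
have fE v : f v = \sum_i v 0 i *: f (delta_mx 0 i).
  by rewrite {1}(row_sum_delta v) linear_sum; apply: eq_bigr => i _; rewrite linearZ.
rewrite (funext fE : f = _ :> (_ -> _)).
apply: continuous_big => [|i _ v]; first exact: add_continuous.
by apply: (@cvgZr_tmp _ _ _ (nbhs v)); exact: (@coord_continuous R 1 d 0 i v).
Qed.

(** Differentiability refers to the sup norm and the remainder to [enorm]; the comparison
    [enorm v ^+ 2 <= d * |v| ^+ 2] only changes the constant, and finite dimension makes [L]
    continuous. *)
Lemma quadratic_remainder_rV (W : normedModType R) (f : 'rV[R]_d -> W) x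
    (L : {linear 'rV[R]_d -> W}) (C : R) :
  (forall v, `|f (x + v) - f x - L v| <= C * enorm v ^+ 2) ->
  differentiable f x /\ 'd f x = L :> (_ -> _).
Proof.
move=> fL; apply: (@quadratic_remainder_diff _ _ _ _ _ _ (`|C| * d%:R)).
  exact: linear_rV_continuous.
move=> v; apply: le_trans (fL v) _; apply: (@le_trans _ _ (`|C| * enorm v ^+ 2)).
  by rewrite ler_wpM2r ?sqr_ge0// ler_norm.
by rewrite -mulrA ler_wpM2l// enorm_le_norm.
Qed.

End euclid.
#[global] Hint Resolve enorm_ge0 : core.

(** The mean value theorem for [phi - psi]. With a polynomial [psi], it gives Taylor bounds with the
    constants that integration along the segment would give. *)
Lemma derive_le01 (R : realType) (phi dphi psi dpsi : R -> R) :
  (forall t : R, is_derive t 1 phi (dphi t)) ->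
  (forall t : R, is_derive t 1 psi (dpsi t)) ->
  (forall t : R, 0 < t < 1 -> dphi t <= dpsi t) ->
  phi 1 - phi 0 <= psi 1 - psi 0.
Proof.
move=> dp dq le_d.
have dd (t : R) : is_derive t 1 (phi - psi) (dphi t - dpsi t) by exact: is_deriveB.
have [|c] := @MVT _ (phi - psi) (fun t => dphi t - dpsi t) 0 1 ltr01.
  apply: continuous_subspaceT => x.
  apply: differentiable_continuous; apply/derivable1_diffP.
  exact: (@ex_derive _ _ _ _ _ _ _ (dd x)).
rewrite in_itv/= => c01 E; have {E} : phi 1 - psi 1 - (phi 0 - psi 0) =
  (dphi c - dpsi c) * (1 - 0) by exact: E.
by have := le_d c c01; lra.
Qed.

(** * Taylor bounds from Lipschitz gradients and Hessians *)

Section taylor.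
Context {R : realType} {d : nat}.
Implicit Types (u v w x y : 'rV[R]_d) (h : 'rV[R]_d -> R).

Lemma is_derive_line (W : normedModType R) (f : 'rV[R]_d -> W) x v t :
  differentiable f (x + t *: v) ->
  is_derive t 1 (fun s : R => f (x + s *: v)) ('D_v f (x + t *: v)).
Proof.
move=> df.
have E : (fun k : R => k^-1 *: (((fun s : R => f (x + s *: v)) \o shift t) (k *: (1 : R))
            - f (x + t *: v))) =
         (fun k : R => k^-1 *: ((f \o shift (x + t *: v)) (k *: v) - f (x + t *: v))).
  apply/funext => k /=; congr (_ *: (f _ - _)).
  by rewrite [k *: 1]mulr1 scalerDl addrCA.
have /(diff_derivable (v := v)) : differentiable f (x + t *: v) := df.
by split; rewrite /derivable /derive E.
Qed.

Lemma derive_grad h x v : differentiable h x -> 'D_v h x = dot (grad h x) v.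
Proof.
move=> dh; rewrite deriveE// [in LHS](row_sum_delta v) linear_sum.
by apply: eq_bigr => i _; rewrite linearZ/= -deriveE// mxE mulrC.
Qed.

Lemma derive_dot_grad h x v w : differentiable (grad h) x ->
  differentiable (dot w \o grad h) x /\
  'D_v (dot w \o grad h) x = dot w (v *m hess h x).
Proof.
move=> dg; have dw z : differentiable (dot w) z.
  by apply: linear_differentiable; exact: linear_rV_continuous.
have dc : differentiable (dot w \o grad h) x by exact: differentiable_comp.
split => //; rewrite deriveE// diff_comp//= diff_lin; last exact: linear_rV_continuous.
by rewrite /= -deriveE// deriveEjacobian.
Qed.

Lemma taylor_lipschitz_grad h (L : R) x v :
  (forall y, differentiable h y) ->
  (forall y z, enorm (grad h y - grad h z) <= L * enorm (y - z)) ->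
  `|h (x + v) - h x - dot (grad h x) v| <= L / 2 * enorm v ^+ 2.
Proof.
move=> dh Lh; set a := dot (grad h x) v; set b := L / 2 * _.
have dphi (t : R) : is_derive t 1 (fun s : R => h (x + s *: v)) (dot (grad h (x + t *: v)) v).
  by rewrite -derive_grad//; exact: is_derive_line.
have dpsi (c e t : R) : is_derive t 1 (fun s : R => s * c + s ^+ 2 * e) (c + 2 * t * e).
  apply: is_derive_eq.
  by rewrite /GRing.scale/=; ring.
have lip t : 0 < t < 1 ->
    `|dot (grad h (x + t *: v)) v - a| <= 2 * t * b.
  move=> /andP[t0 t1]; rewrite /a -dotBl.
  apply: le_trans (normr_dot_le _ _) _.
  apply: le_trans (ler_wpM2r (enorm_ge0 v) (Lh _ _)) _.
  by rewrite addrAC subrr add0r enormZ gtr0_norm// /b; nra.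
have h1 : h (x + 1 *: v) = h (x + v) by rewrite scale1r.
have h0 : h (x + 0 *: v) = h x by rewrite scale0r addr0.
(* The function is compared on the segment with the parabolas [s a + s^2 b] from above and
   [s a - s^2 b] from below; [2 t b] is the Lipschitz bound on the drift of the slope. *)
have up := derive_le01 dphi (dpsi a b).
have dn := derive_le01 (dpsi a (- b)) dphi.
rewrite /= h1 h0 in up dn.
rewrite ler_norml; apply/andP; split.
  have : 1 * a + 1 ^+ 2 * - b - (0 * a + 0 ^+ 2 * - b) <= h (x + v) - h x.
    by apply: dn => t t01; have := lip t t01; rewrite ler_norml => /andP[]; lra.
  lra.
have : h (x + v) - h x <= 1 * a + 1 ^+ 2 * b - (0 * a + 0 ^+ 2 * b).
  by apply: up => t t01; have := lip t t01; rewrite ler_norml => /andP[]; lra.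
lra.
Qed.

(** Cauchy-Schwarz on each column of [A]. It bounds the set whose supremum is [spectral_norm A],
    without which that supremum would carry no information; it also bounds the eigenvalues. *)
Lemma enorm_mulmx_frobenius u (A : 'M[R]_d) :
  enorm (u *m A) <= enorm u * Num.sqrt (\sum_j enorm (row j A^T) ^+ 2).
Proof.
have s0 : 0 <= \sum_j enorm (row j A^T) ^+ 2.
  by apply: sumr_ge0 => j _; rewrite sqr_ge0.
rewrite -(ler_pXn2r (n := 2))// ?nnegrE ?mulr_ge0 ?sqrtr_ge0//.
rewrite exprMn (sqr_sqrtr s0) enorm_sqr mulr_sumr; apply: ler_sum => j _.
rewrite -expr2 -[leLHS](real_normK (num_real _)) -exprMn.
apply: lerXn2r; rewrite ?nnegrE ?mulr_ge0 ?enorm_ge0//.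
rewrite [X in `|X|](_ : _ = dot u (row j A^T)) ?normr_dot_le//.
by rewrite mxE; apply: eq_bigr => i _; rewrite !mxE.
Qed.

Lemma enorm_mulmx_le u (A : 'M[R]_d) : enorm (u *m A) <= spectral_norm A * enorm u.
Proof.
have [->|u0] := eqVneq u 0; first by rewrite mul0mx enorm0 mulr0.
have pu : 0 < enorm u.
  by rewrite lt0r enorm_ge0 andbT; apply: contra_neq u0 => /enorm_eq0.
have : enorm ((enorm u)^-1 *: u *m A) <= spectral_norm A.
  apply: ub_le_sup.
    exists (Num.sqrt (\sum_j enorm (row j A^T) ^+ 2)) => _ [w /= w1 <-].
    apply: le_trans (enorm_mulmx_frobenius _ _) _.
    by rewrite ler_piMl ?sqrtr_ge0.
  exists ((enorm u)^-1 *: u) => //=.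
  by rewrite enormZ gtr0_norm ?invr_gt0// mulVf// gt_eqF.
by rewrite -scalemxAl enormZ gtr0_norm ?invr_gt0// ler_pdivrMl// mulrC.
Qed.

(** Pairing with a fixed [w] keeps the comparison on the segment scalar. Used with [w] and [- w],
    the one-sided bound becomes two-sided. *)
Lemma taylor_lipschitz_hess h (L : R) x u w :
  (forall y, differentiable (grad h) y) ->
  (forall y z, spectral_norm (hess h y - hess h z) <= L * enorm (y - z)) ->
  dot w (grad h (x + u)) - dot w (grad h x) - dot w (u *m hess h x)
  <= L / 2 * enorm u ^+ 2 * enorm w.
Proof.
move=> dg Lh; set a := dot w (u *m hess h x); set b := _ * enorm w.
have dphi (t : R) : is_derive t 1 (fun s : R => (dot w \o grad h) (x + s *: u))
    (dot w (u *m hess h (x + t *: u))).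
  have [dc <-] := derive_dot_grad u w (dg (x + t *: u)).
  exact: is_derive_line.
have dpsi (t : R) : is_derive t 1 (fun s : R => s * a + s ^+ 2 * b) (a + 2 * t * b).
  by apply: is_derive_eq; rewrite /GRing.scale/=; ring.
have := derive_le01 dphi dpsi.
rewrite /= scale1r scale0r addr0 => H.
suff /H : forall t, 0 < t < 1 -> dot w (u *m hess h (x + t *: u)) <= a + 2 * t * b.
  by lra.
move=> t /andP[t0 t1].
rewrite -lerBlDl.
rewrite /a -dotBr -mulmxBr.
apply: le_trans (dot_le _ _) _.
apply: (@le_trans _ _ (enorm w * (L * enorm (x + t *: u - x) * enorm u))).
  rewrite ler_wpM2l ?enorm_ge0//; apply: le_trans (enorm_mulmx_le _ _) _.
  by rewrite ler_wpM2r ?enorm_ge0.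
rewrite addrAC subrr add0r enormZ gtr0_norm// /b.
by apply: le_of_eq; field.
Qed.

(** The gradient terms at [y] for [v] and [- v] cancel, so that only curvature remains. Each of the
    two slopes errs by at most [L/2 t^2 |v|^3]; the sum integrates to [L/3 |v|^3]. *)
Lemma taylor_symmetric h (L : R) y v :
  (forall y, differentiable h y) ->
  (forall y, differentiable (grad h) y) ->
  (forall y z, spectral_norm (hess h y - hess h z) <= L * enorm (y - z)) ->
  h (y + v) + h (y - v) - 2 * h y <= dot v (v *m hess h y) + L / 3 * enorm v ^+ 3.
Proof.
move=> dh dg Lh; set a := dot _ _; set b := _ * _ ^+ 3.
have dphi (t : R) : is_derive t 1
    ((fun s : R => h (y + s *: v)) + (fun s : R => h (y + s *: (- v))))
    (dot (grad h (y + t *: v)) v + dot (grad h (y + t *: (- v))) (- v)).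
  by apply: is_deriveD; rewrite -derive_grad//; exact: is_derive_line.
have dpsi (t : R) : is_derive t 1 (fun s : R => s ^+ 2 * a + s ^+ 3 * b)
    (2 * t * a + 3 * t ^+ 2 * b).
  by apply: is_derive_eq; rewrite /GRing.scale/=; ring.
have := derive_le01 dphi dpsi.
rewrite [X in X - _ <= _](_ : _ = h (y + v) + h (y - v)); last first.
  by rewrite -[LHS]/(_ + _)/= !scale1r.
rewrite [X in _ - X <= _](_ : _ = 2 * h y); last first.
  by rewrite -[LHS]/(_ + _)/= !scale0r addr0; ring.
move=> H; suff /H : forall t, 0 < t < 1 ->
  dot (grad h (y + t *: v)) v + dot (grad h (y + t *: (- v))) (- v) <=
    2 * t * a + 3 * t ^+ 2 * b by lra.
move=> t /andP[t0 t1].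
have t0' : 0 <= t by exact: ltW.
have e1 := taylor_lipschitz_hess y (t *: v) v dg Lh.
have e2 := taylor_lipschitz_hess y (t *: (- v)) (- v) dg Lh.
move: e1 e2.
rewrite !enormZ (ger0_norm t0') enormN.
have -> : dot v ((t *: v) *m hess h y) = t * a by rewrite -scalemxAl dotZr.
have -> : dot (- v) ((t *: (- v)) *m hess h y) = t * a.
  by rewrite -scalemxAl mulNmx dotZr dotNr dotNl opprK.
rewrite !(dotNl v) !(dotC v) dotNr.
set p := dot (grad h (y + _)) v; set q := dot (grad h (y + _)) v.
set r := dot _ _; set e := L / 2 * _ * _.
have -> : 3 * t ^+ 2 * b = e + e by rewrite /e /b; field.
by move: p q r e => p q r e; lra.
Qed.

End taylor.

(** * Measurability of vector-valued maps *)

Lemma continuous_measurable_rV (R : realType) d (h : 'rV[R]_d -> R) :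
  continuous h -> mfunT (h : borel_rV R d -> R).
Proof.
move=> /continuousP ch.
apply: (@measurability _ _ _ _ _ _ (@RGenOpens.G R) (@RGenOpens.measurableE R)).
move=> _ [_ [a [b ->] <-]]; rewrite setTI; apply: sub_sigma_algebra; apply: ch.
exact: interval_open.
Qed.

Section measurable_rV.
Context {R : realType} {d : nat} {dT : measure_display} {T : measurableType dT}.
Implicit Types X Y : T -> borel_rV R d.

Let box (q : 'rV[rat]_d) (n : nat) : set 'rV[R]_d :=
  [set x | forall i, `|x 0 i - ratr (q 0 i)| < n.+1%:R^-1].

Let open_rV_box (U : set 'rV[R]_d) x : open U -> U x ->
  exists (q : 'rV[rat]_d) n, box q n x /\ box q n `<=` U.
Proof.
move=> oU Ux.
have /nbhs_ballP[e /= e0 eU] : nbhs x U by apply: open_nbhs_nbhs; split.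
(* Two radii must fit into [e]: from [x] to the rational centre, and from the centre to any other
   point of the box. *)
pose n := Num.trunc (2 / e).
have ne : n.+1%:R^-1 + n.+1%:R^-1 < e.
  have -> : n.+1%:R^-1 + n.+1%:R^-1 = 2 / n.+1%:R :> R by rewrite mulr_natl mulr2n.
  rewrite ltr_pdivrMr// mulrC -ltr_pdivrMr//.
  exact: truncnS_gt.
have n0 : 0 < n.+1%:R^-1 :> R by rewrite invr_gt0.
have ex i : exists q : rat, `|x 0 i - ratr q| < n.+1%:R^-1.
  have /rat_in_itvoo[q] : x 0 i < x 0 i + n.+1%:R^-1 by rewrite ltrDl.
  rewrite in_itv/= => /andP[q1 q2]; exists q.
  by rewrite distrC gtr0_norm ?subr_gt0// ltrBlDl.
have [q qP] := choice ex.
exists (\row_i q i), n; split; first by move=> i; rewrite mxE.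
move=> y yb; apply: eU; rewrite -ball_normE/=.
rewrite [ltLHS]/Num.norm/= mx_normrE; apply/bigmax_ltP; split => // -[i j] _ /=.
rewrite ord1 !mxE; apply: lt_trans ne.
have -> : x 0 j - y 0 j = (x 0 j - ratr (q j)) - (y 0 j - ratr (q j)).
  by rewrite opprB addrA subrK.
apply: le_lt_trans (ler_normB _ _) _; apply: ltrD; first exact: qP.
by have := yb j; rewrite mxE.
Qed.

(** [borel_rV] is generated by the open sets and not by the coordinates. Boxes with rational centre
    and radius [1/(n+1)] form a countable base, and the preimage of a box is a finite intersection
    of coordinate conditions. *)
Lemma measurable_rV X :
  (forall i, mfunT (fun t => (X t : 'rV[R]_d) 0 i)) ->
  mfunT X.
Proof.
move=> mX; have := @measurability _ _ T (borel_rV R d) setT X (@open 'rV[R]_d) erefl.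
apply => //.
move=> _ [U oU <-]; rewrite setTI.
pose F (k : 'rV[rat]_d * nat) : set T :=
  if `[< box k.1 k.2 `<=` U >] then X @^-1` box k.1 k.2 else set0.
have -> : X @^-1` U = \bigcup_k F k.
  apply/seteqP; split=> [t /= /(open_rV_box oU)[q [n [b1 b2]]]|t [k _]].
    by exists (q, n) => //; rewrite /F; case: asboolP.
  by rewrite /F; case: asboolP => //= bU /bU.
apply: countable_bigcupT_measurable; first exact: countableP.
move=> k; rewrite /F; case: ifP => // _.
have -> : X @^-1` box k.1 k.2 = \bigcap_(i in [set: 'I_d])
   [set t | `|(X t : 'rV[R]_d) 0 i - ratr (k.1 0 i)| < k.2.+1%:R^-1].
  by apply/seteqP; split => t h i; [move=> _; exact: h|exact: h].
apply: fin_bigcap_measurable; first exact: finite_finset.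
move=> i _; rewrite -[X in measurable X]setTI.
apply: (measurable_fun_ltr (f := fun t => `|(X t : 'rV[R]_d) 0 i - ratr (k.1 0 i)|)
  (g := cst k.2.+1%:R^-1)) => //.
apply: measurableT_comp => //; exact: measurable_funB.
Qed.

Lemma measurable_coord X i : mfunT X ->
  mfunT (fun t => (X t : 'rV[R]_d) 0 i).
Proof.
move=> mX; apply: (@measurableT_comp _ _ _ _ _ _
  ((fun x : 'rV[R]_d => x 0 i) : borel_rV R d -> R) _ X) => //.
by apply: continuous_measurable_rV => x; exact: coord_continuous.
Qed.

Lemma measurable_continuous (h : 'rV[R]_d -> R) X :
  continuous h -> mfunT X -> mfunT (fun t => h (X t)).
Proof.
move=> ch mX; apply: (@measurableT_comp _ _ _ _ _ _ (h : borel_rV R d -> R) _ X) => //.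
exact: continuous_measurable_rV.
Qed.

Lemma measurable_rVD X Y : mfunT X -> mfunT Y ->
  mfunT (fun t => X t + Y t : borel_rV R d).
Proof.
move=> mX mY; apply: measurable_rV => i; under eq_fun do rewrite mxE.
by apply: measurable_funD; exact: measurable_coord.
Qed.

Lemma measurable_rVZ (a : T -> R) X : mfunT a -> mfunT X ->
  mfunT (fun t => a t *: (X t : 'rV[R]_d) : borel_rV R d).
Proof.
move=> ma mX; apply: measurable_rV => i; under eq_fun do rewrite mxE.
by apply: measurable_funM => //; exact: measurable_coord.
Qed.

Lemma measurable_rVB X Y : mfunT X -> mfunT Y ->
  mfunT (fun t => X t - Y t : borel_rV R d).
Proof.
move=> mX mY; apply: measurable_rV => i; under eq_fun do rewrite !mxE.
by apply: measurable_funB; exact: measurable_coord.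
Qed.

Lemma measurable_rV_sum (I : Type) (s : seq I) (X : I -> T -> borel_rV R d) :
  (forall i, mfunT (X i)) ->
  mfunT (fun t => \sum_(i <- s) (X i t : 'rV[R]_d) : borel_rV R d).
Proof.
move=> mX; elim: s => [|i s IH].
  by under eq_fun do rewrite big_nil; exact: measurable_cst.
by under eq_fun do rewrite big_cons; exact: measurable_rVD.
Qed.

Lemma measurable_dot X Y : mfunT X -> mfunT Y ->
  mfunT (fun t => dot (X t) (Y t)).
Proof.
move=> mX mY; rewrite /dot.
apply: measurable_sum => i; apply: measurable_funM; exact: measurable_coord.
Qed.

Lemma measurable_enorm_sqr X : mfunT X ->
  mfunT (fun t => enorm (X t) ^+ 2).
Proof. by move=> mX; under eq_fun do rewrite enorm_sqr; exact: measurable_dot. Qed.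

Lemma measurable_enorm X : mfunT X ->
  mfunT (fun t => enorm (X t)).
Proof.
move=> mX; have -> : (fun t => enorm (X t)) = (fun t => Num.sqrt (enorm (X t) ^+ 2)).
  by apply/funext => t; rewrite sqrtr_sqr ger0_norm// enorm_ge0.
apply: (@measurableT_comp _ _ _ _ _ _ (@Num.sqrt R)).
  exact: (continuous_measurable_fun (@sqrt_continuous R)).
exact: measurable_enorm_sqr.
Qed.

Lemma measurable_rV_bool (b : T -> bool) X Y : mfunT b ->
  mfunT X -> mfunT Y ->
  mfunT (fun t => if b t then X t else Y t).
Proof. by move=> mb mX mY; exact: measurable_fun_ifT. Qed.

Lemma measurable_ler_bool (g h : T -> R) : mfunT g ->
  mfunT h -> mfunT (fun t => g t <= h t).
Proof. by move=> mg mh; exact: measurable_fun_ler. Qed.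

Lemma measurable_rV_eq0 X : mfunT X ->
  mfunT (fun t => (X t : 'rV[R]_d) == 0).
Proof.
move=> mX; have -> : (fun t => (X t : 'rV[R]_d) == 0) = (fun t => enorm (X t) <= cst 0 t).
  apply/funext => t /=; apply/eqP/idP => [->|h]; first by rewrite enorm0.
  by apply: enorm_eq0; apply/eqP; rewrite eq_le h enorm_ge0.
by apply: measurable_fun_ler => //; exact: measurable_enorm.
Qed.

End measurable_rV.

(** Together with [scaled_remainder], this turns a quadratic Taylor remainder into convergence of
    the difference quotients of step [1/(n+1)]; derivatives become pointwise limits of measurable
    functions. *)
Lemma cvg_quotient (R : realType) (a : nat -> R) (l C : R) :
  (forall n, `|a n - l| <= C * n.+1%:R^-1) -> a @ \oo --> l.
Proof.
move=> aC; apply/cvgrPdist_le => e e0; near=> n.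
rewrite distrC; apply: le_trans (aC n) _.
apply: (@le_trans _ _ ((`|C| + 1) * n.+1%:R^-1)).
  by rewrite ler_wpM2r// (le_trans (ler_norm C))// lerDl.
have C1 : 0 < `|C| + 1 by rewrite ltr_wpDl.
rewrite -ler_pdivlMl// mulrC; near: n.
have := @cvg_harmonic R => /cvgrPdist_le/(_ (e / (`|C| + 1))).
rewrite divr_gt0// => /(_ isT); apply: filterS => n.
by rewrite sub0r normrN /= ger0_norm ?invr_ge0.
Unshelve. all: by end_near. Qed.

Lemma scaled_remainder (R : realType) (n : nat) (a b C : R) :
  `|a - n.+1%:R^-1 * b| <= C * n.+1%:R^-1 ^+ 2 ->
  `|n.+1%:R * a - b| <= C * n.+1%:R^-1.
Proof.
have n0 : n.+1%:R != 0 :> R by [].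
move=> h; have -> : n.+1%:R * a - b = n.+1%:R * (a - n.+1%:R^-1 * b).
  by rewrite mulrBr mulVKf.
have -> : C * n.+1%:R^-1 = n.+1%:R * (C * n.+1%:R^-1 ^+ 2) by field.
by rewrite normrM ger0_norm// ler_wpM2l.
Qed.

Lemma scaled_delta_mulmx (R : realType) d (a : R) (A : 'M[R]_d) i j :
  ((a *: delta_mx 0 i : 'rV[R]_d) *m A) 0 j = a * A i j.
Proof. by rewrite -scalemxAl -rowE !mxE. Qed.

Section near_integrals.
Context {R : realType} {dX : measure_display} {X : measurableType dX}.
Variable D : probability X R.
Implicit Types g : X -> R.

Lemma integrableRD g1 g2 : D.-integrable setT (EFin \o g1) ->
  D.-integrable setT (EFin \o g2) ->
  D.-integrable setT (EFin \o (fun x => g1 x + g2 x)).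
Proof. exact: (integrableD measurableT). Qed.

Lemma integrableRB g1 g2 : D.-integrable setT (EFin \o g1) ->
  D.-integrable setT (EFin \o g2) ->
  D.-integrable setT (EFin \o (fun x => g1 x - g2 x)).
Proof. exact: (integrableB measurableT). Qed.

Lemma integrableRZ (a : R) g : D.-integrable setT (EFin \o g) ->
  D.-integrable setT (EFin \o (fun x => a * g x)).
Proof. exact: (integrableZl measurableT). Qed.

Lemma integrableR_cst (a : R) : D.-integrable setT (EFin \o (fun=> a)).
Proof. exact: (finite_measure_integrable_cst D a measurableT). Qed.

(** A partial derivative lies within a constant of the unit increment of the function in that
    direction. Integrability thus passes from [f] to the gradients, and from these to the
    Hessians. *)
Lemma integrable_near g1 g2 (C : R) : D.-integrable setT (EFin \o g1) ->
  mfunT g2 -> (forall x, `|g2 x - g1 x| <= C) ->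
  D.-integrable setT (EFin \o g2).
Proof.
move=> i1 m2 h.
have i3 : D.-integrable setT (EFin \o (fun x => `|g1 x| + C)).
  by apply: integrableRD; [exact: integrable_norm|exact: integrableR_cst].
apply: (le_integrable measurableT _ _ i3); first exact/measurable_EFinP.
move=> x _; have C0 : 0 <= C by apply: le_trans (h x).
rewrite /= lee_fin [leRHS]ger0_norm ?addr_ge0//.
by have := ler_normD (g2 x - g1 x) (g1 x); rewrite subrK; have := h x; lra.
Qed.

Lemma Rintegral_le_cst g (C : R) : D.-integrable setT (EFin \o g) ->
  (forall x, g x <= C) -> \int[D]_x g x <= C.
Proof.
move=> ig gC; have <- : \int[D]_x (cst C x) = C.
  by rewrite Rintegral_cst//= probability_setT mulr1.
by apply: le_Rintegral => //; exact: integrableR_cst.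
Qed.

Lemma Rintegral_sum (I : Type) (s : seq I) (g : I -> X -> R) :
  (forall i, D.-integrable setT (EFin \o g i)) ->
  D.-integrable setT (EFin \o (fun x => \sum_(i <- s) g i x)) /\
  \int[D]_x (\sum_(i <- s) g i x) = \sum_(i <- s) \int[D]_x g i x.
Proof.
move=> ig; elim: s => [|i s [IH1 IH2]].
  rewrite big_nil; split.
    under eq_fun do rewrite /= big_nil.
    exact: integrableR_cst.
  under eq_Rintegral do rewrite big_nil.
  by rewrite Rintegral_cst//= mul0r.
split.
  under eq_fun do rewrite /= big_cons.
  exact: integrableRD.
under eq_Rintegral do rewrite big_cons.
by rewrite RintegralD// big_cons IH2.
Qed.

End near_integrals.

(** * Differentiation of the objective under the expectation *)

Section objective_calculus.
Context {R : realType} {d : nat} {dX : measure_display} {Xi : measurableType dX}.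
Variables (D : probability Xi R) (f : 'rV[R]_d -> Xi -> R).
Variables (L1 L2 Delta G V : R) (x1 : 'rV[R]_d).
Hypothesis L2_ge0 : 0 <= L2.
Hypothesis sa : standing_assumptions D f L1 L2 Delta G V x1.
Let F := objective D f.
Let gf x xi := grad (f^~ xi) x.
Let Hf x xi := hess (f^~ xi) x.

Let taylor1 xi x v :
  `|f (x + v) xi - f x xi - dot (gf x xi) v| <= L1 / 2 * enorm v ^+ 2.
Proof.
apply: (taylor_lipschitz_grad (h := f^~ xi)); first by case: (sa_differentiable sa xi).
exact: sa_grad_lipschitz sa xi.
Qed.

Let taylor2 xi x u w :
  dot w (gf (x + u) xi) - dot w (gf x xi) - dot w (u *m Hf x xi)
  <= L2 / 2 * enorm u ^+ 2 * enorm w.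
Proof.
apply: (taylor_lipschitz_hess (h := f^~ xi)); first by case: (sa_differentiable sa xi).
exact: sa_hess_lipschitz sa xi.
Qed.

Let enorm_delta i : enorm (delta_mx 0 i : 'rV[R]_d) = 1.
Proof.
by apply/eqP; rewrite -sqrp_eq1 ?enorm_ge0// enorm_sqr dot_delta mxE !eqxx.
Qed.

Let taylor2_coord xi x u j :
  `|gf (x + u) xi 0 j - gf x xi 0 j - (u *m Hf x xi) 0 j| <= L2 / 2 * enorm u ^+ 2.
Proof.
have := taylor2 xi x u (delta_mx 0 j).
have := taylor2 xi x u (- delta_mx 0 j).
rewrite !dotNl !(dotC (delta_mx 0 j)) !dot_delta enormN enorm_delta mulr1.
by rewrite ler_norml; lra.
Qed.

Section joint_measurability.
Context {dT : measure_display} {T : measurableType dT}.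
Variable Z : T -> Xi.
Hypothesis mZ : mfunT Z.

Lemma measurable_sample (Y : T -> borel_rV R d) : mfunT Y ->
  mfunT (fun t => f (Y t) (Z t)).
Proof.
move=> mY; apply: (measurableT_comp (sa_measurable sa) (g := fun t => (Y t, Z t))).
exact: measurable_fun_pair.
Qed.

Let shift_measurable (Y : T -> borel_rV R d) (v : 'rV[R]_d) : mfunT Y ->
  mfunT (fun t => Y t + v : borel_rV R d).
Proof. by move=> mY; apply: measurable_rVD => //; exact: measurable_cst. Qed.

(** Both the point [Y t] and the sample [Z t] vary with [t]: this is joint measurability, in the
    form needed on products of histories. *)
Lemma measurable_sample_grad (Y : T -> borel_rV R d) : mfunT Y ->
  mfunT (fun t => grad (f^~ (Z t)) (Y t) : borel_rV R d).
Proof.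
move=> mY; apply: measurable_rV => i.
pose a n t := n.+1%:R * (f ((Y t : 'rV[R]_d) + n.+1%:R^-1 *: delta_mx 0 i) (Z t) - f (Y t) (Z t)).
apply: (measurable_fun_cvg (h := a)).
  move=> n; apply: measurable_funM => //; apply: measurable_funB; apply: measurable_sample => //.
  exact: shift_measurable.
move=> t _; apply: (@cvg_quotient _ _ _ (L1 / 2)) => n; rewrite /a.
have := taylor1 (Z t) (Y t) (n.+1%:R^-1 *: delta_mx 0 i).
rewrite dotZr dot_delta enormZ enorm_delta mulr1 [`|_^-1|]ger0_norm ?invr_ge0//; exact: scaled_remainder.
Qed.

Lemma measurable_sample_hess (Y : T -> borel_rV R d) i j : mfunT Y ->
  mfunT (fun t => hess (f^~ (Z t)) (Y t) i j).
Proof.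
move=> mY.
pose a n t := n.+1%:R * (gf ((Y t : 'rV[R]_d) + n.+1%:R^-1 *: delta_mx 0 i) (Z t) 0 j
                         - gf (Y t) (Z t) 0 j).
apply: (measurable_fun_cvg (h := a)).
  move=> n; apply: measurable_funM => //; apply: measurable_funB.
    by apply: measurable_coord; apply: measurable_sample_grad; exact: shift_measurable.
  by apply: measurable_coord; exact: measurable_sample_grad.
move=> t _; apply: (@cvg_quotient _ _ _ (L2 / 2)) => n; rewrite /a.
have := taylor2_coord (Z t) (Y t) (n.+1%:R^-1 *: delta_mx 0 i) j.
rewrite scaled_delta_mulmx enormZ enorm_delta mulr1 [`|_^-1|]ger0_norm ?invr_ge0//; exact: scaled_remainder.
Qed.

End joint_measurability.

Let mgf x : mfunT (gf x : Xi -> borel_rV R d).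
Proof.
apply: (@measurable_sample_grad _ Xi id _ (cst (x : borel_rV R d))); first exact: measurable_id.
exact: measurable_cst.
Qed.

Lemma integrable_sample_grad x i :
  D.-integrable setT (EFin \o (fun xi => grad (f^~ xi) x 0 i)).
Proof.
pose g1 xi := f (x + delta_mx 0 i) xi - f x xi.
apply: (@integrable_near _ _ _ _ g1 _ (L1 / 2)).
- by apply: integrableRB; exact: sa_integrable sa _.
- by apply: measurable_coord; exact: mgf.
- move=> xi; have := taylor1 xi x (delta_mx 0 i).
  by rewrite dot_delta enorm_delta expr1n mulr1 distrC.
Qed.

Lemma integrable_sample_hess x i j :
  D.-integrable setT (EFin \o (fun xi => hess (f^~ xi) x i j)).
Proof.
pose g1 xi := gf (x + delta_mx 0 i) xi 0 j - gf x xi 0 j.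
apply: (@integrable_near _ _ _ _ g1 _ (L2 / 2)).
- by apply: integrableRB; exact: integrable_sample_grad.
- apply: (@measurable_sample_hess _ Xi id _ (cst (x : borel_rV R d))); first exact: measurable_id.
  exact: measurable_cst.
- move=> xi; have := taylor2_coord xi x (delta_mx 0 i) j.
  by rewrite -[delta_mx 0 i]scale1r scaled_delta_mulmx mul1r scale1r enorm_delta expr1n mulr1 distrC.
Qed.

Lemma integrable_dot (X : Xi -> 'rV[R]_d) v :
  (forall i, D.-integrable setT (EFin \o (fun xi => X xi 0 i))) ->
  D.-integrable setT (EFin \o (fun xi => dot (X xi) v)) /\
  \int[D]_xi dot (X xi) v = dot (\row_i \int[D]_xi X xi 0 i) v.
Proof.
move=> iX.
have iXv i : D.-integrable setT (EFin \o (fun xi => X xi 0 i * v 0 i)).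
  exact: (integrableZr measurableT (v 0 i) (iX i)).
have [h1 h2] := Rintegral_sum (index_enum 'I_d) iXv.
split => //; rewrite h2; apply: eq_bigr => i _.
by rewrite RintegralZr// mxE.
Qed.

Let mgrad x := \row_i \int[D]_xi gf x xi 0 i.
Let mhess x := \matrix_(i, j) \int[D]_xi Hf x xi i j.

Lemma objectiveE x : F x = \int[D]_xi f x xi.
Proof. by rewrite /F /objective unlock. Qed.

(** The remainder constant is the same for all samples, so the bound survives the expectation. It
    yields at once the differentiability of [F] and the identity of its gradient with the mean
    sample gradient. *)
Let F_taylor x v : `|F (x + v) - F x - dot (mgrad x) v| <= L1 / 2 * enorm v ^+ 2.
Proof.
have [i1 e1] := integrable_dot v (integrable_sample_grad x).
have i2 := sa_integrable sa x; have i3 := sa_integrable sa (x + v).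
rewrite !objectiveE -e1 -RintegralB//.
have i4 : D.-integrable setT (EFin \o (fun xi => f (x + v) xi - f x xi)).
  exact: integrableRB.
rewrite -RintegralB//.
have i5 := integrableRB i4 i1.
apply: le_trans (le_normr_Rintegral _ _) _ => //.
by apply: Rintegral_le_cst => [|xi]; [exact: integrable_norm|exact: taylor1].
Qed.

Lemma differentiable_objective x : differentiable F x.
Proof. by have [] := quadratic_remainder_rV (L := dot (mgrad x)) (F_taylor x). Qed.

Lemma grad_objective x : grad F x = \row_i \int[D]_xi grad (f^~ xi) x 0 i.
Proof.
have [dF E] := quadratic_remainder_rV (L := dot (mgrad x)) (F_taylor x).
by apply/rowP => i; rewrite [LHS]mxE deriveE// E /= dot_delta.
Qed.

Lemma objective_taylor x v :
  F (x + v) <= F x + dot (grad F x) v + L1 / 2 * enorm v ^+ 2.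
Proof.
by have := F_taylor x v; rewrite -[mgrad x]grad_objective ler_norml; lra.
Qed.

Let integrable_mulmx_hess (v y : 'rV[R]_d) j :
  D.-integrable setT (EFin \o (fun xi => (v *m Hf y xi) 0 j)) /\
  \int[D]_xi (v *m Hf y xi) 0 j = (v *m mhess y) 0 j.
Proof.
have iv k := integrableRZ (v 0 k) (integrable_sample_hess y k j).
have [h1 h2] := Rintegral_sum (index_enum 'I_d) iv.
have E : (fun xi => (v *m Hf y xi) 0 j) = (fun xi => \sum_k v 0 k * Hf y xi k j).
  by apply/funext => xi; rewrite mxE.
rewrite E h2; split => //; rewrite mxE; apply: eq_bigr => k _.
by rewrite RintegralZl ?mxE//; exact: integrable_sample_hess.
Qed.

(** The left-hand norm is the sup norm, so the bound on each coordinate, averaged over the samples,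
    is a bound on the vector with the same constant. *)
Let gradF_taylor x u :
  `|grad F (x + u) - grad F x - u *m mhess x| <= L2 / 2 * enorm u ^+ 2.
Proof.
rewrite [leLHS]/Num.norm/= mx_normrE; apply/bigmax_leP; split.
  by rewrite mulr_ge0 ?sqr_ge0// divr_ge0.
move=> [k j] _ /=; rewrite ord1.
have [i1 e1] := integrable_mulmx_hess u x j.
have i2 := integrable_sample_grad x j; have i3 := integrable_sample_grad (x + u) j.
have i4 := integrableRB i3 i2.
have -> : (grad F (x + u) - grad F x - u *m mhess x) 0 j =
    \int[D]_xi (gf (x + u) xi 0 j - gf x xi 0 j - (u *m Hf x xi) 0 j).
  rewrite !grad_objective RintegralB// RintegralB// e1.
  by rewrite [LHS]mxE [X in X + _]mxE [X in X + _ + _]mxE [X in _ + X + _]mxE mxE [X in _ + X]mxE.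
have i5 := integrableRB i4 i1.
apply: le_trans (le_normr_Rintegral _ _) _ => //.
by apply: Rintegral_le_cst => [|xi]; [exact: integrable_norm|exact: taylor2_coord].
Qed.

Lemma differentiable_grad_objective x : differentiable (grad F) x.
Proof.
by have [] := quadratic_remainder_rV (L := mulmxr (mhess x)) (gradF_taylor x).
Qed.

Lemma hess_objective x :
  hess F x = \matrix_(i, j) \int[D]_xi hess (f^~ xi) x i j.
Proof.
have [dF E] := quadratic_remainder_rV (L := mulmxr (mhess x)) (gradF_taylor x).
apply/row_matrixP => i; rewrite [LHS]rowE [RHS]rowE -deriveEjacobian// deriveE//.
exact: (congr1 (fun h => h (delta_mx 0 i)) E).
Qed.

(** The scalar inequality is integrated sample by sample; the Lipschitz property of the sample
    Hessians is thus used directly, without passing to one for [hess F]. *)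
Lemma objective_taylor_symmetric y v :
  F (y + v) + F (y - v) - 2 * F y <= dot v (v *m hess F y) + L2 / 3 * enorm v ^+ 3.
Proof.
have iH i := integrable_mulmx_hess v y i.
have [i1 e1] := @integrable_dot (fun xi => v *m Hf y xi) v (fun i => (iH i).1).
have e1' : \int[D]_xi dot (v *m Hf y xi) v = dot v (v *m hess F y).
  rewrite e1 hess_objective dotC; congr (dot _ _).
  by apply/rowP => i; rewrite mxE (iH i).2.
have i2 := sa_integrable sa (y + v); have i3 := sa_integrable sa (y - v).
have i4 := integrableRZ 2 (sa_integrable sa y).
have i5 := integrableRB (integrableRB (integrableRD i2 i3) i4) i1.
rewrite !objectiveE -e1' -RintegralZl//; last exact: sa_integrable sa y.
rewrite -RintegralD//.
rewrite -RintegralB//; last exact: integrableRD.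
rewrite -lerBlDl -RintegralB//; last by apply: integrableRB => //; exact: integrableRD.
apply: Rintegral_le_cst => // xi; rewrite lerBlDl dotC.
apply: (taylor_symmetric (h := f^~ xi)); try by case: (sa_differentiable sa xi).
exact: sa_hess_lipschitz sa xi.
Qed.

Lemma continuous_objective : continuous F.
Proof. by move=> x; apply: differentiable_continuous; exact: differentiable_objective. Qed.

Section measurability.
Context {dT : measure_display} {T : measurableType dT}.
Variable Y : T -> borel_rV R d.
Hypothesis mY : mfunT Y.

Lemma measurable_objective : mfunT (fun t => F (Y t)).
Proof. by apply: measurable_continuous => //; exact: continuous_objective. Qed.

Lemma measurable_grad_objective :
  mfunT (fun t => grad F (Y t) : borel_rV R d).
Proof.
apply: measurable_rV => i.
apply: (measurable_continuous (h := fun y => grad F y 0 i)) => // x.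
apply: (@continuous_comp _ _ _ (grad F) (fun y : 'rV[R]_d => y 0 i)).
  by apply: differentiable_continuous; exact: differentiable_grad_objective.
exact: (@coord_continuous R 1 d 0 i).
Qed.

End measurability.

Lemma measurable_hess_objective i j :
  mfunT (fun y : borel_rV R d => hess F y i j).
Proof.
pose a n (y : borel_rV R d) := n.+1%:R *
  (grad F ((y : 'rV[R]_d) + n.+1%:R^-1 *: delta_mx 0 i) 0 j - grad F y 0 j).
apply: (measurable_fun_cvg (h := a)).
  move=> n; apply: measurable_funM => //; apply: measurable_funB.
    apply: measurable_coord; apply: measurable_grad_objective.
    by apply: measurable_rVD; [exact: measurable_id|exact: measurable_cst].
  by apply: measurable_coord; apply: measurable_grad_objective; exact: measurable_id.
move=> y _; apply: (@cvg_quotient _ _ _ (L2 / 2)) => n; rewrite /a.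
have := le_trans (normr_coord_le_norm _ j) (gradF_taylor y (n.+1%:R^-1 *: delta_mx 0 i)).
rewrite enormZ enorm_delta mulr1 [`|_^-1|]ger0_norm ?invr_ge0// => h.
apply: scaled_remainder; apply: le_trans h; rewrite hess_objective.
rewrite -[mhess y]/(\matrix_(i, j) _).
by rewrite -scaled_delta_mulmx [X in _ <= `|X|]mxE [X in _ <= `|X + _|]mxE
  [X in _ <= `|_ + X + _|]mxE [X in _ <= `|_ + X|]mxE.
Qed.

End objective_calculus.

(** * Measurability of lower bounds on the least eigenvalue *)

Section lambda_min.
Context {R : realType} {d : nat}.
Implicit Types A : 'M[R]_d.

Lemma eigenvalue_det A a : eigenvalue A a = (\det (A - a%:M) == 0).
Proof.
apply/eigenvalueP/det0P => -[v h1 h2]; exists v => //.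
  by rewrite mulmxBr mul_mx_scalar h1 subrr.
by apply/eqP; rewrite -subr_eq0 -mul_mx_scalar -mulmxBr h2.
Qed.

Lemma eigenvalue_bounded A a : eigenvalue A a ->
  `|a| <= Num.sqrt (\sum_j enorm (row j A^T) ^+ 2).
Proof.
move=> /eigenvalueP[v vA v0].
have pv : 0 < enorm v.
  by rewrite lt0r enorm_ge0 andbT; apply: contra_neq v0 => /enorm_eq0.
have := enorm_mulmx_frobenius v A.
by rewrite vA enormZ mulrC ler_pM2l.
Qed.

(** For a matrix without real eigenvalues the infimum is that of the empty set, which is 0; the
    condition [0 <= g] makes the equivalence true in that case too. *)
Lemma lambda_min_ge A g : 0 <= g ->
  (- g <= lambda_min A) <-> (forall a, eigenvalue A a -> - g <= a).
Proof.
move=> g0; split.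
  move=> h a ea; apply: le_trans h _; apply: ge_inf => //.
  exists (- Num.sqrt (\sum_j enorm (row j A^T) ^+ 2)) => b /eigenvalue_bounded.
  by rewrite ler_norml => /andP[].
move=> h; have [E|/set0P ne] := eqVneq [set l | eigenvalue A l] set0.
  by rewrite /lambda_min E inf0 oppr_le0.
by apply: lb_le_inf.
Qed.

Lemma continuous_det_shift A : continuous (fun a : R => \det (A - a%:M)).
Proof.
rewrite /determinant.
apply: continuous_big => [|s _ a]; first exact: add_continuous.
apply: cvgM; first exact: cvg_cst.
apply: (@cvg_big _ _ _ _ _ (@mul_continuous R) _ (nbhs a) _
  (fun i (x : R) => (A - x%:M) i (perm.fun_of_perm s i))
  (fun i => (A - a%:M) i (perm.fun_of_perm s i))) => i _.
under eq_fun do rewrite !mxE; rewrite !mxE.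
apply: cvgB; first exact: cvg_cst.
by case: (_ == _); rewrite ?mulr1n ?mulr0n; [exact: cvg_id|exact: cvg_cst].
Qed.

(** The right-hand side has only countable quantifiers, which makes it measurable in a parameter.
    Density of the rationals gives one direction; for the other, [|p|] attains its minimum on the
    compact interval, and that minimum is below every [1/(k+1)]. *)
Lemma exists_root_rat (p : R -> R) (a b : R) : a < b -> continuous p ->
  (exists2 l, a <= l <= b & p l = 0) <->
  (forall k : nat, exists2 q : rat, a <= ratr q <= b & `|p (ratr q)| < k.+1%:R^-1).
Proof.
move=> ab cp; split.
  move=> [l lab pl0] k.
  have k0 : 0 < k.+1%:R^-1 :> R by rewrite invr_gt0.
  have /cvgrPdist_lt/(_ _ k0) := cp l; rewrite pl0 => /nbhs_ballP[e /= e0 he].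
  (* The open interval is taken on the left of [l], or on its right when [l = a]; in the second case
     [a < b] leaves room. *)
  have [u [v [uv uab]]] : exists u v, u < v /\ forall x, u < x < v -> a <= x <= b /\ ball l e x.
    have [la|la] := ltP a l.
      exists (Num.max a (l - e)), l; split.
        by rewrite gt_max la ltrBlDr ltrDl.
      move=> x /andP[]; rewrite gt_max => /andP[ax lex] xl; split.
        by rewrite (ltW ax)/= (le_trans (ltW xl))//; case/andP: lab.
      by rewrite /ball/= ger0_norm; [rewrite ltrBlDr -ltrBlDl|rewrite subr_ge0 ltW].
    exists l, (Num.min b (l + e)); split.
      by rewrite lt_min ltrDl e0 andbT (le_lt_trans la).
    move=> x /andP[lx]; rewrite lt_min => /andP[xb xe]; split.
      by rewrite (ltW xb) andbT (le_trans _ (ltW lx))//; case/andP: lab.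
    by rewrite /ball/= distrC ger0_norm; [rewrite ltrBlDl|rewrite subr_ge0 ltW].
  have [q] := rat_in_itvoo uv; rewrite in_itv/= => /uab[qab qb].
  by exists q => //; have := he _ qb; rewrite /= sub0r normrN.
move=> h.
have [|c cab cmin] := @EVT_min _ (fun x => `|p x|) a b (ltW ab).
  apply: continuous_subspaceT => x; apply: (continuous_comp (cp x)).
  exact: norm_continuous.
exists c; first by move: cab; rewrite in_itv.
apply/eqP; apply: contraT => pc0.
have pc : 0 < `|p c| by rewrite normr_gt0.
have [q qab] := h (Num.trunc `|p c|^-1).
rewrite ltNge (le_trans _ (cmin (ratr q) _)) ?in_itv//.
rewrite invf_ple ?posrE// ltW//; exact: truncnS_gt.
Qed.

(** The half-line below [- g] is exhausted by countably many compact windows. Since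
    [n.+2 > 1 / n.+1], each of them has nonempty interior, as [exists_root_rat] requires. *)
Lemma eigenvalue_lt_window A g :
  (exists2 a, eigenvalue A a & a < - g) <->
  (exists n : nat, exists2 a, - g - n.+2%:R <= a <= - g - n.+1%:R^-1 & \det (A - a%:M) = 0).
Proof.
split=> [[a ea ag]|[n [a /andP[_ an] da]]]; last first.
  exists a; first by rewrite eigenvalue_det da.
  by rewrite (le_lt_trans an)// ltrBlDr ltrDl invr_gt0.
pose e := - g - a; have e0 : 0 < e by rewrite subr_gt0.
(* With [a = - g - e], one index serves both ends: [e < n.+1] for the lower end and [1/e < n.+1] for
   the upper one. *)
pose n := Num.trunc (e + e^-1); have nP := truncnS_gt (e + e^-1).
exists n; exists a; last by apply/eqP; rewrite -eigenvalue_det.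
have ei : 0 < e^-1 by rewrite invr_gt0.
have -> : a = - g - e by rewrite /e opprB addrC subrK.
rewrite !lerD2l !lerN2; apply/andP; split.
  apply: ltW; apply: lt_trans (_ : n.+1%:R < _); last by rewrite ltr_nat.
  by apply: lt_trans nP; rewrite ltrDl.
rewrite invf_ple ?posrE//; apply: ltW; apply: lt_trans nP.
by rewrite ltrDr.
Qed.

(* lambda_min is not continuous on nonsymmetric matrices; its superlevel sets
   are described by values of the characteristic polynomial at rationals. *)
Lemma measurable_lambda_min_ge (dT : measure_display) (T : measurableType dT)
    (H : T -> 'M[R]_d) g : 0 <= g ->
  (forall i j, mfunT (fun t => H t i j)) ->
  measurable [set t | - g <= lambda_min (H t)].
Proof.
move=> g0 mH.
have mdet (q : R) : mfunT (fun t => \det (H t - q%:M)).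
  rewrite /determinant; apply: measurable_sum => s; apply: measurable_funM => //.
  apply: measurable_prod => i _; under eq_fun do rewrite !mxE.
  exact: measurable_funB.
pose S (n k : nat) (q : rat) : set T :=
  if (- g - n.+2%:R <= ratr q <= - g - n.+1%:R^-1)
  then [set t | `|\det (H t - (ratr q)%:M)| < k.+1%:R^-1] else set0.
rewrite [X in measurable X](_ : _ = ~` \bigcup_n \bigcap_k \bigcup_q S n k q).
  apply: measurableC; apply: bigcup_measurable => n _.
  apply: bigcapT_measurable => k; apply: bigcupT_measurable_rat => q.
  rewrite /S; case: ifP => // _; rewrite -[X in measurable X]setTI.
  apply: (measurable_fun_ltr (g := cst k.+1%:R^-1)) => //.
  exact: measurableT_comp.
apply/seteqP; split=> t /=.
  move=> /(lambda_min_ge _ g0) h [n _ hn].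
  have ab : - g - n.+2%:R < - g - n.+1%:R^-1.
    by rewrite ltrD2l ltrN2 (@le_lt_trans _ _ 1)// ?ltr1n// invf_le1// ler1n.
  have [|a aw da] := (exists_root_rat ab (@continuous_det_shift (H t))).2.
    move=> k; have [q _] := hn k I; rewrite /S; case: ifP => // qw qk.
    by exists q.
  have [|b eb bg] := (eigenvalue_lt_window (H t) g).2.
    by exists n; exists a.
  by have := h b eb; rewrite leNgt bg.
move=> h; apply/(lambda_min_ge _ g0) => a ea; rewrite leNgt; apply/negP => ag.
apply: h; have [n nP] := (eigenvalue_lt_window (H t) g).1 (ex_intro2 _ _ a ea ag).
exists n => // k _.
have ab : - g - n.+2%:R < - g - n.+1%:R^-1.
  by rewrite ltrD2l ltrN2 (@le_lt_trans _ _ 1)// ?ltr1n// invf_le1// ler1n.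
have [q qw qk] := (exists_root_rat ab (@continuous_det_shift (H t))).1 nP k.
by exists q => //; rewrite /S qw.
Qed.

End lambda_min.

(** * Independence of pi-systems and averaging over one of them *)

Section independence.
Context {R : realType} {dO : measure_display} {Omega : measurableType dO}.
Variable P : probability Omega R.

Definition independent_systems (G1 G2 : set (set Omega)) : Prop :=
  forall A B, <<s G1 >> A -> <<s G2 >> B -> P (A `&` B) = (P A * P B)%E.

(** For fixed [A], both [B |-> P (A & B)] and [B |-> P A * P B] are finite measures, and two of
    these that agree on a pi-system containing the whole space agree on what it generates. *)
Lemma independent_from_pi (A : set Omega) (G : set (set Omega)) :
  measurable A -> G `<=` measurable -> G setT -> setI_closed G ->
  (forall B, G B -> P (A `&` B) = (P A * P B)%E) ->
  forall B, <<s G >> B -> P (A `&` B) = (P A * P B)%E.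
Proof.
move=> mA mG GT GI h B GB.
pose r : {nonneg R} := NngNum (fine_ge0 (measure_ge0 P A)).
have rE : r%:num%:E = P A by rewrite /= fineK// fin_num_measure.
have : mrestr P mA B = mscale r P B.
  apply: (@g_sigma_algebra_measure_unique _ R Omega G mG (fun=> setT)) => //.
  - by rewrite bigcup_const//; exists 0%N.
  - by move=> C GC; rewrite /= /mrestr/mscale setIC h// rE.
  - by move=> _; rewrite /= /mrestr setTI ltey_eq fin_num_measure.
by rewrite /mrestr /mscale setIC rE.
Qed.

Lemma independent_systems_pi (G1 G2 : set (set Omega)) :
  G1 `<=` measurable -> G1 setT -> setI_closed G1 ->
  G2 `<=` measurable -> G2 setT -> setI_closed G2 ->
  (forall A B, G1 A -> G2 B -> P (A `&` B) = (P A * P B)%E) ->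
  independent_systems G1 G2.
Proof.
move=> m1 T1 I1 m2 T2 I2 h A B GA GB.
have sm2 := smallest_sub (@sigma_algebra_measurable _ Omega) m2.
rewrite setIC muleC.
apply: (independent_from_pi _ m1) => // [|A' GA']; first exact: sm2.
rewrite setIC muleC; apply: (independent_from_pi _ m2) => //; first exact: m1.
by move=> B' GB'; exact: h.
Qed.

Section freeze.
Variables G1 G2 : set (set Omega).
Hypotheses (mG1 : G1 `<=` measurable) (mG2 : G2 `<=` measurable).
Hypothesis ind : independent_systems G1 G2.
Let T1 := g_sigma_algebraType G1.
Let T2 := g_sigma_algebraType G2.

Let mid (G : set (set Omega)) : G `<=` measurable ->
  mfunT (id : Omega -> g_sigma_algebraType G).
Proof.
move=> mG _ B mB; rewrite setTI preimage_id.
exact: (smallest_sub (@sigma_algebra_measurable _ Omega) mG).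
Qed.

Let m12 : mfunT ((fun w => (w, w)) : Omega -> T1 * T2).
Proof. by apply: measurable_fun_pair; exact: mid. Qed.

Let X1 : {mfun Omega >-> T1} := mfun_Sub (mem_set (mid mG1)).
Let X2 : {mfun Omega >-> T2} := mfun_Sub (mem_set (mid mG2)).
Let X12 : {mfun Omega >-> (T1 * T2)%type} := mfun_Sub (mem_set m12).

Variable phi : T1 * T2 -> \bar R.
Hypotheses (mphi : mfunT phi) (phi0 : forall z, (0 <= phi z)%E).

(** [T1] and [T2] are [Omega] with smaller sigma-algebras. Independence says exactly that the
    diagonal [w |-> (w, w)] pushes [P] to the product of its two restrictions; Tonelli then
    separates the two copies of [w]. *)
Lemma integral_independent :
  (\int[P]_w phi (w, w) = \int[P]_w \int[P]_w' phi (w, w'))%E.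
Proof.
transitivity (\int[distribution P X12]_z phi z)%E.
  by rewrite ge0_integral_distribution.
transitivity (\int[(distribution P X1 \x distribution P X2)%E]_z phi z)%E.
  apply: eq_measure_integral => A mA _; apply/esym.
  apply: product_measure_unique; last exact: mA.
  by move=> B1 B2 mB1 mB2; exact: (ind mB1 mB2).
rewrite fubini_tonelli1//= ge0_integral_distribution//; last 2 first.
- exact: measurable_fun_fubini_tonelli_F.
- by move=> x; apply: integral_ge0 => y _.
apply: eq_integral => w _; rewrite /= /fubini_F ge0_integral_distribution//.
exact: measurableT_comp.
Qed.

Lemma measurable_integral_independent :
  mfunT ((fun w => \int[P]_w' phi (w, w'))%E : T1 -> \bar R).
Proof.
have := measurable_fun_fubini_tonelli_F (m2 := distribution P X2) phi mphi phi0.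
apply: eq_measurable_fun => w _; rewrite /fubini_F ge0_integral_distribution//.
exact: measurableT_comp.
Qed.

End freeze.

Section family.
Context {I : eqType} (E : I -> set (set Omega)).
Hypotheses (ET : forall i, E i setT)
  (EI : forall i, setI_closed (E i)) (Em : forall i, E i `<=` measurable).
Hypothesis Eind : mutually_independent P E.

(** Finite intersections of events, one for each index of a duplicate-free list: a pi-system
    generating the sigma-algebra of all the [E i] with [i] in [J], on which mutual independence
    reads as a product formula. *)
Definition pi_family (J : set I) : set (set Omega) :=
  [set A | exists l (B : I -> set Omega), [/\ uniq l, (forall i, i \in l -> J i),
     (forall i, E i (B i)) & A = \bigcap_(i in [set` l]) B i]].

Let prob_bigcap l (B : I -> set Omega) : uniq l -> (forall i, E i (B i)) ->
  P (\bigcap_(i in [set` l]) B i) = (\prod_(i <- l) P (B i))%E.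
Proof.
move=> ul EB.
have inj : injective (tnth (in_tuple l)).
  case: l ul => [|x l] ul a b; first by case: a.
  rewrite !(tnth_nth x)/= => /eqP; rewrite nth_uniq//= ?ltn_ord// => /eqP.
  exact: val_inj.
have := Eind (B := fun k => B (tnth (in_tuple l) k)) inj (fun k => EB _).
rewrite -(big_tnth _ _ l xpredT (fun i => P (B i))) => <-; congr (P _).
apply/seteqP; split=> w h.
  by move=> k _; apply: h; rewrite /= mem_tnth.
move=> i /= /(tnthP (in_tuple l))[k ->]; exact: (h k).
Qed.

Lemma pi_family_sub J i A : J i -> E i A -> pi_family J A.
Proof.
move=> Ji EA; exists [:: i], (fun j => if j == i then A else setT); split => //.
- by move=> j; rewrite inE => /eqP ->.
- by move=> j; case: eqVneq => [->|].
- by rewrite set_cons1 bigcap_set1 eqxx.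
Qed.

Lemma pi_familyT J : pi_family J setT.
Proof. by exists [::], (fun=> setT); split => //; rewrite set_nil bigcap_set0. Qed.

Lemma pi_familyI J : setI_closed (pi_family J).
Proof.
move=> _ _ [l1 [B1 [u1 J1 E1 ->]]] [l2 [B2 [u2 J2 E2 ->]]].
(* Outside its own list each family imposes no condition, hence the default [setT]; indices of both
   lists carry the intersection of the two events. *)
exists (undup (l1 ++ l2)), (fun i => (if i \in l1 then B1 i else setT) `&`
  (if i \in l2 then B2 i else setT)); split.
- exact: undup_uniq.
- by move=> i; rewrite mem_undup mem_cat => /orP[/J1|/J2].
- by move=> i; apply: EI; case: ifP.
apply/seteqP; split=> w.
  by move=> [h1 h2] i _; split; case: ifP => // il; [apply: h1|apply: h2].
move=> h; split=> i /= il.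
  by have := h i; rewrite /= mem_undup mem_cat il => /(_ isT)[].
by have := h i; rewrite /= mem_undup mem_cat il orbT => /(_ isT)[_].
Qed.

Lemma pi_family_measurable J : pi_family J `<=` measurable.
Proof.
move=> _ [l [B [u Jl EB ->]]]; apply: fin_bigcap_measurable => // i _.
exact: Em.
Qed.

Lemma pi_family_independent (J1 J2 : set I) : J1 `&` J2 = set0 ->
  independent_systems (pi_family J1) (pi_family J2).
Proof.
move=> J12; apply: independent_systems_pi.
- exact: pi_family_measurable.
- exact: pi_familyT.
- exact: pi_familyI.
- exact: pi_family_measurable.
- exact: pi_familyT.
- exact: pi_familyI.
move=> _ _ [l1 [B1 [u1 h1 E1 ->]]] [l2 [B2 [u2 h2 E2 ->]]].
have dis i : i \in l2 -> (i \in l1) = false.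
  move=> /h2 i2; apply/negP => /h1 i1.
  by have : (J1 `&` J2) i by []; rewrite J12.
(* Disjointness of [J1] and [J2] lets one family carry both lists, so that the product formula
   applies to their concatenation. *)
pose B i := if i \in l1 then B1 i else B2 i.
have EB i : E i (B i) by rewrite /B; case: ifP.
have -> : \bigcap_(i in [set` l1]) B1 i = \bigcap_(i in [set` l1]) B i.
  by apply: eq_bigcapr => i /= il; rewrite /B il.
have -> : \bigcap_(i in [set` l2]) B2 i = \bigcap_(i in [set` l2]) B i.
  by apply: eq_bigcapr => i /= il; rewrite /B dis.
rewrite !prob_bigcap// -big_cat/= -prob_bigcap//.
  congr (P _); apply/seteqP; split=> w /=.
    by move=> [k1 k2] i /=; rewrite mem_cat => /orP[/k1|/k2].
  by move=> k; split=> i /= il; apply: k; rewrite /= mem_cat il ?orbT.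
by rewrite cat_uniq u1 u2 andbT; apply/hasPn => i /dis ->.
Qed.

End family.

End independence.

HB.instance Definition _ := gen_eqMixin source.

(** * The information carried by a set of draws *)

Section sources.
Context {R : realType} {dO dX dU : measure_display}.
Context {Omega : measurableType dO} {P : probability Omega R}.
Context {Xi : measurableType dX} {U : measurableType dU}.
Variable W : draws P Xi U.
Hypothesis ind : mutually_independent P (source_sigma W).

Lemma source_sigma_preimage s :
  exists (d' : measure_display) (T : measurableType d') (X : {mfun Omega >-> T}),
    source_sigma W s = g_sigma_algebra_preimage X.
Proof.
case: s => [j r i|j|j|j]; [exists dX, Xi, (sample W j r i)|
  exists _, nat, (epoch_length W j)|exists dU, U, (seed W j)|
  exists _, R, (sign W j)] => //.
Qed.

Lemma source_sigmaT s : source_sigma W s setT.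
Proof.
by have [d' [T [X ->]]] := source_sigma_preimage s; exists setT => //; rewrite setTI.
Qed.

Lemma source_sigmaI s : setI_closed (source_sigma W s).
Proof.
have [d' [T [X ->]]] := source_sigma_preimage s.
move=> _ _ [A mA <-] [B mB <-]; exists (A `&` B); first exact: measurableI.
by rewrite !setTI.
Qed.

Lemma source_sigma_measurable s : source_sigma W s `<=` measurable.
Proof.
have [d' [T [X ->]]] := source_sigma_preimage s.
by move=> _ [A mA <-]; rewrite setTI; exact: measurable_funPTI.
Qed.

(** Measurability on [history W J] is the formal meaning of being determined by the draws in [J].
    The points are still those of [Omega], so the same functions can be read on every history. *)
Definition history (J : set source) := g_sigma_algebraType (pi_family (source_sigma W) J).

Lemma measurable_from_history J (d' : measure_display) (T : measurableType d')
    (X : Omega -> T) :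
  mfunT (X : history J -> T) -> mfunT X.
Proof.
move=> mX _ B mB; have := mX measurableT B mB.
apply: (smallest_sub (@sigma_algebra_measurable _ Omega)).
exact: pi_family_measurable source_sigma_measurable _.
Qed.

Let measurable_source J s (d' : measure_display) (T : measurableType d') (X : Omega -> T) :
  J s -> (forall B, measurable B -> source_sigma W s (X @^-1` B)) ->
  mfunT (X : history J -> T).
Proof.
move=> Js XB _ B mB; rewrite setTI; apply: sub_sigma_algebra.
exact: (pi_family_sub source_sigmaT Js (XB B mB)).
Qed.

Lemma measurable_history_sample J j r i : J (SampleSrc j r i) ->
  mfunT (sample W j r i : history J -> Xi).
Proof. by move=> Js; apply: (measurable_source Js) => B mB; exists B; rewrite ?setTI. Qed.

Lemma measurable_history_length J j : J (LengthSrc j) ->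
  mfunT (epoch_length W j : history J -> nat).
Proof. by move=> Js; apply: (measurable_source Js) => B mB; exists B; rewrite ?setTI. Qed.

Lemma measurable_history_seed J j : J (SeedSrc j) ->
  mfunT (seed W j : history J -> U).
Proof. by move=> Js; apply: (measurable_source Js) => B mB; exists B; rewrite ?setTI. Qed.

Lemma measurable_history_sign J j : J (SignSrc j) ->
  mfunT (sign W j : history J -> R).
Proof. by move=> Js; apply: (measurable_source Js) => B mB; exists B; rewrite ?setTI. Qed.

Lemma measurable_history_batch J j r n : (forall i, (i < n)%N -> J (SampleSrc j r i)) ->
  mfunT ((fun w => batch W j r n w) : history J -> n.-tuple Xi).
Proof.
move=> Js; apply/measurable_fun_tnthP => i.
rewrite [X in measurable_fun _ X](_ : _ = (sample W j r i : history J -> Xi)).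
  by apply: measurable_history_sample; exact: Js.
by apply/funext => w; rewrite /= /batch tnth_mktuple.
Qed.

(* Fubini: the sources in J2 are averaged out while those in J1 stay frozen. *)
Lemma freeze J1 J2 (phi : history J1 * history J2 -> \bar R) :
  J1 `&` J2 = set0 -> mfunT phi -> (forall z, (0 <= phi z)%E) ->
  (\int[P]_w phi (w, w) = \int[P]_w \int[P]_w' phi (w, w'))%E.
Proof.
move=> J12; apply: integral_independent.
- exact: pi_family_measurable source_sigma_measurable _.
- exact: pi_family_measurable source_sigma_measurable _.
- exact: (pi_family_independent source_sigmaT source_sigmaI source_sigma_measurable ind J12).
Qed.

Lemma measurable_freeze J1 J2 (phi : history J1 * history J2 -> \bar R) :
  mfunT phi -> (forall z, (0 <= phi z)%E) ->
  mfunT ((fun w => \int[P]_w' phi (w, w'))%E : history J1 -> \bar R).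
Proof.
apply: measurable_integral_independent.
exact: pi_family_measurable source_sigma_measurable _.
Qed.

End sources.

(** * Mini-batch gradients and their quadratic functionals *)

Section minibatch.
Context {R : realType} {d : nat} {dX : measure_display} {Xi : measurableType dX}.
Variable f : 'rV[R]_d -> Xi -> R.
Hypothesis df : forall xi x, differentiable (f^~ xi) x.

Lemma differentiable_minibatch (s : seq Xi) x :
  differentiable (minibatch f s) x /\
  grad (minibatch f s) x = (size s)%:R^-1 *: \sum_(xi <- s) grad (f^~ xi) x.
Proof.
have [ds gs] : differentiable (fun y => \sum_(xi <- s) f y xi) x /\
    forall v, 'D_v (fun y => \sum_(xi <- s) f y xi) x = \sum_(xi <- s) 'D_v (f^~ xi) x.
  elim: s => [|xi s [IH1 IH2]].
    under eq_fun do rewrite big_nil; split; first exact: differentiable_cst.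
    by move=> v; rewrite big_nil derive_cst.
  have -> : (fun y => \sum_(z <- xi :: s) f y z) =
      f^~ xi + (fun y => \sum_(z <- s) f y z).
    by apply/funext => y; rewrite big_cons.
  split; first exact: differentiableD.
  by move=> v; rewrite deriveD ?big_cons ?IH2//; exact: diff_derivable.
have -> : minibatch f s = (size s)%:R^-1 \*: (fun y => \sum_(xi <- s) f y xi).
  by [].
split; first exact: differentiableZ.
apply/rowP => i; rewrite [LHS]mxE deriveZ; last exact: diff_derivable.
rewrite gs mxE summxE; congr (_ * _); apply: eq_bigr => xi _.
by rewrite mxE.
Qed.

Lemma grad_minibatch (s : seq Xi) x :
  grad (minibatch f s) x = (size s)%:R^-1 *: \sum_(xi <- s) grad (f^~ xi) x.
Proof. by have [] := differentiable_minibatch s x. Qed.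

End minibatch.

Section batches.
Context {R : realType} {d : nat} {dO dX dU : measure_display}.
Context {Omega : measurableType dO} {P : probability Omega R}.
Context {Xi : measurableType dX} {U : measurableType dU}.
Variables (D : probability Xi R) (W : draws P Xi U).
Hypothesis ind : mutually_independent P (source_sigma W).
Hypothesis law : forall j r i (B : set Xi), measurable B ->
  P (sample W j r i @^-1` B) = D B.

Lemma integral_sample j r i (g : Xi -> \bar R) : mfunT g ->
  (forall xi, (0 <= g xi)%E) ->
  (\int[P]_w g (sample W j r i w) = \int[D]_xi g xi)%E.
Proof.
move=> mg g0; rewrite -(ge0_integral_distribution (P := P) (sample W j r i))//.
by apply: eq_measure_integral => A mA _; exact: law.
Qed.

Lemma sum_batch (V : nmodType) j r n w (g : Xi -> V) :
  \sum_(xi <- batch W j r n w) g xi = \sum_(i < n) g (sample W j r i w).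
Proof. by rewrite big_tuple; apply: eq_bigr => i _; rewrite tnth_mktuple. Qed.

Section quadratic.
Variables (psi : Xi -> 'rV[R]_d) (s : R).
Hypothesis mpsi : mfunT (psi : Xi -> borel_rV R d).
Hypothesis ipsi : forall i, D.-integrable setT (EFin \o (fun xi => psi xi 0 i)).
Hypothesis psi0 : forall i, \int[D]_xi psi xi 0 i = 0.
Hypothesis psis : (\int[D]_xi (enorm (psi xi) ^+ 2)%:E <= s%:E)%E.

Let isqr : D.-integrable setT (EFin \o (fun xi => enorm (psi xi) ^+ 2)).
Proof.
have mE := measurable_enorm_sqr mpsi.
apply/integrableP; split; first exact/measurable_EFinP.
under eq_integral do rewrite /= ger0_norm ?sqr_ge0//.
by apply: le_lt_trans psis _; rewrite ltry.
Qed.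

(** As a polynomial in [psi xi], the majorant has the linear coefficient [l + 2 k z], which
    disappears because [psi] is centred; its quadratic part adds at most [k s]. *)
Let mean_quadratic (c k : R) (l z : 'rV[R]_d) (h : Xi -> R) : 0 <= k ->
  mfunT h ->
  (forall xi, 0 <= h xi <= c + dot l (z + psi xi) + k * enorm (z + psi xi) ^+ 2) ->
  (\int[D]_xi (h xi)%:E <= (c + k * s + dot l z + k * enorm z ^+ 2)%:E)%E.
Proof.
move=> k0 mh hb.
pose v := l + (2 * k) *: z; pose a := c + dot l z + k * enorm z ^+ 2.
have quadE xi : c + dot l (z + psi xi) + k * enorm (z + psi xi) ^+ 2 =
    a + dot (psi xi) v + k * enorm (psi xi) ^+ 2.
  rewrite /a /v enormD_sqr !dotDr dotZr (dotC l (psi xi)) (dotC z (psi xi)); ring.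
have [i1 e1] := integrable_dot v ipsi.
have i2 := integrableRZ k isqr.
have i3 := integrableRD (integrableRD (integrableR_cst D a) i1) i2.
apply: (@le_trans _ _ (\int[D]_xi (a + dot (psi xi) v + k * enorm (psi xi) ^+ 2)%:E)%E).
  apply: ge0_le_integral => //.
  - by move=> xi _; rewrite lee_fin; case/andP: (hb xi).
  - exact/measurable_EFinP.
  - exact: (measurable_int D i3).
  - by move=> xi _; rewrite lee_fin -quadE; case/andP: (hb xi).
have -> : (\int[D]_xi (a + dot (psi xi) v + k * enorm (psi xi) ^+ 2)%:E)%E =
    (\int[D]_xi (a + dot (psi xi) v + k * enorm (psi xi) ^+ 2))%:E.
  by rewrite /Rintegral fineK//; exact: integrable_fin_num i3.
rewrite RintegralD//; last by apply: integrableRD => //; exact: integrableR_cst.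
rewrite RintegralD//; last exact: integrableR_cst.
rewrite RintegralZl// Rintegral_cst//= probability_setT mulr1 e1.
have -> : \row_i \int[D]_xi psi xi 0 i = 0 by apply/rowP => i; rewrite !mxE psi0.
rewrite dot0l addr0 lee_fin.
have : \int[D]_xi enorm (psi xi) ^+ 2 <= s.
  by rewrite -lee_fin /Rintegral fineK//; exact: integrable_fin_num isqr.
by rewrite /a => hs; nra.
Qed.

(** Independent centred terms have variances that add up. The claim is stated for any nonnegative
    function below a quadratic, so that the potential after an SCSG step, of which only such an
    upper bound is known, can be averaged directly. *)
Lemma batch_quadratic j r n (h : 'rV[R]_d -> R) (c k : R) (l : 'rV[R]_d) : 0 <= k ->
  mfunT (h : borel_rV R d -> R) ->
  (forall z, 0 <= h z <= c + dot l z + k * enorm z ^+ 2) ->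
  (\int[P]_w (h (\sum_(i < n) psi (sample W j r i w)))%:E <= (c + k * (n%:R * s))%:E)%E.
Proof.
move=> k0; elim: n h c => [|n IH] h c mh hb.
  under eq_integral do rewrite big_ord0.
  rewrite integral_cst//= probability_setT mule1 lee_fin mul0r mulr0 addr0.
  by have /andP[_] := hb 0; rewrite dotC dot0l enorm0 expr0n/= mulr0 !addr0.
pose J1 := [set SampleSrc j r i | i in [set i | (i < n)%N]].
pose J2 := [set SampleSrc j r n].
have J12 : J1 `&` J2 = set0.
  by rewrite -subset0 => _ [[i /= ltin <-] [E]]; rewrite E ltnn in ltin.
pose Zn (w : Omega) : 'rV[R]_d := \sum_(i < n) psi (sample W j r i w).
have mZ (J : set source) : J1 `<=` J -> mfunT (Zn : history W J -> borel_rV R d).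
  move=> sJ; apply: measurable_rV_sum => i.
  apply: (measurableT_comp mpsi (g := sample W j r i : history W J -> Xi)).
  by apply: measurable_history_sample; apply: sJ; exists i => /=.
pose g (p : borel_rV R d * Xi) : \bar R := (h ((p.1 : 'rV[R]_d) + psi p.2))%:E.
have mg : mfunT g.
  apply/measurable_EFinP; apply: (measurableT_comp mh).
  apply: measurable_rVD; first exact: measurable_fst.
  exact: measurableT_comp.
have g0 p : (0 <= g p)%E by rewrite lee_fin; case/andP: (hb (p.1 + psi p.2)).
(* [H] is [h] with the last sample averaged out. It obeys a bound of the same shape, with the same
   [l] and [k] and with [c + k s] for [c]; this is what the induction on [n] consumes. *)
pose H := fubini_F D g.
have mH : mfunT H by exact: measurable_fun_fubini_tonelli_F.
have H0 z : (0 <= H z)%E by apply: integral_ge0 => xi _; exact: g0.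
have Hb z : (H z <= (c + k * s + dot l z + k * enorm z ^+ 2)%:E)%E.
  apply: (mean_quadratic (h := fun xi => h (z + psi xi)) k0); last first.
    by move=> xi; exact: hb.
  by apply/measurable_EFinP; exact: (measurableT_comp mg (pair1_measurable _)).
have Hfin z : H z \is a fin_num.
  by rewrite ge0_fin_numE//; apply: le_lt_trans (Hb z) _; rewrite ltry.
have -> : (\int[P]_w (h (\sum_(i < n.+1) psi (sample W j r i w)))%:E =
    \int[P]_w (fine (H (Zn w)))%:E)%E.
  pose phi (p : history W J1 * history W J2) : \bar R :=
    g (Zn p.1, sample W j r n p.2).
  transitivity (\int[P]_w phi (w, w))%E.
    by apply: eq_integral => w _; rewrite /phi /g/= big_ord_recr.
  rewrite (freeze ind J12).
  - apply: eq_integral => w _; rewrite fineK// /H /fubini_F /phi.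
    apply: (@integral_sample _ _ _ (fun xi => g (Zn w, xi))) => //.
    exact: (measurableT_comp mg (pair1_measurable _)).
  - apply: (measurableT_comp mg); apply: measurable_fun_pair.
      by apply: (measurableT_comp (mZ J1 _) measurable_fst).
    apply: (measurableT_comp _ measurable_snd).
    exact: measurable_history_sample.
  - by move=> p; exact: g0.
apply: le_trans (IH (fun z => fine (H z)) (c + k * s) _ _) _.
- exact: (measurableT_comp (fine_measurable _) mH).
- by move=> z; rewrite fine_ge0//= -lee_fin fineK.
by rewrite lee_fin -natr1; nra.
Qed.

End quadratic.

End batches.

(** * One inner step of the epoch *)

Section scsg_step.
Context {R : realType} {d : nat}.
Variables (F : 'rV[R]_d -> R) (L1 c' eta tau lam Fmin : R) (b : nat).
Hypotheses (L1_gt0 : 0 < L1) (eta_gt0 : 0 < eta) (tau_gt0 : 0 < tau) (tau_le1 : tau <= 1).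
Hypotheses (c'_gt0 : 0 < c') (c'_le : c' <= 1 / 6) (b_gt0 : (0 < b)%N).
Hypothesis etaE : eta * L1 = c' * tau ^+ 2.
Hypothesis lamE : lam = tau ^+ 3 / (12 * eta).
Variables x x0 g e h : 'rV[R]_d.
Hypothesis hE : h = g + e.
Hypothesis taylor : forall v, F (x + v) <= F x + dot g v + L1 / 2 * enorm v ^+ 2.

Let B := enorm (x - x0) ^+ 2.

(** Here [g] is the gradient at [x], [e] the error of the large batch at [x0], and [h = g + e] the
    mean of the SCSG direction. [step_const] bounds the potential after a step without mini-batch
    noise; [step_lin] is the coefficient of that noise, which averages out. *)
Definition step_const : R := F x - Fmin - eta * dot g h + L1 / 2 * eta ^+ 2 * enorm h ^+ 2
  + lam * (B - 2 * eta * dot h (x - x0) + eta ^+ 2 * enorm h ^+ 2).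

Definition step_lin : 'rV[R]_d := (- eta) *: g + (L1 * eta ^+ 2 + 2 * lam * eta ^+ 2) *: h
  - (2 * lam * eta) *: (x - x0).

(** The smoothness bound on [F] and the exact expansion of the square, sorted by degree in the noise
    [n]. *)
Lemma scsg_step_le n :
  F (x - eta *: (h + n)) - Fmin + lam * enorm (x - eta *: (h + n) - x0) ^+ 2
  <= step_const + dot step_lin n + (L1 / 2 + lam) * eta ^+ 2 * enorm n ^+ 2.
Proof.
have lE : dot step_lin n = - eta * dot g n + (L1 * eta ^+ 2 + 2 * lam * eta ^+ 2) * dot h n
    - 2 * lam * eta * dot (x - x0) n.
  by rewrite /step_lin !(dotDl, dotNl, dotZl); ring.
have := taylor (- (eta *: (h + n))); rewrite lE /step_const.
have -> : x - eta *: (h + n) - x0 = (x - x0) - eta *: (h + n) by rewrite addrAC.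
rewrite enormB_sqr !enormN !enormZ !exprMn !real_normK ?num_real// (enormD_sqr h n).
rewrite -/B !(dotDl, dotDr, dotNl, dotNr, dotZr) !(dotC h x) !(dotC h x0).
move: (F _) => T.
by lra.
Qed.

(** The added term is the variance of the mini-batch. The identity [2 <g,h> = |g|^2 + |h|^2 - |e|^2]
    supplies [- eta/2 |h|^2], which absorbs the shares [1/12], [1/6] and [1/12] from smoothness,
    Young and the quadratic part of the distance. In [5/9 = 1/2 + 1/18], the first part comes from
    Young and the second from the variance; being below 1, it leaves the growth per step below
    [1 + tau^3]. *)
Lemma scsg_step_const_le :
  step_const + (L1 / 2 + lam) * eta ^+ 2 * (L1 ^+ 2 * B / b%:R) <=
  F x - Fmin + lam * (1 + 5 / 9 * tau ^+ 3) * B + eta / 2 * enorm e ^+ 2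
  - eta / 2 * enorm g ^+ 2.
Proof.
rewrite /step_const.
set H := enorm h ^+ 2; set E := enorm e ^+ 2; set Gg := enorm g ^+ 2.
have H0 : 0 <= H by exact: sqr_ge0.
have B0 : 0 <= B by exact: sqr_ge0.
have ghE : dot g h = (Gg + H - E) / 2.
  have -> : E = enorm (h - g) ^+ 2 by rewrite /E hE addrAC subrr add0r.
  by rewrite enormB_sqr -/H -/Gg (dotC h g); field.
pose y := enorm h * enorm (x - x0).
have hx : - dot h (x - x0) <= y.
  by have := normr_dot_le h (x - x0); rewrite ler_norml => /andP[]; rewrite /y; lra.
have t3_gt0 : 0 < tau ^+ 3 by exact: exprn_gt0.
have t3_le1 : tau ^+ 3 <= 1 by rewrite exprn_ile1// ltW.
have lam_gt0 : 0 < lam by rewrite lamE divr_gt0// mulr_gt0.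
have eta_neq0 : eta != 0 by rewrite gt_eqF.
(* Young: the weight makes the resulting [H] coefficient of order [eta]. *)
have young : 2 * eta * y <= tau ^+ 3 / 2 * B + 2 * eta ^+ 2 / tau ^+ 3 * H.
  have := sqr_ge0 (tau ^+ 3 / 2 * enorm (x - x0) - eta * enorm h).
  move=> h1; rewrite -(ler_pM2l t3_gt0) mulrDr.
  have -> : tau ^+ 3 * (2 * eta ^+ 2 / tau ^+ 3 * H) = 2 * eta ^+ 2 * H.
    by field; rewrite gt_eqF.
  by rewrite /y /H /B; nra.
have k1 : lam * (2 * eta ^+ 2 / tau ^+ 3) = eta / 6.
  by rewrite lamE; field; rewrite gt_eqF// gt_eqF.
have k2 : lam * eta ^+ 2 = eta * tau ^+ 3 / 12 by rewrite lamE; field.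
have etaL : eta * L1 <= 1 / 6.
  rewrite etaE; apply: (@le_trans _ _ (c' * 1)); last by rewrite mulr1.
  by rewrite ler_pM2l// exprn_ile1// ltW.
have k3 : L1 / 2 * eta ^+ 2 <= eta / 12.
  have -> : L1 / 2 * eta ^+ 2 = eta / 2 * (eta * L1) by ring.
  by nra.
have b1 : b%:R^-1 <= 1 :> R by rewrite invf_le1 ?ler1n ?ltr0n.
have b0 : 0 < b%:R^-1 :> R by rewrite invr_gt0 ltr0n.
have k4 : (L1 / 2 + lam) * eta ^+ 2 * (L1 ^+ 2 * B / b%:R) <= lam * tau ^+ 3 / 18 * B.
  have -> : (L1 / 2 + lam) * eta ^+ 2 * (L1 ^+ 2 * B / b%:R) =
     ((L1 / 2 + lam) * (eta * L1) ^+ 2) * B * b%:R^-1 by ring.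
  have c3 : c' ^+ 3 <= 1 / 216.
    have -> : 1 / 216 = (1 / 6) ^+ 3 :> R by field.
    by rewrite lerXn2r ?nnegrE// ltW.
  have c2 : c' ^+ 2 <= 1 / 36.
    have -> : 1 / 36 = (1 / 6) ^+ 2 :> R by field.
    by rewrite lerXn2r ?nnegrE// ltW.
  (* After multiplication by [eta] both sides are multiples of [tau^6]; the comparison is
     [c'^3 / 2 <= 1/432], exactly the bound [c' <= 1/6]. *)
  have p1 : L1 / 2 * (eta * L1) ^+ 2 <= lam * tau ^+ 3 / 36.
    rewrite -(ler_pM2l eta_gt0).
    have -> : eta * (L1 / 2 * (eta * L1) ^+ 2) = (eta * L1) ^+ 3 / 2 by ring.
    rewrite etaE lamE.
    have -> : eta * (tau ^+ 3 / (12 * eta) * tau ^+ 3 / 36) = tau ^+ 6 / 432 by field.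
    have -> : (c' * tau ^+ 2) ^+ 3 / 2 = c' ^+ 3 * tau ^+ 6 / 2 by ring.
    have : 0 < tau ^+ 6 by exact: exprn_gt0.
    by move: (tau ^+ 6) (c' ^+ 3) c3 => u v c3 u0; nra.
  have p2 : lam * (eta * L1) ^+ 2 <= lam * tau ^+ 3 / 36.
    rewrite -mulrA ler_pM2l// etaE exprMn -exprM.
    have t4 : tau ^+ (2 * 2) <= tau ^+ 3 by rewrite [leLHS]exprS ler_piMl// ltW.
    have t40 : 0 <= tau ^+ (2 * 2) by apply: exprn_ge0; exact: ltW.
    by move: (tau ^+ (2 * 2)) (tau ^+ 3) (c' ^+ 2) c2 t4 t40 => u v w; nra.
  have p0 : 0 <= (L1 / 2 + lam) * (eta * L1) ^+ 2.
    by rewrite mulr_ge0 ?sqr_ge0// addr_ge0 ?divr_ge0 ?(ltW L1_gt0)// ltW.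
  apply: (@le_trans _ _ ((L1 / 2 + lam) * (eta * L1) ^+ 2 * B)).
    by rewrite ler_piMr// mulr_ge0.
  by rewrite ler_wpM2r//; lra.
have k5 : lam * (- (2 * eta * dot h (x - x0))) <=
    lam * (tau ^+ 3 / 2) * B + eta / 6 * H.
  rewrite -k1 -!mulrA -mulrDr ler_pM2l//; apply: le_trans (le_trans _ young) _.
    by rewrite -mulrN -mulrA -mulrN; nra.
  by apply: le_of_eq; ring.
have k6 : eta * tau ^+ 3 / 12 * H <= eta / 12 * H.
  by rewrite ler_wpM2r// ler_pM2r ?invr_gt0// ler_piMr// ltW.
have k7 : L1 / 2 * eta ^+ 2 * H <= eta / 12 * H by rewrite ler_wpM2r.
have k8 : 0 <= eta * H by rewrite mulr_ge0// ltW.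
have k9 : lam * eta ^+ 2 * H = eta * tau ^+ 3 / 12 * H by rewrite k2.
rewrite ghE.
apply: le_trans (lerD (lexx _) k4) _.
have -> : lam * (B - 2 * eta * dot h (x - x0) + eta ^+ 2 * H) =
  lam * B + lam * (- (2 * eta * dot h (x - x0))) + lam * eta ^+ 2 * H by ring.
by lra.
Qed.

End scsg_step.

Section scsg_one_step.
Context {R : realType} {d : nat} {dO dX dU : measure_display}.
Context {Omega : measurableType dO} {P : probability Omega R}.
Context {Xi : measurableType dX} {U : measurableType dU}.
Variables (D : probability Xi R) (f : 'rV[R]_d -> Xi -> R) (W : draws P Xi U).
Variables (L1 L2 Delta G V : R) (x1 : 'rV[R]_d).
Hypothesis sa : standing_assumptions D f L1 L2 Delta G V x1.
Hypothesis ind : mutually_independent P (source_sigma W).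
Hypothesis law : forall j r i (B : set Xi), measurable B ->
  P (sample W j r i @^-1` B) = D B.
Let F := objective D f.

Let df xi x : differentiable (f^~ xi) x.
Proof. by case: (sa_differentiable sa xi). Qed.

Let mgf x : mfunT ((fun xi => grad (f^~ xi) x) : Xi -> borel_rV R d).
Proof.
exact: (measurable_sample_grad sa (@measurable_id _ Xi setT)
  (measurable_cst (x : borel_rV R d))).
Qed.

Section centered.
Variables (phi : Xi -> 'rV[R]_d).
Hypothesis mphi : mfunT (phi : Xi -> borel_rV R d).
Hypothesis iphi : forall i, D.-integrable setT (EFin \o (fun xi => phi xi 0 i)).
Let mean : 'rV[R]_d := \row_i \int[D]_xi phi xi 0 i.

Lemma integrable_centered i :
  D.-integrable setT (EFin \o (fun xi => (phi xi - mean) 0 i)) /\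
  \int[D]_xi (phi xi - mean) 0 i = 0.
Proof.
have -> : (fun xi => (phi xi - mean) 0 i) =
    (fun xi => phi xi 0 i - (fun=> mean 0 i) xi).
  by apply/funext => xi; rewrite !mxE.
have ic := integrableR_cst D (mean 0 i).
split; first exact: integrableRB.
by rewrite RintegralB// Rintegral_cst//= probability_setT mulr1 mxE subrr.
Qed.

(** Expanding the square, the mean contributes [-2 |mean|^2 + |mean|^2 <= 0]. *)
Lemma centered_variance_le (s : R) : (forall xi, enorm (phi xi) ^+ 2 <= s) ->
  (\int[D]_xi (enorm (phi xi - mean) ^+ 2)%:E <= s%:E)%E.
Proof.
move=> phis.
have [i1 e1] := integrable_dot mean iphi.
have i2 := integrableRZ (-2) i1.
have i3 := integrableRD (integrableR_cst D (s + enorm mean ^+ 2)) i2.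
apply: (@le_trans _ _ (\int[D]_xi (s + enorm mean ^+ 2 + - 2 * dot (phi xi) mean)%:E)%E).
  apply: ge0_le_integral => //.
  - by move=> xi _; rewrite lee_fin sqr_ge0.
  - apply/measurable_EFinP; apply: measurable_enorm_sqr.
    by apply: measurable_rVB => //; exact: measurable_cst.
  - exact: (measurable_int D i3).
  - by move=> xi _; rewrite lee_fin enormB_sqr; have := phis xi; lra.
have -> : (\int[D]_xi (s + enorm mean ^+ 2 + - 2 * dot (phi xi) mean)%:E)%E =
    (\int[D]_xi (s + enorm mean ^+ 2 + - 2 * dot (phi xi) mean))%:E.
  by rewrite /Rintegral fineK//; exact: integrable_fin_num i3.
rewrite RintegralD//; last exact: integrableR_cst.
rewrite RintegralZl// Rintegral_cst//= probability_setT mulr1 e1 -/mean.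
rewrite lee_fin -enorm_sqr.
by have := sqr_ge0 (enorm mean); lra.
Qed.

End centered.

Section step.
Variables (c' eta tau lam Fmin : R) (b : nat).
Hypotheses (L1_gt0 : 0 < L1) (eta_gt0 : 0 < eta) (tau_gt0 : 0 < tau) (tau_le1 : tau <= 1).
Hypotheses (c'_gt0 : 0 < c') (c'_le : c' <= 1 / 6) (b_gt0 : (0 < b)%N).
Hypothesis etaE : eta * L1 = c' * tau ^+ 2.
Hypothesis lamE : lam = tau ^+ 3 / (12 * eta).
Hypothesis FminP : forall x, Fmin <= F x.

Let lam_ge0 : 0 <= lam.
Proof. by rewrite lamE divr_ge0 ?exprn_ge0 ?mulr_ge0 ?(ltW eta_gt0) ?(ltW tau_gt0). Qed.

(** Variance reduction: the noise comes from differences of sample gradients at [x] and [x0], so its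
    second moment is at most [L1^2 |x - x0|^2], a quantity that the potential controls. The error
    [e] of the large batch is frozen here. *)
Lemma scsg_one_step j r (x x0 e : 'rV[R]_d) :
  (\int[P]_w (F (x - eta *: (grad (minibatch f (batch W j r b w)) x
                - grad (minibatch f (batch W j r b w)) x0 + (grad F x0 + e))) - Fmin
     + lam * enorm (x - eta *: (grad (minibatch f (batch W j r b w)) x
                - grad (minibatch f (batch W j r b w)) x0 + (grad F x0 + e)) - x0) ^+ 2)%:E
   <= (F x - Fmin + lam * (1 + 5 / 9 * tau ^+ 3) * enorm (x - x0) ^+ 2
       + eta / 2 * enorm e ^+ 2 - eta / 2 * enorm (grad F x) ^+ 2)%:E)%E.
Proof.
pose phi xi := grad (f^~ xi) x - grad (f^~ xi) x0.
have iphi i : D.-integrable setT (EFin \o (fun xi => phi xi 0 i)).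
  have := integrableRB (integrable_sample_grad sa x i) (integrable_sample_grad sa x0 i).
  by congr (integrable _ _ _); apply/funext => xi; rewrite /= !mxE.
have mphi : mfunT (phi : Xi -> borel_rV R d) by exact: measurable_rVB.
have meanE : \row_i \int[D]_xi phi xi 0 i = grad F x - grad F x0.
  rewrite !(grad_objective sa); apply/rowP => i; rewrite !mxE.
  rewrite -RintegralB//; [|exact: integrable_sample_grad sa _ _..].
  by apply: eq_Rintegral => xi _; rewrite !mxE.
pose psi xi := phi xi - (grad F x - grad F x0).
have phi_le xi : enorm (phi xi) ^+ 2 <= L1 ^+ 2 * enorm (x - x0) ^+ 2.
  rewrite -exprMn lerXn2r// ?nnegrE ?mulr_ge0 ?enorm_ge0 ?(ltW L1_gt0)//.
  exact: sa_grad_lipschitz sa xi x x0.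
have bR : b%:R != 0 :> R by rewrite pnatr_eq0 -lt0n.
pose h := grad F x + e.
pose q (z : 'rV[R]_d) := F (x - eta *: (h + b%:R^-1 *: z)) - Fmin
   + lam * enorm (x - eta *: (h + b%:R^-1 *: z) - x0) ^+ 2.
(* The SCSG direction is its mean [h] plus the average of the centred terms [psi]. *)
have stepE w : grad (minibatch f (batch W j r b w)) x
    - grad (minibatch f (batch W j r b w)) x0 + (grad F x0 + e) =
    h + b%:R^-1 *: \sum_(i < b) psi (sample W j r i w).
  rewrite !(grad_minibatch df) size_tuple !sum_batch.
  set m := grad F x - grad F x0.
  have bm : b%:R^-1 *: (m *+ b) = m by rewrite -[m *+ b]scaler_nat scalerA mulVf ?scale1r.
  have -> : \sum_(i < b) psi (sample W j r i w) =
      \sum_(i < b) grad (f^~ (sample W j r i w)) x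
      - \sum_(i < b) grad (f^~ (sample W j r i w)) x0 - m *+ b.
    by rewrite /psi -/m sumrB /phi sumrB sumr_const card_ord.
  rewrite !scalerBr bm /m /h.
  by apply/rowP => i; rewrite !mxE; ring.
have mq : mfunT (q : borel_rV R d -> R).
  have mX : mfunT (fun z : borel_rV R d =>
      x - eta *: (h + b%:R^-1 *: (z : 'rV[R]_d)) : borel_rV R d).
    apply: measurable_rVB; first exact: measurable_cst.
    apply: (@measurable_rVZ _ _ _ _ (cst eta)) => //.
    apply: measurable_rVD; first exact: measurable_cst.
    by apply: (@measurable_rVZ _ _ _ _ (cst b%:R^-1)) => //; exact: measurable_id.
  apply: measurable_funD.
    by apply: measurable_funB => //; exact: (measurable_objective sa mX).
  apply: measurable_funM => //; apply: measurable_enorm_sqr.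
  by apply: measurable_rVB => //; exact: measurable_cst.
pose S := step_const F L1 eta lam Fmin x x0 (grad F x) h.
pose l := step_lin L1 eta lam x x0 (grad F x) h.
pose k := (L1 / 2 + lam) * eta ^+ 2.
have k0 : 0 <= k by rewrite mulr_ge0 ?sqr_ge0// addr_ge0// divr_ge0// ltW.
have qle z : 0 <= q z <= S + dot (b%:R^-1 *: l) z + k * b%:R^-1 ^+ 2 * enorm z ^+ 2.
  apply/andP; split.
    by rewrite addr_ge0 ?subr_ge0// mulr_ge0// sqr_ge0.
  have := scsg_step_le eta lam Fmin x0 h (objective_taylor sa x) (b%:R^-1 *: z).
  rewrite enormZ exprMn real_normK ?num_real// dotZr dotZl => /le_trans; apply.
  by rewrite /S /l /k -!mulrA.
have kb0 : 0 <= k * b%:R^-1 ^+ 2 by rewrite mulr_ge0 ?sqr_ge0.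
have [ip mp] : (forall i, D.-integrable setT (EFin \o (fun xi => psi xi 0 i))) /\
    (forall i, \int[D]_xi psi xi 0 i = 0).
  by split=> i; have [] := integrable_centered iphi i; rewrite meanE.
have vp : (\int[D]_xi (enorm (psi xi) ^+ 2)%:E <= (L1 ^+ 2 * enorm (x - x0) ^+ 2)%:E)%E.
  by have := centered_variance_le mphi iphi phi_le; rewrite meanE.
have mpsi : mfunT (psi : Xi -> borel_rV R d).
  by apply: measurable_rVB => //; exact: measurable_cst.
under eq_integral do rewrite stepE.
apply: le_trans (batch_quadratic ind law mpsi ip mp vp j r b kb0 mq qle) _.
rewrite lee_fin.
have := scsg_step_const_le F Fmin L1_gt0 eta_gt0 tau_gt0 tau_le1 c'_gt0 c'_le b_gt0
  etaE lamE x x0 (erefl h).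
apply: le_trans; rewrite /S -/k; apply: lerD => //.
by apply: le_of_eq; field.
Qed.

End step.
End scsg_one_step.

(** Since [1 - q = q t], the weights are those of a stopping time of mean [1 / t]: a per-step error
    [E] accumulates to [E / t], and a sum of the [g k] along the path becomes [1 / t] times the mean
    of [g] at the stopped index. The growth of [b] is harmless because [q * (1 + 5/9 * t) <= 1]. *)
Lemma geometric_descent (R : realType) (a b g : nat -> R) (t q E : R) :
  0 < t -> q = (1 + t)^-1 -> (forall k, 0 <= b k) -> (forall k, 0 <= a k) -> b 0%N = 0 ->
  0 <= E ->
  (forall k, a k.+1 + b k.+1 + g k <= a k + (1 + 5 / 9 * t) * b k + E) ->
  forall n, \sum_(k < n) q ^+ k * (1 - q) * (a k + g k / t) <= a 0%N + E / t.
Proof.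
move=> t0 qE b0 a0 b00 E0 step n.
have t1 : 1 + t != 0 by rewrite gt_eqF// addr_gt0.
have q0 : 0 < q by rewrite qE invr_gt0 addr_gt0.
have qt : 1 - q = q * t by rewrite qE; field.
(* The quantity that telescopes also keeps the mass [q ^+ n] not yet stopped, multiplied by the full
   potential [a n + b n]. *)
suff : \sum_(k < n) q ^+ k * (1 - q) * (a k + g k / t) + q ^+ n * (a n + b n) <=
    a 0%N + (1 - q ^+ n) * (E / t).
  have h1 : 0 <= q ^+ n * (a n + b n) by rewrite mulr_ge0 ?addr_ge0// exprn_ge0// ltW.
  have h2 : 0 <= q ^+ n * (E / t) by rewrite mulr_ge0 ?divr_ge0 ?exprn_ge0// ltW.
  by lra.
elim: n => [|n IH]; first by rewrite big_ord0 expr0 b00; lra.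
rewrite big_ord_recr/=.
have qn0 : 0 < q ^+ n by exact: exprn_gt0.
suff : q ^+ n * (1 - q) * (a n + g n / t) + q ^+ n.+1 * (a n.+1 + b n.+1) <=
    q ^+ n * (a n + b n) + (q ^+ n - q ^+ n.+1) * (E / t) by lra.
rewrite exprSr.
have -> : (q ^+ n - q ^+ n * q) * (E / t) = q ^+ n * (q * E).
  have -> : (q ^+ n - q ^+ n * q) * (E / t) = q ^+ n * ((1 - q) * (E / t)) by ring.
  by rewrite qt; field; rewrite gt_eqF.
have -> : q ^+ n * (1 - q) * (a n + g n / t) = q ^+ n * ((1 - q) * a n + q * g n).
  rewrite -mulrA mulrDr; congr (_ * (_ + _)).
  by rewrite qt; field; rewrite gt_eqF.
rewrite -mulrA -!mulrDr ler_pM2l//.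
have : q * (a n.+1 + b n.+1 + g n) <= q * (a n + (1 + 5 / 9 * t) * b n + E).
  by rewrite ler_pM2l.
have -> : q * (a n + (1 + 5 / 9 * t) * b n + E) =
   q * a n + q * b n + 5 / 9 * (q * t) * b n + q * E by ring.
rewrite -qt => h.
have : 0 <= (1 - q) * b n by rewrite qt mulr_ge0// mulr_ge0// ltW.
lra.
Qed.

Section integral_real.
Context {R : realType} {dO : measure_display} {T : measurableType dO}.
Variable P : {measure set T -> \bar R}.
Implicit Types g h : T -> R.

Lemma ge0_integralRD g h : mfunT g -> mfunT h ->
  (forall w, 0 <= g w) -> (forall w, 0 <= h w) ->
  (\int[P]_w (g w + h w)%:E = \int[P]_w (g w)%:E + \int[P]_w (h w)%:E)%E.
Proof.
move=> mg mh g0 h0; under eq_integral do rewrite EFinD.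
rewrite ge0_integralD//; try exact/measurable_EFinP; by move=> w _; rewrite lee_fin.
Qed.

Lemma ge0_integralRZ (a : R) g : mfunT g -> 0 <= a -> (forall w, 0 <= g w) ->
  (\int[P]_w (a * g w)%:E = a%:E * \int[P]_w (g w)%:E)%E.
Proof.
move=> mg a0 g0; under eq_integral do rewrite EFinM.
rewrite ge0_integralZl_EFin//; first by move=> w _; rewrite lee_fin.
exact/measurable_EFinP.
Qed.

Lemma ge0_le_integralR (g : T -> \bar R) h : mfunT g ->
  mfunT h -> (forall w, (0 <= g w)%E) -> (forall w, (g w <= (h w)%:E)%E) ->
  (\int[P]_w g w <= \int[P]_w (h w)%:E)%E.
Proof.
by move=> mg mh g0 gh; apply: ge0_le_integral => //; exact/measurable_EFinP.
Qed.

End integral_real.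

Section measurable_batches.
Context {R : realType} {d : nat} {dX : measure_display} {Xi : measurableType dX}.
Variables (D : probability Xi R) (f : 'rV[R]_d -> Xi -> R).
Variables (L1 L2 Delta G V : R) (x1 : 'rV[R]_d).
Hypothesis sa : standing_assumptions D f L1 L2 Delta G V x1.
Context {dT : measure_display} {T : measurableType dT}.

Lemma measurable_grad_minibatch n (Z : T -> n.-tuple Xi) (Y : T -> borel_rV R d) :
  mfunT Z -> mfunT Y ->
  mfunT (fun t => grad (minibatch f (Z t)) (Y t) : borel_rV R d).
Proof.
move=> mZ mY.
have df xi x : differentiable (f^~ xi) x by case: (sa_differentiable sa xi).
under eq_fun do rewrite (grad_minibatch df) size_tuple big_tuple.
apply: (@measurable_rVZ _ _ _ _ (cst n%:R^-1)) => //.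
apply: measurable_rV_sum => i.
apply: (measurable_sample_grad sa (Z := fun t => tnth (Z t) i)) => //.
exact: (measurableT_comp (measurable_tnth i)).
Qed.

Lemma measurable_scsg_step (a : R) m b (S : T -> m.-tuple Xi) (B : T -> b.-tuple Xi)
    (X Y : T -> borel_rV R d) :
  mfunT S -> mfunT B ->
  mfunT X -> mfunT Y ->
  mfunT (fun t => (Y t : 'rV[R]_d) - a *: (grad (minibatch f (B t)) (Y t)
    - grad (minibatch f (B t)) (X t) + grad (minibatch f (S t)) (X t)) : borel_rV R d).
Proof.
move=> mS mB mX mY; apply: measurable_rVB => //.
apply: (@measurable_rVZ _ _ _ _ (cst a)) => //.
apply: measurable_rVD; last exact: (measurable_grad_minibatch mS mX).
apply: measurable_rVB; first exact: (measurable_grad_minibatch mB mY).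
exact: (measurable_grad_minibatch mB mX).
Qed.

End measurable_batches.

Section measurable_draws.
Context {R : realType} {d : nat} {dO dX dU : measure_display}.
Context {Omega : measurableType dO} {P : probability Omega R}.
Context {Xi : measurableType dX} {U : measurableType dU}.
Variables (D : probability Xi R) (f : 'rV[R]_d -> Xi -> R) (W : draws P Xi U).
Variables (L1 L2 Delta G V : R) (x1 : 'rV[R]_d).
Hypothesis sa : standing_assumptions D f L1 L2 Delta G V x1.
Context {dT : measure_display} {T : measurableType dT}.

(* [om t] is the point of Omega from which the draws are read: taking for T a
   product of histories lets independent parts of a run vary separately. *)
Variable om : T -> Omega.

Lemma measurable_batch_at j r n :
  (forall i, mfunT (fun t => sample W j r i (om t))) ->
  mfunT (fun t => batch W j r n (om t)).
Proof.
move=> h; apply/measurable_fun_tnthP => i.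
rewrite [X in measurable_fun _ X](_ : _ = (fun t => sample W j r i (om t))) //.
by apply/funext => t; rewrite /= tnth_mktuple.
Qed.

Lemma measurable_scsg_iter c' j m1 b (X : T -> borel_rV R d) k :
  mfunT X ->
  (forall i, mfunT (fun t => sample W j Epoch i (om t))) ->
  (forall k' i, (k' <= k)%N -> mfunT (fun t => sample W j (Inner k') i (om t))) ->
  mfunT (fun t => scsg_iter f L1 c' (batch W j Epoch m1 (om t)) b
    (fun k' => batch W j (Inner k') b (om t)) (X t) k : borel_rV R d).
Proof.
move=> mX mE; elim: k => [//|k IH] mI.
have mk : mfunT (fun t => scsg_iter f L1 c' (batch W j Epoch m1 (om t)) b
    (fun k' => batch W j (Inner k') b (om t)) (X t) k : borel_rV R d).
  by apply: IH => k' i kk'; apply: mI; exact: leqW.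
have mB : mfunT (fun t => batch W j (Inner k.+1) b (om t)).
  by apply: measurable_batch_at => i; exact: mI.
have mS : mfunT (fun t => batch W j Epoch m1 (om t)).
  exact: measurable_batch_at.
(* The step size depends on the batch through its size only; evaluating it at an arbitrary [point]
   makes it a constant. *)
have := measurable_scsg_step sa (scsg_stepsize L1 c' (batch W j Epoch m1 (om point)) b)
  mS mB mX mk.
apply: eq_measurable_fun => t _ /=.
by rewrite /scsg_stepsize !size_tuple.
Qed.

End measurable_draws.

(** * The inner loop for a fixed number of steps *)

Section scsg_chain.
Context {R : realType} {d : nat} {dO dX dU : measure_display}.
Context {Omega : measurableType dO} {P : probability Omega R}.
Context {Xi : measurableType dX} {U : measurableType dU}.
Variables (D : probability Xi R) (f : 'rV[R]_d -> Xi -> R) (W : draws P Xi U).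
Variables (L1 L2 Delta G V : R) (x1 : 'rV[R]_d).
Hypothesis L2_ge0 : 0 <= L2.
Hypothesis sa : standing_assumptions D f L1 L2 Delta G V x1.
Hypothesis ind : mutually_independent P (source_sigma W).
Hypothesis law : forall j r i (B : set Xi), measurable B ->
  P (sample W j r i @^-1` B) = D B.
Let F := objective D f.
Variables (c' eta tau Fmin : R) (m1 b : nat).
Hypotheses (L1_gt0 : 0 < L1) (eta_gt0 : 0 < eta) (tau_gt0 : 0 < tau) (tau_le1 : tau <= 1).
Hypotheses (c'_gt0 : 0 < c') (c'_le : c' <= 1 / 6) (b_gt0 : (0 < b)%N) (m1_gt0 : (0 < m1)%N).
Hypothesis etaE : eta * L1 = c' * tau ^+ 2.
Hypothesis stepE : forall S1 : m1.-tuple Xi, scsg_stepsize L1 c' S1 b = eta.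
Hypothesis FminP : forall x, Fmin <= F x.
Variables (j : nat) (x : 'rV[R]_d).

Let lam := tau ^+ 3 / (12 * eta).
Let lam_ge0 : 0 <= lam.
Proof. by rewrite divr_ge0 ?exprn_ge0 ?mulr_ge0 ?(ltW eta_gt0) ?(ltW tau_gt0). Qed.

Definition scsg_point (k : nat) (w : Omega) : 'rV[R]_d :=
  scsg_iter f L1 c' (batch W j Epoch m1 w) b (fun k' => batch W j (Inner k') b w) x k.

Let e1 w := grad (minibatch f (batch W j Epoch m1 w)) x - grad F x.

Let A k w := F (scsg_point k w) - Fmin.
Let B k w := lam * enorm (scsg_point k w - x) ^+ 2.
Let H k w := eta / 2 * enorm (grad F (scsg_point k w)) ^+ 2.
Let E w := eta / 2 * enorm (e1 w) ^+ 2.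

Let A0 k w : 0 <= A k w. Proof. by rewrite subr_ge0. Qed.
Let B0 k w : 0 <= B k w. Proof. by rewrite mulr_ge0// sqr_ge0. Qed.
Let H0 k w : 0 <= H k w.
Proof. by rewrite mulr_ge0 ?sqr_ge0// divr_ge0// ltW. Qed.
Let E0 w : 0 <= E w.
Proof. by rewrite mulr_ge0 ?sqr_ge0// divr_ge0// ltW. Qed.

Definition epoch_past k : set source := [set s | (exists i, s = SampleSrc j Epoch i) \/
  (exists k' i, (k' <= k)%N /\ s = SampleSrc j (Inner k') i)].
Definition epoch_next k : set source := [set s | exists i, s = SampleSrc j (Inner k.+1) i].

Let past_next k : epoch_past k `&` epoch_next k = set0.
Proof.
rewrite -subset0 => _ [[[i ->]|[k' [i [kk' ->]]]] [i' []]]//.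
by move=> E' _; rewrite E' ltnn in kk'.
Qed.

Let measurable_point k (J : set source) : epoch_past k `<=` J ->
  mfunT (scsg_point k : history W J -> borel_rV R d).
Proof.
move=> sJ; rewrite /scsg_point.
have mE i : mfunT ((fun w => sample W j Epoch i w) : history W J -> Xi).
  by apply: measurable_history_sample; apply: sJ; left; exists i.
have mI k' i : (k' <= k)%N ->
    mfunT ((fun w => sample W j (Inner k') i w) : history W J -> Xi).
  by move=> kk'; apply: measurable_history_sample; apply: sJ; right; exists k', i.
exact: (@measurable_scsg_iter _ _ _ _ _ _ _ _ _ _ f W _ _ _ _ _ _ sa _ (history W J)
  (fun w => w) c' j m1 b (cst (x : borel_rV R d)) k (measurable_cst _) mE mI).
Qed.

Let measurable_epoch_batch (J : set source) : epoch_past 0 `<=` J ->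
  mfunT ((fun w => batch W j Epoch m1 w) : history W J -> m1.-tuple Xi).
Proof. by move=> sJ; apply: measurable_history_batch => i _; apply: sJ; left; exists i. Qed.

Let mpt k : mfunT (scsg_point k : Omega -> borel_rV R d).
Proof. by apply: (measurable_from_history (W := W) (J := epoch_past k)); exact: measurable_point. Qed.

Let mA k : mfunT (A k).
Proof. by apply: measurable_funB => //; exact: (measurable_objective sa (mpt k)). Qed.

Let mB k : mfunT (B k).
Proof.
apply: measurable_funM => //; apply: measurable_enorm_sqr.
by apply: measurable_rVB => //; exact: measurable_cst.
Qed.

Let mH k : mfunT (H k).
Proof.
apply: measurable_funM => //; apply: measurable_enorm_sqr.
exact: (measurable_grad_objective L2_ge0 sa (mpt k)).
Qed.

Let mE : mfunT E.
Proof.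
apply: measurable_funM => //; apply: measurable_enorm_sqr.
apply: measurable_rVB; last exact: measurable_cst.
apply: (measurable_grad_minibatch sa); last exact: measurable_cst.
by apply: (measurable_from_history (W := W) (J := epoch_past 0)); exact: measurable_epoch_batch.
Qed.

(** Variance of an average of [m1] independent centred gradients, read from [batch_quadratic] for
    the pure quadratic with [k = eta / 2 / m1^2]. *)
Let E_le : (\int[P]_w (E w)%:E <= (eta / 2 * (V / m1%:R))%:E)%E.
Proof.
have df xi y : differentiable (f^~ xi) y by case: (sa_differentiable sa xi).
pose phi xi := grad (f^~ xi) x.
have mphi : mfunT (phi : Xi -> borel_rV R d).
  exact: (measurable_sample_grad sa (@measurable_id _ Xi setT)
    (measurable_cst (x : borel_rV R d))).
have [ip mp] : (forall i, D.-integrable setT (EFin \o (fun xi => (phi xi - grad F x) 0 i))) /\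
    (forall i, \int[D]_xi (phi xi - grad F x) 0 i = 0).
  have iphi i := integrable_sample_grad sa x i.
  by split=> i; have [] := integrable_centered iphi i; rewrite -(grad_objective sa).
have mpsi : mfunT ((fun xi => phi xi - grad F x) : Xi -> borel_rV R d).
  by apply: measurable_rVB => //; exact: measurable_cst.
have m1R : m1%:R != 0 :> R by rewrite pnatr_eq0 -lt0n.
pose k := eta / 2 * m1%:R^-1 ^+ 2.
have k0 : 0 <= k by rewrite mulr_ge0 ?sqr_ge0// divr_ge0// ltW.
have mh : mfunT ((fun z : 'rV[R]_d => k * enorm z ^+ 2) : borel_rV R d -> R).
  by apply: measurable_funM => //; apply: measurable_enorm_sqr; exact: measurable_id.
have hb (z : 'rV[R]_d) : 0 <= k * enorm z ^+ 2 <= 0 + dot 0 z + k * enorm z ^+ 2.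
  by rewrite dot0l !add0r lexx andbT mulr_ge0// sqr_ge0.
have := batch_quadratic ind law mpsi ip mp (sa_variance sa x) j Epoch m1 k0 mh hb.
rewrite add0r; have -> : k * (m1%:R * V) = eta / 2 * (V / m1%:R) by rewrite /k; field.
apply: le_trans; apply: le_of_eq.
apply: eq_integral => w _; congr EFin; rewrite /E /e1 (grad_minibatch df) size_tuple sum_batch.
rewrite sumrB sumr_const card_ord.
set S := \sum_(i < m1) _.
have -> : m1%:R^-1 *: S - grad F x = m1%:R^-1 *: (S - grad F x *+ m1).
  by rewrite scalerBr -[grad F x *+ m1]scaler_nat scalerA mulVf ?scale1r.
by rewrite enormZ exprMn real_normK ?num_real// /k mulrA.
Qed.

Let scsg_pointS k w : scsg_point k.+1 w = scsg_point k w - eta *: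
  (grad (minibatch f (batch W j (Inner k.+1) b w)) (scsg_point k w)
   - grad (minibatch f (batch W j (Inner k.+1) b w)) x
   + grad (minibatch f (batch W j Epoch m1 w)) x).
Proof. by rewrite -(stepE (batch W j Epoch m1 w)). Qed.

(** Draws up to step [k] are frozen and the next mini-batch is averaged. The gradient term stands on
    the left, so only nonnegative integrals are added and the inequality makes sense before any of
    them is known to be finite. *)
Let chain_step k :
  (\int[P]_w (A k.+1 w)%:E + \int[P]_w (B k.+1 w)%:E + \int[P]_w (H k w)%:E <=
   \int[P]_w (A k w)%:E + (1 + 5 / 9 * tau ^+ 3)%:E * \int[P]_w (B k w)%:E
   + \int[P]_w (E w)%:E)%E.
Proof.
pose Z (p : history W (epoch_past k) * history W (epoch_next k)) : 'rV[R]_d :=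
  scsg_point k p.1 - eta *:
  (grad (minibatch f (batch W j (Inner k.+1) b p.2)) (scsg_point k p.1)
   - grad (minibatch f (batch W j (Inner k.+1) b p.2)) x
   + grad (minibatch f (batch W j Epoch m1 p.1)) x).
pose phi p := (F (Z p) - Fmin + lam * enorm (Z p - x) ^+ 2)%:E.
have mZ : mfunT (Z : _ -> borel_rV R d).
  apply: (measurable_scsg_step sa eta (S := fun p : history W (epoch_past k) * history W (epoch_next k) => batch W j Epoch m1 p.1)
    (B := fun p => batch W j (Inner k.+1) b p.2) (X := cst x) (Y := fun p => scsg_point k p.1)).
  - apply: (measurableT_comp _ measurable_fst); apply: measurable_epoch_batch.
    by move=> s [[i ->]|[k' [i [k0 ->]]]]; [left; exists i|right; exists k', i;
      split => //; exact: leq_trans k0 _].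
  - apply: (measurableT_comp (f := fun w : history W (epoch_next k) => batch W j (Inner k.+1) b w) _ measurable_snd).
    by apply: measurable_history_batch => i _; exists i.
  - exact: measurable_cst.
  - by apply: (measurableT_comp _ measurable_fst); exact: measurable_point.
have mphi : mfunT phi.
  apply/measurable_EFinP; apply: measurable_funD.
    by apply: measurable_funB => //; exact: (measurable_objective sa mZ).
  apply: measurable_funM => //; apply: measurable_enorm_sqr.
  by apply: measurable_rVB => //; exact: measurable_cst.
have phi0 p : (0 <= phi p)%E.
  by rewrite lee_fin addr_ge0 ?subr_ge0// mulr_ge0// sqr_ge0.
have inner w : (\int[P]_w' phi (w, w') <=
   (A k w + (1 + 5 / 9 * tau ^+ 3) * B k w + E w - H k w)%:E)%E.
  have := scsg_one_step sa ind law L1_gt0 eta_gt0 tau_gt0 tau_le1 c'_gt0 c'_le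
    b_gt0 etaE (erefl lam) FminP j (Inner k.+1) (scsg_point k w) x (e1 w).
  have -> : grad (objective D f) x + e1 w = grad (minibatch f (batch W j Epoch m1 w)) x.
    by rewrite /e1 addrC subrK.
  move=> /le_trans; apply; rewrite lee_fin /A /B /E /H.
  by apply: le_of_eq; rewrite -/F; ring.
have diagE : (\int[P]_w (A k.+1 w)%:E + \int[P]_w (B k.+1 w)%:E =
    \int[P]_w \int[P]_w' phi (w, w'))%E.
  rewrite -(ge0_integralRD P (mA _) (mB _) (A0 _) (B0 _)).
  transitivity (\int[P]_w phi (w, w))%E; last exact: (freeze ind (@past_next k) mphi phi0).
  by apply: eq_integral => w _; rewrite /A /B scsg_pointS.
have minner : mfunT ((fun w => \int[P]_w' phi (w, w'))%E : Omega -> \bar R).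
  by apply: (measurable_from_history (W := W) (J := epoch_past k)); exact: measurable_freeze mphi phi0.
have inner0 w : (0 <= \int[P]_w' phi (w, w'))%E by apply: integral_ge0 => w' _.
rewrite diagE.
have c0 : 0 <= 1 + 5 / 9 * tau ^+ 3.
  by rewrite addr_ge0// mulr_ge0// exprn_ge0// ltW.
have cB0 w : 0 <= (1 + 5 / 9 * tau ^+ 3) * B k w by rewrite mulr_ge0.
have mcB : mfunT (fun w => (1 + 5 / 9 * tau ^+ 3) * B k w).
  exact: measurable_funM.
have mAB : mfunT (fun w => A k w + (1 + 5 / 9 * tau ^+ 3) * B k w).
  exact: measurable_funD.
have AB0 w : 0 <= A k w + (1 + 5 / 9 * tau ^+ 3) * B k w by rewrite addr_ge0.
rewrite -(ge0_integralRZ P (mB k) c0 (B0 k)) -(ge0_integralRD P (mA k) mcB (A0 k) cB0).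
rewrite -(ge0_integralRD P mAB mE AB0 E0).
have mH' : mfunT (fun w => (H k w)%:E) by exact/measurable_EFinP.
rewrite -(ge0_integralD P measurableT (fun w _ => inner0 w) minner _ mH'); last first.
  by move=> w _; rewrite lee_fin.
apply: ge0_le_integralR.
- exact: emeasurable_funD.
- exact: measurable_funD.
- by move=> w; rewrite adde_ge0// lee_fin.
- move=> w; apply: le_trans (leeD (inner w) (lexx _)) _.
  by rewrite -EFinD lee_fin subrK.
Qed.

Let ge0I (g : Omega -> R) : (forall w, 0 <= g w) -> (0 <= \int[P]_w (g w)%:E)%E.
Proof. by move=> g0; apply: integral_ge0 => w _; rewrite lee_fin. Qed.

(** The starting values are constants, and [chain_step] passes finiteness on; after this the
    recursion can be read in the real numbers. *)
Let fin_chain k : (\int[P]_w (A k w)%:E \is a fin_num)%E /\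
  (\int[P]_w (B k w)%:E \is a fin_num)%E.
Proof.
elim: k => [|k [IHA IHB]].
  split; last first.
    rewrite (_ : (fun w => (B 0%N w)%:E) = cst 0%:E); first by rewrite integral_cst//= mul0e.
    by apply/funext => w; rewrite /B /scsg_point/= subrr enorm0 expr0n/= mulr0.
  rewrite (_ : (fun w => (A 0%N w)%:E) = cst (F x - Fmin)%:E).
    by rewrite integral_cst//= probability_setT mule1.
  by [].
have : (\int[P]_w (A k.+1 w)%:E + \int[P]_w (B k.+1 w)%:E + \int[P]_w (H k w)%:E < +oo)%E.
  apply: le_lt_trans (chain_step k) _.
  rewrite -(fineK IHA) -(fineK IHB) -EFinM -EFinD.
  by apply: lte_add_pinfty; [rewrite ltry|apply: le_lt_trans E_le _; rewrite ltry].
have hA := ge0I (A0 k.+1); have hB := ge0I (B0 k.+1); have hH := ge0I (H0 k).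
move=> h; split; rewrite ge0_fin_numE//; apply: le_lt_trans h.
  by rewrite -addeA leeDl// adde_ge0.
by rewrite addeAC leeDr// adde_ge0.
Qed.

Let fin_H k : (\int[P]_w (H k w)%:E \is a fin_num)%E.
Proof.
have [fA fB] := fin_chain k.
rewrite ge0_fin_numE; last exact: ge0I.
have hs : (\int[P]_w (A k w)%:E + (1 + 5 / 9 * tau ^+ 3)%:E * \int[P]_w (B k w)%:E
    + \int[P]_w (E w)%:E < +oo)%E.
  rewrite -(fineK fA) -(fineK fB) -EFinM -EFinD.
  by apply: lte_add_pinfty; [rewrite ltry|apply: le_lt_trans E_le _; rewrite ltry].
apply: le_lt_trans hs; apply: le_trans (chain_step k).
by rewrite leeDr// adde_ge0//; exact: ge0I.
Qed.

(** [geometric_descent] with [t = tau^3]: the weights are the probabilities of the epoch lengths,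
    and division by [t] turns [eta / 2] into [eta / (2 tau^3)]. *)
Lemma scsg_partial_sums n :
  (\sum_(k < n) ((1 + tau ^+ 3)^-1 ^+ k * (1 - (1 + tau ^+ 3)^-1))%:E *
     \int[P]_w (F (scsg_point k w) - Fmin
       + eta / (2 * tau ^+ 3) * enorm (grad F (scsg_point k w)) ^+ 2)%:E <=
   (F x - Fmin + eta / (2 * tau ^+ 3) * (V / m1%:R))%:E)%E.
Proof.
have t3 : 0 < tau ^+ 3 by exact: exprn_gt0.
pose a k := fine (\int[P]_w (A k w)%:E)%E.
pose bb k := fine (\int[P]_w (B k w)%:E)%E.
pose g k := fine (\int[P]_w (H k w)%:E)%E.
have fine_ge0I (u : Omega -> R) : (forall w, 0 <= u w) -> 0 <= fine (\int[P]_w (u w)%:E)%E.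
  by move=> /ge0I/fine_ge0.
have -> : (\sum_(k < n) ((1 + tau ^+ 3)^-1 ^+ k * (1 - (1 + tau ^+ 3)^-1))%:E *
     \int[P]_w (F (scsg_point k w) - Fmin
       + eta / (2 * tau ^+ 3) * enorm (grad F (scsg_point k w)) ^+ 2)%:E =
    (\sum_(k < n) (1 + tau ^+ 3)^-1 ^+ k * (1 - (1 + tau ^+ 3)^-1) *
      (a k + g k / tau ^+ 3))%:E)%E.
  rewrite -sumEFin; apply: eq_bigr => k _; rewrite [in RHS]EFinM; congr (_ * _)%E.
  have [fA fB] := fin_chain k.
  have -> : ((a k + g k / tau ^+ 3)%:E = \int[P]_w (A k w)%:E +
      ((tau ^+ 3)^-1)%:E * \int[P]_w (H k w)%:E)%E.
    by rewrite [g k / _]mulrC EFinD EFinM /a /g (fineK fA) (fineK (fin_H k)).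
  have t3i : 0 <= (tau ^+ 3)^-1 by rewrite invr_ge0 ltW.
  rewrite -(ge0_integralRZ P (mH k) t3i (H0 k)) -ge0_integralRD//.
  - apply: eq_integral => w _; congr EFin; rewrite /A /H; congr (_ + _).
    by field; rewrite gt_eqF.
  - exact: measurable_funM.
  - by move=> w; rewrite mulr_ge0.
rewrite lee_fin.
have E_fin : (\int[P]_w (E w)%:E \is a fin_num)%E.
  rewrite ge0_fin_numE; first by apply: le_lt_trans E_le _; rewrite ltry.
  by apply: integral_ge0 => w _; rewrite lee_fin.
have Efin_le : fine (\int[P]_w (E w)%:E)%E <= eta / 2 * (V / m1%:R).
  by rewrite -lee_fin fineK.
have bb0 : bb 0%N = 0.
  rewrite /bb (_ : (fun w => (B 0%N w)%:E) = cst 0%:E) ?integral0//.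
  by apply/funext => w; rewrite /B /scsg_point/= subrr enorm0 expr0n/= mulr0.
have step k : a k.+1 + bb k.+1 + g k <= a k + (1 + 5 / 9 * tau ^+ 3) * bb k
    + fine (\int[P]_w (E w)%:E)%E.
  have [fA fB] := fin_chain k; have [fA' fB'] := fin_chain k.+1.
  have := chain_step k.
  rewrite -(fineK fA) -(fineK fB) -(fineK fA') -(fineK fB') -(fineK (fin_H k)).
  by rewrite -(fineK E_fin) -EFinM -!EFinD lee_fin.
apply: le_trans (geometric_descent t3 erefl (fun k => fine_ge0I _ (B0 k))
  (fun k => fine_ge0I _ (A0 k)) bb0 (fine_ge0I _ E0) step n) _.
rewrite [X in X + _](_ : _ = F x - Fmin); last first.
  rewrite (_ : (fun w => (A 0%N w)%:E) = cst (F x - Fmin)%:E).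
    by rewrite integral_cst//= probability_setT mule1.
  by [].
rewrite lerD2l.
have -> : eta / (2 * tau ^+ 3) * (V / m1%:R) = eta / 2 * (V / m1%:R) / tau ^+ 3.
  by field; rewrite (gt_eqF tau_gt0) pnatr_eq0 -lt0n m1_gt0.
by rewrite ler_pM2r ?invr_gt0.
Qed.

End scsg_chain.

Section nat_index.
Context {R : realType} {dT : measure_display} {T : measurableType dT}.

Lemma measurable_nat_index (d' : measure_display) (T' : measurableType d')
    (N : T -> nat) (Y : nat -> T -> T') :
  mfunT N -> (forall k, mfunT (Y k)) ->
  mfunT (fun t => Y (N t) t).
Proof.
move=> mN mY _ B mB; rewrite setTI.
have -> : (fun t => Y (N t) t) @^-1` B = \bigcup_k (N @^-1` [set k] `&` Y k @^-1` B).
  apply/seteqP; split=> [t /= YB|t [k _ [/= <-]]//].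
  by exists (N t).
apply: bigcupT_measurable => k; apply: measurableI.
  by rewrite -[X in measurable X]setTI; exact: mN.
by rewrite -[X in measurable X]setTI; exact: mY.
Qed.

Lemma integral_nat_rv (P : probability T R) (N : T -> nat) (h : nat -> \bar R) :
  mfunT N -> (forall k, (0 <= h k)%E) ->
  (\int[P]_t h (N t) = \sum_(k <oo) P (N @^-1` [set k]) * h k)%E.
Proof.
move=> mN h0.
have mpre k : measurable (N @^-1` [set k]).
  by rewrite -[X in measurable X]setTI; exact: mN.
have covN : setT = \bigcup_k (N @^-1` [set k]).
  by apply/seteqP; split=> // t _; exists (N t).
rewrite [in LHS]covN ge0_integral_bigcup//=.
- apply: eq_eseriesr => k _.
  rewrite (eq_integral (fun=> h k)); last by move=> t; rewrite inE => /= ->.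
  by rewrite integral_cst// muleC.
- rewrite -covN; apply: (measurableT_comp (f := h)) => //.
- apply/trivIsetP => a b _ _ /eqP ab; apply/seteqP; split=> // t [/= Na Nb].
  by apply: ab; rewrite -Na -Nb.
Qed.

Lemma nneseries_le (u : nat -> \bar R) (M : \bar R) : (forall k, (0 <= u k)%E) ->
  (forall n, (\sum_(k < n) u k <= M)%E) -> (\sum_(k <oo) u k <= M)%E.
Proof.
move=> u0 uM; apply: lime_le; first by apply: is_cvg_nneseries => n _ _; exact: u0.
by apply: nearW => n; rewrite big_mkord; exact: uM.
Qed.

Lemma geometric_mean_partial (q : R) n : q != 1 ->
  \sum_(k < n) q ^+ k * (1 - q) * k%:R =
  q / (1 - q) - (n%:R * q ^+ n + q ^+ n.+1 / (1 - q)).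
Proof.
move=> q1; have q1' : 1 - q != 0 by rewrite subr_eq0 eq_sym.
elim: n => [|n IH]; first by rewrite big_ord0 expr1 mul0r add0r subrr.
rewrite big_ord_recr/= IH -natr1 !exprS; field.
by rewrite q1'.
Qed.

End nat_index.

(** * The epoch with its geometric length *)

Section epoch.
Context {R : realType} {d : nat} {dO dX dU : measure_display}.
Context {Omega : measurableType dO} {P : probability Omega R}.
Context {Xi : measurableType dX} {U : measurableType dU}.
Variables (D : probability Xi R) (f : 'rV[R]_d -> Xi -> R) (W : draws P Xi U).
Variables (L1 L2 Delta G V : R) (x1 : 'rV[R]_d).
Hypothesis L2_ge0 : 0 <= L2.
Hypothesis sa : standing_assumptions D f L1 L2 Delta G V x1.
Variables (c' Fmin : R) (m1 b : nat).
Hypothesis vd : valid_draws D m1 b W.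
Hypotheses (L1_gt0 : 0 < L1) (c'_gt0 : 0 < c') (c'_le : c' <= 1 / 6).
Hypothesis b_m1 : (0 < b <= m1)%N.
Let F := objective D f.
Hypothesis FminP : forall x, Fmin <= F x.

Let b_gt0 : (0 < b)%N. Proof. by case/andP: b_m1. Qed.
Let m1_gt0 : (0 < m1)%N. Proof. by case/andP: b_m1 => ? /(leq_trans _) ->. Qed.
Let bR : 0 < b%:R :> R. Proof. by rewrite ltr0n. Qed.
Let mR : 0 < m1%:R :> R. Proof. by rewrite ltr0n. Qed.

(** Its cube is [b / m1]. The geometric parameter then equals [1 / (1 + tau^3)] and the step size
    [c' / L1 * tau^2], so all later algebra is rational in [tau]. *)
Definition epoch_ratio : R := (b%:R / m1%:R) `^ (1 / 3).
Let tau := epoch_ratio.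

Lemma epoch_ratio_cube : epoch_ratio ^+ 3 = b%:R / m1%:R.
Proof.
rewrite /epoch_ratio -powR_mulrn ?powR_ge0// -powRrM.
by rewrite (_ : 1 / 3 * 3%:R = 1) ?powRr1 ?divr_ge0//; field.
Qed.

Lemma epoch_ratio_gt0 : 0 < epoch_ratio.
Proof. by rewrite powR_gt0// divr_gt0. Qed.

Lemma epoch_ratio_le1 : epoch_ratio <= 1.
Proof.
suff : epoch_ratio <= 1 `^ (1 / 3) by rewrite powR1.
rewrite ge0_ler_powR ?divr_ge0//= ?nnegrE ?divr_ge0//.
by rewrite ler_pdivrMr// mul1r ler_nat; case/andP: b_m1.
Qed.

Lemma scsg_stepsizeE (S1 : m1.-tuple Xi) :
  scsg_stepsize L1 c' S1 b = c' / L1 * epoch_ratio ^+ 2.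
Proof.
rewrite /scsg_stepsize size_tuple /epoch_ratio; congr (_ * _).
have -> : m1%:R / b%:R = (b%:R / m1%:R) `^ (-1) :> R by rewrite powR_inv1 ?divr_ge0// invf_div.
rewrite -powRrM -powR_mulrn ?powR_ge0// -powRrM.
by congr (_ `^ _); field.
Qed.

Let q_E : m1%:R / (m1%:R + b%:R) = (1 + tau ^+ 3)^-1 :> R.
Proof.
rewrite epoch_ratio_cube; field.
by rewrite !gt_eqF//= addr_gt0.
Qed.

Definition descent_rate : R := c' / (2 * L1 * epoch_ratio).

Definition length_src j : set source := [set LengthSrc j].
Definition sample_src j : set source := [set s | exists r i, s = SampleSrc j r i].

Lemma length_sample_disjoint j : length_src j `&` sample_src j = set0.
Proof. by rewrite -subset0 => _ [-> [r [i]]]. Qed.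

Lemma measurable_scsg_call (dT : measure_display) (T : measurableType dT)
    (om : T -> Omega) (X : T -> borel_rV R d) j :
  mfunT X ->
  mfunT (fun t => epoch_length W j (om t)) ->
  (forall i, mfunT (fun t => sample W j Epoch i (om t))) ->
  (forall k i, mfunT (fun t => sample W j (Inner k) i (om t))) ->
  mfunT (fun t => (scsg_call f L1 c' m1 b W (om t) j (X t)).1 : borel_rV R d).
Proof.
move=> mX mN mE mI.
apply: (measurable_nat_index (Y := fun k t => scsg_iter f L1 c' (batch W j Epoch m1 (om t)) b
  (fun k' => batch W j (Inner k') b (om t)) (X t) k : borel_rV R d)) => // k.
exact: (@measurable_scsg_iter _ _ _ _ _ _ _ _ _ _ f W _ _ _ _ _ _ sa _ T
  om c' j m1 b X k mX mE (fun k' i _ => mI k' i)).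
Qed.

(** The length is independent of the samples, so the mean at the random index is the series of the
    means at fixed indices, weighted by the law of the length; its partial sums are bounded by
    [scsg_partial_sums]. *)
Lemma scsg_epoch_descent j x :
  (\int[P]_w (F (scsg_call f L1 c' m1 b W w j x).1 - Fmin
     + descent_rate * enorm (grad F (scsg_call f L1 c' m1 b W w j x).1) ^+ 2)%:E
   <= (F x - Fmin + descent_rate * (V / m1%:R))%:E)%E.
Proof.
pose pt k w := scsg_point f W L1 c' m1 b j x k w.
pose Y k w := F (pt k w) - Fmin + descent_rate * enorm (grad F (pt k w)) ^+ 2.
have rate0 : 0 <= descent_rate.
  by rewrite divr_ge0 ?mulr_ge0 ?(ltW L1_gt0) ?(ltW c'_gt0) ?(ltW epoch_ratio_gt0).
have Y0 k w : 0 <= Y k w by rewrite addr_ge0 ?subr_ge0 ?FminP// mulr_ge0// sqr_ge0.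
pose phi (p : history W (length_src j) * history W (sample_src j)) : \bar R :=
  (Y (epoch_length W j p.1) p.2)%:E.
have mpt k : mfunT (pt k : history W (sample_src j) -> borel_rV R d).
  have mS r i : mfunT ((fun w => sample W j r i w) : history W (sample_src j) -> Xi).
    by apply: measurable_history_sample; exists r, i.
  exact: (@measurable_scsg_iter _ _ _ _ _ _ _ _ _ _ f W _ _ _ _ _ _ sa _
    (history W (sample_src j)) (fun w => w) c' j m1 b (cst (x : borel_rV R d)) k
    (measurable_cst _) (mS Epoch) (fun k' i _ => mS (Inner k') i)).
have mY k : mfunT (Y k : history W (sample_src j) -> R).
  apply: measurable_funD.
    by apply: measurable_funB => //; exact: (measurable_objective sa (mpt k)).
  apply: measurable_funM => //; apply: measurable_enorm_sqr.
  exact: (measurable_grad_objective L2_ge0 sa (mpt k)).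
have mphi : mfunT phi.
  apply/measurable_EFinP.
  have mN : mfunT (fun p : history W (length_src j) * history W (sample_src j) =>
      epoch_length W j p.1).
    by apply: (measurableT_comp _ measurable_fst); exact: measurable_history_length.
  have mY2 k : mfunT (fun p : history W (length_src j) * history W (sample_src j) =>
      Y k p.2).
    exact: (measurableT_comp (mY k) measurable_snd).
  exact: (measurable_nat_index mN mY2).
have phi0 p : (0 <= phi p)%E by rewrite lee_fin.
have -> : (\int[P]_w (F (scsg_call f L1 c' m1 b W w j x).1 - Fmin
     + descent_rate * enorm (grad F (scsg_call f L1 c' m1 b W w j x).1) ^+ 2)%:E
    = \int[P]_w \int[P]_w' phi (w, w'))%E.
  exact: (freeze (vd_independent vd) (length_sample_disjoint j) mphi phi0).
pose h k := (\int[P]_w' (Y k w')%:E)%E.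
have h0 k : (0 <= h k)%E by apply: integral_ge0 => w _; rewrite lee_fin.
rewrite -[leLHS]/(\int[P]_w h (epoch_length W j w))%E integral_nat_rv//.
apply: nneseries_le => [k|n]; first exact: mule_ge0.
have eta0 : 0 < c' / L1 * tau ^+ 2.
  by rewrite mulr_gt0 ?divr_gt0// exprn_gt0// epoch_ratio_gt0.
have etaE : c' / L1 * tau ^+ 2 * L1 = c' * tau ^+ 2 by field; rewrite gt_eqF.
have := scsg_partial_sums L2_ge0 sa (vd_independent vd) (vd_sample vd) L1_gt0 eta0
  epoch_ratio_gt0 epoch_ratio_le1 c'_gt0 c'_le b_gt0 m1_gt0 etaE scsg_stepsizeE FminP j x n.
have -> : c' / L1 * tau ^+ 2 / (2 * tau ^+ 3) = descent_rate.
  by rewrite /descent_rate -/tau; field; rewrite (gt_eqF L1_gt0) (gt_eqF epoch_ratio_gt0).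
apply: le_trans; apply: le_of_eq.
apply: eq_bigr => k _; congr (_ * _)%E.
by rewrite (vd_length vd) q_E.
Qed.

(** The mean length is [q / (1 - q) = m1 / b], so the [2 b] gradients per inner step add [2 m1] on
    average to the [m1] of the large batch. *)
Lemma scsg_mean_cost j :
  (\int[P]_w ((scsg_call_cost m1 b W w j)%:R : R)%:E <= (3 * m1%:R)%:E)%E.
Proof.
pose h (k : nat) : \bar R := (m1%:R + 2 * b%:R * k%:R)%:E.
have h0 k : (0 <= h k)%E by rewrite lee_fin addr_ge0// !mulr_ge0.
have -> : (\int[P]_w ((scsg_call_cost m1 b W w j)%:R : R)%:E =
    \int[P]_w h (epoch_length W j w))%E.
  apply: eq_integral => w _; rewrite /h /scsg_call_cost /scsg_cost size_tuple.
  by rewrite natrD !natrM.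
rewrite integral_nat_rv//; apply: nneseries_le => [k|n]; first exact: mule_ge0.
set q := (1 + tau ^+ 3)^-1.
have t30 : 0 < tau ^+ 3 by rewrite exprn_gt0// epoch_ratio_gt0.
have q0 : 0 < q by rewrite invr_gt0 addr_gt0.
have q1 : q < 1 by rewrite invf_lt1 ?addr_gt0// ltrDl.
have -> : (\sum_(k < n) P (epoch_length W j @^-1` [set (k : nat)]) * h k =
   (m1%:R * (\sum_(k < n) q ^+ k * (1 - q)) +
    2 * b%:R * (\sum_(k < n) q ^+ k * (1 - q) * k%:R))%:E)%E.
  rewrite !mulr_sumr -big_split/= -sumEFin; apply: eq_bigr => k _.
  by rewrite (vd_length vd) q_E -/q -EFinM; congr EFin; ring.
have s1 : \sum_(k < n) q ^+ k * (1 - q) = 1 - q ^+ n.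
  elim: (n) => [|m IH]; first by rewrite big_ord0 expr0 subrr.
  by rewrite big_ord_recr/= IH exprSr; ring.
rewrite s1 geometric_mean_partial ?lt_eqF// lee_fin.
have qn0 : 0 < q ^+ n by exact: exprn_gt0.
have qS0 : 0 < q ^+ n.+1 / (1 - q) by rewrite divr_gt0 ?exprn_gt0// subr_gt0.
have nq0 : 0 <= n%:R * q ^+ n by rewrite mulr_ge0// ltW.
have qq : b%:R * (q / (1 - q)) = m1%:R.
  have -> : 1 - q = q * tau ^+ 3 by rewrite /q; field; rewrite gt_eqF// addr_gt0.
  rewrite epoch_ratio_cube; have qn : q != 0 by rewrite gt_eqF.
  by field; rewrite qn !gt_eqF.
have mq : 0 <= m1%:R * q ^+ n by rewrite mulr_ge0// ltW.
have bq : 0 <= b%:R * (n%:R * q ^+ n + q ^+ n.+1 / (1 - q)).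
  by rewrite mulr_ge0// addr_ge0// ltW.
by rewrite mulrBr -!mulrA mulrBr qq; lra.
Qed.

End epoch.

Section bool_integral.
Context {R : realType} {dT : measure_display} {T : measurableType dT}.
Variable P : probability T R.

Lemma measurable_bool_set (b : T -> bool) : mfunT b ->
  measurable [set t | b t].
Proof.
by move=> mb; rewrite -[X in measurable X]setTI; exact: (mb measurableT [set true]).
Qed.

Lemma measurable_bool_natr (b : T -> bool) : mfunT b ->
  mfunT (fun t => (b t)%:R : R).
Proof.
move=> mb; have -> : (fun t => (b t)%:R : R) = (fun t => if b t then cst 1 t else cst 0 t).
  by apply/funext => t; case: (b t).
exact: measurable_fun_ifT.
Qed.

Lemma integral_bool (b : T -> bool) : mfunT b ->
  (\int[P]_t ((b t)%:R : R)%:E = P [set t | b t])%E.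
Proof.
move=> mb; rewrite -(setIT [set t | b t]) -integral_indic//; last exact: measurable_bool_set.
apply: eq_integral => t _; rewrite indicE.
by case: (boolP (b t)) => bt; [rewrite mem_set|rewrite memNset//; apply/negP].
Qed.

(** Only the masses of the two atoms are given; as they add up to 1, the remaining event is null. *)
Lemma integral_rademacher (z : T -> R) (g : R -> R) :
  mfunT z -> mfunT g -> (forall a, 0 <= g a) ->
  P (z @^-1` [set 1]) = (2^-1)%:E -> P (z @^-1` [set -1]) = (2^-1)%:E ->
  (\int[P]_t (g (z t))%:E = ((g 1 + g (-1)) / 2)%:E)%E.
Proof.
move=> mz mg g0 P1 PN1.
have mpre a : measurable (z @^-1` [set a]) by rewrite -[X in measurable X]setTI; exact: mz.
have mgz : mfunT (fun t => (g (z t))%:E).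
  by apply/measurable_EFinP; exact: measurableT_comp.
have N11 : [disjoint z @^-1` [set 1] & z @^-1` [set -1]].
  rewrite disj_set2E; apply/eqP/seteqP; split=> // t [/= -> h].
  by have : (1 : R) = -1 := h; lra.
have mA := measurableU _ _ (mpre 1) (mpre (-1)).
pose A := z @^-1` [set 1] `|` z @^-1` [set -1].
have PA : P A = 1%E.
  have I0 : z @^-1` [set 1] `&` z @^-1` [set -1] = set0 by apply/eqP; rewrite -disj_set2E.
  have -> : P A = (P (z @^-1` [set 1%R]) + P (z @^-1` [set (-1)%R]))%E by exact: measureU.
  by rewrite P1 PN1 -EFinD (_ : 2^-1 + 2^-1 = 1 :> R)//; field.
have PAC : P (~` A) = 0%E by rewrite probability_setC// PA subee.
rewrite -(setUv A) ge0_integral_setU//; first last.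
- by rewrite disj_set2E setICr.
- by move=> t _; rewrite lee_fin.
- by rewrite setUv.
- exact: measurableC.
rewrite [X in (_ + X)%E]null_set_integral ?adde0//; first last.
- exact: measurable_funTS.
- exact: measurableC.
rewrite ge0_integral_setU//; first last.
- by move=> t _; rewrite lee_fin.
- exact: measurable_funTS.
rewrite (eq_integral (fun=> (g 1)%:E)); last by move=> t; rewrite inE => /= ->.
rewrite [X in (_ + X)%E](eq_integral (fun=> (g (-1))%:E)); last first.
  by move=> t; rewrite inE => /= ->.
rewrite !integral_cst//.
have -> : ((g 1)%:E * P (z @^-1` [set 1%R]) + (g (-1))%:E * P (z @^-1` [set (-1)%R]) =
    ((g 1 + g (-1)) / 2)%:E)%E by rewrite P1 PN1 -!EFinM -EFinD -mulrDl.
by [].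
Qed.

End bool_integral.

(** * The NEON step at a fixed point *)

Section neon.
Context {R : realType} {d : nat} {dO dX dU : measure_display}.
Context {Omega : measurableType dO} {P : probability Omega R}.
Context {Xi : measurableType dX} {U : measurableType dU}.
Variables (D : probability Xi R) (f : 'rV[R]_d -> Xi -> R) (W : draws P Xi U).
Variables (L1 L2 Delta G V : R) (x1 : 'rV[R]_d).
Hypotheses (L1_gt0 : 0 < L1) (L2_gt0 : 0 < L2).
Let L2_ge0 : 0 <= L2. Proof. exact: ltW. Qed.
Hypothesis sa : standing_assumptions D f L1 L2 Delta G V x1.
Variables (m1 b n2 : nat) (neon : U -> 'rV[R]_d -> fo_proc R d).
Variables (gamma c C Tn fail Fmin : R).
Hypotheses (gamma_gt0 : 0 < gamma) (c_gt0 : 0 < c).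
Hypothesis vd : valid_draws D m1 b W.
Hypothesis ng : neon_guarantee D f L2 c gamma n2 neon W C Tn fail.
Let F := objective D f.
Hypothesis FminP : forall x, Fmin <= F x.

Section measurability.
Context {dT : measure_display} {T : measurableType dT}.
Variables (om : T -> Omega) (Y : T -> borel_rV R d) (j : nat).
Hypothesis mY : mfunT Y.
Hypothesis mS : forall i, mfunT (fun t => sample W j Curv i (om t)).
Hypothesis mU : mfunT (fun t => seed W j (om t)).

Lemma measurable_neon_direction : mfunT
  (fun t => neon_scsg_direction f n2 neon W (om t) j (Y t) : borel_rV R d).
Proof.
have mB : mfunT (fun t => batch W j Curv n2 (om t)) by exact: measurable_batch_at.
apply: (measurableT_comp (ng_measurable_run ng)
  (g := fun t => (Y t, (batch W j Curv n2 (om t), seed W j (om t))))).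
by do 2 apply: measurable_fun_pair => //.
Qed.

Lemma measurable_neon_cost : mfunT
  (fun t => (neon_cost f (curv_batch n2 W (om t)) (neon_call neon W (om t)) j (Y t))%:R : R).
Proof.
have mB : mfunT (fun t => batch W j Curv n2 (om t)) by exact: measurable_batch_at.
have mQ : mfunT (fun t =>
    queries (minibatch f (batch W j Curv n2 (om t))) (neon (seed W j (om t)) (Y t))).
  apply: (measurableT_comp (ng_measurable_queries ng)
    (g := fun t => (Y t, (batch W j Curv n2 (om t), seed W j (om t))))).
  by do 2 apply: measurable_fun_pair => //.
rewrite /neon_cost /curv_batch; under eq_fun do rewrite size_tuple.
exact: (measurableT_comp (f := fun k : nat => (n2 * k)%:R : R)).
Qed.

Lemma measurable_neon_update : mfunT (fun t => sign W j (om t)) ->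
  mfunT
  (fun t => neon_scsg_update f L2 c gamma n2 neon W (om t) j (Y t) : borel_rV R d).
Proof.
move=> mz; have mD := measurable_neon_direction.
apply: measurable_rVB => //; apply: measurable_rVZ.
  by apply: measurable_funM => //; apply: measurable_funM.
apply: measurable_rVZ => //.
under eq_fun do rewrite -powR_inv1 ?enorm_ge0//.
apply: (measurableT_comp (measurable_powR _)); exact: measurable_enorm.
Qed.

End measurability.

(** Let [s = c gamma / L2] be the step length. For a direction of curvature at most [- c gamma], the
    symmetric difference is at most [- s^2 c gamma + L2/3 s^3], that is [- 3 + 1] times [neon_gain];
    averaging the two signs leaves one gain. [neon_loss] is [L1/2 s^2], the possible increase along
    an unsound direction. *)
Definition neon_gain : R := c ^+ 3 * gamma ^+ 3 / (3 * L2 ^+ 2).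
Definition neon_loss : R := L1 * c ^+ 2 * gamma ^+ 2 / (2 * L2 ^+ 2).

Let unsound y (u : 'rV[R]_d) := (u != 0) && (- (c * gamma) < curvature F y u).

Lemma neon_step_pointwise y u v :
  v = (c * gamma / L2) *: ((enorm u)^-1 *: u) ->
  (F (y + v) + F (y - v)) / 2 + neon_gain * (u != 0)%:R <=
  F y + (neon_gain + neon_loss) * (unsound y u)%:R.
Proof.
move=> vE; rewrite /unsound; have [u0|u0] := eqVneq u 0.
  by rewrite vE u0 !scaler0 subr0 addr0 /= !mulr0; lra.
rewrite /= mulr1; pose s := c * gamma / L2.
have s0 : 0 < s by rewrite divr_gt0// mulr_gt0.
have nu : 0 < enorm u by rewrite lt0r enorm_ge0 andbT; apply: contra_neq u0 => /enorm_eq0.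
have nv : enorm v = s.
  by rewrite vE !enormZ [`|_^-1|]gtr0_norm ?invr_gt0// mulVf ?gt_eqF// mulr1 gtr0_norm.
case: ltP => cu /=.
  have lossE : neon_loss = L1 / 2 * s ^+ 2 by rewrite /neon_loss /s; field; rewrite gt_eqF.
  have := objective_taylor sa y v; have := objective_taylor sa y (- v).
  by rewrite enormN nv dotNr -/F lossE; lra.
have qE : dot v (v *m hess F y) = s ^+ 2 * curvature F y u.
  rewrite /curvature dot_mulmx vE -!scalemxAl !dotZl !dotZr (dotC u) -/s.
  by field; rewrite gt_eqF.
have := objective_taylor_symmetric L2_ge0 sa y v.
rewrite -/F qE nv.
have : s ^+ 2 * curvature F y u <= s ^+ 2 * - (c * gamma).
  by rewrite ler_pM2l// exprn_gt0.
have -> : s ^+ 2 * - (c * gamma) = - (3 * neon_gain).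
  by rewrite /neon_gain /s; field; rewrite gt_eqF.
have -> : L2 / 3 * s ^+ 3 = neon_gain by rewrite /neon_gain /s; field; rewrite gt_eqF.
by rewrite mulr0; lra.
Qed.

Definition neon_src j : set source :=
  [set s | (exists i, s = SampleSrc j Curv i) \/ s = SeedSrc j].
Definition sign_src j : set source := [set SignSrc j].

Let neon_sign_disjoint j : neon_src j `&` sign_src j = set0.
Proof. by rewrite -subset0 => t [[[i ->]|->] /= E]. Qed.

Lemma measurable_unsound (dT : measure_display) (T : measurableType dT)
    (u : T -> borel_rV R d) y : mfunT u ->
  mfunT (fun t => unsound y (u t)).
Proof.
move=> mu; apply: measurable_and.
  by apply: measurable_neg; exact: measurable_rV_eq0.
apply: (measurable_fun_ltr (f := cst (- (c * gamma))) (g := fun t => curvature F y (u t))) => //.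
rewrite [X in measurable_fun _ X](_ : _ = (fun t =>
  dot ((u t : 'rV[R]_d) *m hess F y) (u t) * (enorm (u t) ^+ 2) `^ (-1))); last first.
  by apply/funext => t; rewrite /curvature dot_mulmx powR_inv1 ?sqr_ge0.
apply: measurable_funM.
  apply: measurable_dot => //; apply: measurable_rV => i.
  rewrite [X in measurable_fun _ X](_ : _ =
    (fun t => \sum_k (u t : 'rV[R]_d) 0 k * hess F y k i)); last first.
    by apply/funext => t; rewrite mxE.
  apply: measurable_sum => k; apply: measurable_funM => //; exact: measurable_coord.
by apply: (measurableT_comp (measurable_powR _)); exact: measurable_enorm_sqr.
Qed.

(** The sign is averaged with the direction frozen. Every nonzero answer is credited with the gain,
    whatever the spectrum at [y]; unsound answers are charged separately, through [ng_sound].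
    Continuing the run thus always costs potential. *)
Lemma neon_one_step j y :
  (\int[P]_w (F (neon_scsg_update f L2 c gamma n2 neon W w j y) - Fmin
     + neon_gain * (neon_scsg_direction f n2 neon W w j y != 0)%:R)%:E
   <= (F y - Fmin + (neon_gain + neon_loss) * fail)%:E)%E.
Proof.
pose u w := neon_scsg_direction f n2 neon W w j y.
have gain0 : 0 <= neon_gain.
  by rewrite divr_ge0 ?mulr_ge0 ?exprn_ge0 ?(ltW c_gt0) ?(ltW gamma_gt0) ?(ltW L2_gt0).
have loss0 : 0 <= neon_loss.
  by rewrite divr_ge0 ?mulr_ge0 ?exprn_ge0 ?(ltW c_gt0) ?(ltW gamma_gt0) ?(ltW L2_gt0) ?(ltW L1_gt0).
have mu : mfunT (u : history W (neon_src j) -> borel_rV R d).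
  apply: (measurable_neon_direction (om := fun w : history W (neon_src j) => w)
     (Y := cst (y : borel_rV R d))); first exact: measurable_cst.
    by move=> i; apply: measurable_history_sample; left; exists i.
  by apply: measurable_history_seed; right.
pose step (z : R) (v : 'rV[R]_d) : 'rV[R]_d := y - (c * gamma * z / L2) *: ((enorm v)^-1 *: v).
pose g (z : R) (v : 'rV[R]_d) := F (step z v) - Fmin + neon_gain * (v != 0)%:R.
have g0 z v : 0 <= g z v by rewrite addr_ge0 ?subr_ge0// mulr_ge0.
have mg (dT : measure_display) (T : measurableType dT) (z : T -> R) (v : T -> borel_rV R d) :
    mfunT z -> mfunT v ->
    mfunT (fun t => g (z t) (v t)).
  move=> mz mv; apply: measurable_funD.
    apply: measurable_funB => //; apply: (measurable_objective sa (Y := fun t => step (z t) (v t))).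
    apply: measurable_rVB => //; apply: measurable_rVZ.
      by apply: measurable_funM => //; apply: measurable_funM.
    apply: measurable_rVZ => //; under eq_fun do rewrite -powR_inv1 ?enorm_ge0//.
    by apply: (measurableT_comp (measurable_powR _)); exact: measurable_enorm.
  apply: measurable_funM => //; apply: measurable_bool_natr; apply: measurable_neg.
  exact: measurable_rV_eq0.
pose phi (p : history W (neon_src j) * history W (sign_src j)) : \bar R :=
  (g (sign W j p.2) (u p.1))%:E.
have mphi : mfunT phi.
  apply/measurable_EFinP; apply: mg; last exact: (measurableT_comp mu measurable_fst).
  apply: (measurableT_comp _ measurable_snd); exact: measurable_history_sign.
have phi0 p : (0 <= phi p)%E by rewrite lee_fin.
have -> : (\int[P]_w (F (neon_scsg_update f L2 c gamma n2 neon W w j y) - Fmin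
     + neon_gain * (neon_scsg_direction f n2 neon W w j y != 0)%:R)%:E =
   \int[P]_w \int[P]_w' phi (w, w'))%E.
  exact: (freeze (vd_independent vd) (@neon_sign_disjoint j) mphi phi0).
have inner w : (\int[P]_w' phi (w, w') = ((g 1 (u w) + g (-1) (u w)) / 2)%:E)%E.
  rewrite (@integral_rademacher _ _ _ P (sign W j) (fun z => g z (u w)))//.
  - by apply: (mg _ _ id (cst (u w : borel_rV R d))) => //; exact: measurable_cst.
  - exact: vd_sign_pos vd j.
  - exact: vd_sign_neg vd j.
have muO : mfunT (u : Omega -> borel_rV R d).
  exact: (measurable_from_history (W := W) (J := neon_src j)).
have mb : mfunT (fun w => unsound y (u w)) by exact: measurable_unsound.
apply: (@le_trans _ _ (\int[P]_w (F y - Fmin + (neon_gain + neon_loss) * (unsound y (u w))%:R)%:E)%E).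
  apply: ge0_le_integralR.
  - apply: (measurable_from_history (W := W) (J := neon_src j)); exact: measurable_freeze mphi phi0.
  - apply: measurable_funD => //; apply: measurable_funM => //; exact: measurable_bool_natr.
  - by move=> w; apply: integral_ge0 => w' _.
  - move=> w; rewrite inner lee_fin.
    have := neon_step_pointwise y (erefl ((c * gamma / L2) *: ((enorm (u w))^-1 *: u w))).
    rewrite /g /step mulr1 mulrN1 mulNr scaleNr opprK.
    by set v := _ *: _; lra.
have yF : 0 <= F y - Fmin by rewrite subr_ge0.
rewrite (ge0_integralRD P (g := fun=> F y - Fmin))//; last 2 first.
- by apply: measurable_funM => //; exact: measurable_bool_natr.
- by move=> w; rewrite mulr_ge0// addr_ge0.
rewrite integral_cst//= probability_setT mule1.
rewrite ge0_integralRZ//; last 2 first.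
- exact: measurable_bool_natr.
- by rewrite addr_ge0.
rewrite integral_bool//.
have -> : ((F y - Fmin + (neon_gain + neon_loss) * fail)%:E =
  (F y - Fmin)%:E + (neon_gain + neon_loss)%:E * fail%:E)%E by [].
rewrite leeD2l// lee_wpmul2l//.
  by rewrite lee_fin addr_ge0.
have := ng_sound ng j y; congr (_ <= _)%E; congr (P _).
by apply/seteqP; split=> w /=; [move=> [a e]; apply/andP|move=> /andP].
Qed.

End neon.

(** * One iteration of the algorithm, and its run *)

Section iteration.
Context {R : realType} {d : nat} {dO dX dU : measure_display}.
Context {Omega : measurableType dO} {P : probability Omega R}.
Context {Xi : measurableType dX} {U : measurableType dU}.
Variables (D : probability Xi R) (f : 'rV[R]_d -> Xi -> R) (W : draws P Xi U).
Variables (L1 L2 Delta G V : R) (x1 : 'rV[R]_d).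
Hypotheses (L1_gt0 : 0 < L1) (L2_gt0 : 0 < L2).
Let L2_ge0 : 0 <= L2. Proof. exact: ltW. Qed.
Hypothesis sa : standing_assumptions D f L1 L2 Delta G V x1.
Variables (m1 b s n2 : nat) (neon : U -> 'rV[R]_d -> fo_proc R d).
Variables (c' eps gamma c C Tn fail Fmin : R).
Hypotheses (eps_gt0 : 0 < eps) (gamma_gt0 : 0 < gamma) (c_gt0 : 0 < c) (fail_gt0 : 0 < fail).
Hypotheses (c'_gt0 : 0 < c') (c'_le : c' <= 1 / 6) (b_m1 : (0 < b <= m1)%N).
Hypothesis vd : valid_draws D m1 b W.
Hypothesis cg : check_guarantee D f eps s W fail.
Hypothesis ng : neon_guarantee D f L2 c gamma n2 neon W C Tn fail.
Let F := objective D f.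
Hypothesis FminP : forall x, Fmin <= F x.

Definition epoch_point (w : Omega) j x : 'rV[R]_d := (scsg_call f L1 c' m1 b W w j x).1.
Definition met (w : Omega) j y : bool := first_order_met f eps (check_batch s W w) j y.
(** The fallback is [y] because the base procedure returns [z = y]. *)
Definition after_check (w : Omega) j y : 'rV[R]_d :=
  if met w j y then neon_scsg_update f L2 c gamma n2 neon W w j y else y.
Definition stops (w : Omega) j y : bool :=
  met w j y && (neon_scsg_direction f n2 neon W w j y == 0).

Section measurability.
Context {dT : measure_display} {T : measurableType dT}.
Variables (om : T -> Omega) (j : nat) (Y : T -> borel_rV R d).
Hypothesis mY : mfunT Y.

Lemma measurable_met : (forall i, mfunT (fun t => sample W j Check i (om t))) ->
  mfunT (fun t => met (om t) j (Y t)).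
Proof.
move=> mC; apply: measurable_ler_bool; last exact: measurable_cst.
apply: measurable_enorm; apply: (measurable_grad_minibatch sa) => //.
exact: measurable_batch_at.
Qed.

Hypothesis mC : forall i, mfunT (fun t => sample W j Check i (om t)).
Hypothesis mV : forall i, mfunT (fun t => sample W j Curv i (om t)).
Hypothesis mU : mfunT (fun t => seed W j (om t)).

Lemma measurable_stops : mfunT (fun t => stops (om t) j (Y t)).
Proof.
apply: measurable_and; first exact: measurable_met.
by apply: measurable_rV_eq0; exact: (measurable_neon_direction ng).
Qed.

Lemma measurable_after_check : mfunT (fun t => sign W j (om t)) ->
  mfunT (fun t => after_check (om t) j (Y t) : borel_rV R d).
Proof.
move=> mz; apply: measurable_rV_bool => //; first exact: measurable_met.
exact: (measurable_neon_update ng).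
Qed.

End measurability.

Definition check_src j : set source := [set t | exists i, t = SampleSrc j Check i].
Definition neon_all_src j : set source := neon_src j `|` sign_src j.

Let check_neon_disjoint j : check_src j `&` neon_all_src j = set0.
Proof.
by rewrite -subset0 => t [[i ->]] [[[i']|]|].
Qed.

Let loss_gain_ge0 : 0 <= neon_gain L2 gamma c + neon_loss L1 L2 gamma c.
Proof.
by rewrite addr_ge0// divr_ge0 ?mulr_ge0 ?exprn_ge0 ?(ltW c_gt0) ?(ltW gamma_gt0)
  ?(ltW L2_gt0) ?(ltW L1_gt0).
Qed.

Let met_event j y : measurable [set w | met w j y].
Proof.
apply: measurable_bool_set.
by apply: (measurable_met (om := id) (Y := cst (y : borel_rV R d))).
Qed.

Let check_event j y : measurable [set w |
  eps / 2 < enorm (grad F y - grad (minibatch f (check_batch s W w j)) y)].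
Proof.
apply: measurable_bool_set; apply: (measurable_fun_ltr (f := cst (eps / 2))) => //.
apply: measurable_enorm; apply: measurable_rVB; first exact: measurable_cst.
apply: (measurable_grad_minibatch sa); last exact: measurable_cst.
by apply: (measurable_batch_at (om := id)).
Qed.

Lemma check_fails j y : enorm (grad F y) <= eps / 2 ->
  (P [set w | ~~ met w j y] <= fail%:E)%E.
Proof.
move=> gy; apply: le_trans (cg j y); apply: le_measure.
- by rewrite inE; have := measurableC (met_event j y); congr (measurable _);
    apply/seteqP; split=> w /= /negP.
- by rewrite inE; exact: check_event.
move=> w /=; rewrite /met /first_order_met -ltNge => h.
have := enorm_triangle (grad F y) (grad (minibatch f (check_batch s W w j)) y - grad F y).
rewrite addrC subrK -[enorm (_ - grad F y)]enormN opprB.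
by rewrite -/F; lra.
Qed.

Lemma check_passes j y : 3 / 2 * eps < enorm (grad F y) ->
  (P [set w | met w j y] <= fail%:E)%E.
Proof.
move=> gy; apply: le_trans (cg j y); apply: le_measure; rewrite ?inE//.
move=> w /=; rewrite /met /first_order_met => h.
have := enorm_triangle (grad F y - grad (minibatch f (check_batch s W w j)) y)
  (grad (minibatch f (check_batch s W w j)) y).
by rewrite subrK -/F; lra.
Qed.

(** At a fixed [y] it is settled which requirement fails. Either the gradient exceeds [3/2 eps], and
    the check must have erred by more than [eps / 2], or the curvature is below [- 2 gamma], and
    NEON wrongly answered 0. One failure probability covers each case. *)
Lemma bad_stop j y : ~ second_order_stationary F (3 / 2 * eps) (2 * gamma) y ->
  (P [set w | stops w j y] <= fail%:E)%E.
Proof.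
move=> nso.
have mst : measurable [set w | stops w j y].
  apply: measurable_bool_set.
  by apply: (measurable_stops (om := id) (Y := cst (y : borel_rV R d))).
have [gy|gy] := ltP (3 / 2 * eps) (enorm (grad F y)).
  apply: le_trans (check_passes j gy); apply: le_measure; rewrite ?inE//.
  by move=> w /andP[].
have ly : lambda_min (hess F y) < - (2 * gamma).
  by rewrite ltNge; apply/negP => ly; apply: nso; split.
apply: le_trans (ng_certifies ng j y); apply: le_measure; rewrite ?inE//; last first.
  by move=> w /andP[_ /eqP dw]; split.
rewrite (_ : [set w | _] = [set w | neon_scsg_direction f n2 neon W w j y == 0]).
  apply: measurable_bool_set; apply: measurable_rV_eq0.
  by apply: (measurable_neon_direction ng (om := id) (Y := cst (y : borel_rV R d))).
by apply/seteqP; split=> w /= => [[-> _]|/eqP].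
Qed.

Let measurable_neon_value (dT : measure_display) (T : measurableType dT)
    (om : T -> Omega) j y k :
  (forall i, mfunT (fun t => sample W j Curv i (om t))) ->
  mfunT (fun t => seed W j (om t)) ->
  mfunT (fun t => sign W j (om t)) ->
  mfunT (fun t => F (neon_scsg_update f L2 c gamma n2 neon W (om t) j y) - Fmin
    + k * (neon_scsg_direction f n2 neon W (om t) j y != 0)%:R).
Proof.
move=> mS mU mz; have my : mfunT (cst (y : borel_rV R d) : T -> _) by [].
apply: measurable_funD.
  apply: measurable_funB => //; apply: (measurable_objective sa).
  exact: (measurable_neon_update ng my).
apply: measurable_funM => //; apply: measurable_bool_natr; apply: measurable_neg.
exact: measurable_rV_eq0 (measurable_neon_direction ng my mS mU).
Qed.

Section check_descent.
Variable mu : R.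
Hypotheses (mu_ge0 : 0 <= mu) (mu_gain : mu <= neon_gain L2 gamma c).
Hypothesis mu_rate : mu * (4 / eps ^+ 2) <= descent_rate L1 c' m1 b.

(** The charge [mu] for continuing is paid by the NEON gain when the check is met. Otherwise it is
    weighted by the probability that the check is not met. *)
Lemma after_check_descent j y :
  (\int[P]_w (F (after_check w j y) - Fmin + mu * (~~ stops w j y)%:R)%:E <=
   (F y - Fmin + (neon_gain L2 gamma c + neon_loss L1 L2 gamma c) * fail
    + mu * (fail + 4 / eps ^+ 2 * enorm (grad F y) ^+ 2))%:E)%E.
Proof.
pose psi (w w' : Omega) : R := if met w j y
  then F (neon_scsg_update f L2 c gamma n2 neon W w' j y) - Fmin
    + mu * (neon_scsg_direction f n2 neon W w' j y != 0)%:R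
  else F y - Fmin + mu.
have yF0 : 0 <= F y - Fmin by rewrite subr_ge0.
have psi0 w w' : 0 <= psi w w'.
  by rewrite /psi; case: ifP => _; rewrite addr_ge0 ?mulr_ge0// subr_ge0.
pose phi (p : history W (check_src j) * history W (neon_all_src j)) : \bar R :=
  (psi p.1 p.2)%:E.
have mC : mfunT ((fun w => met w j y) : history W (check_src j) -> bool).
  apply: (measurable_met (om := fun w : history W (check_src j) => w)
    (Y := cst (y : borel_rV R d))) => // i.
  by apply: measurable_history_sample; exists i.
have mcurv i : mfunT ((fun w => sample W j Curv i w) : history W (neon_all_src j) -> Xi).
  by apply: measurable_history_sample; left; left; exists i.
have mseed : mfunT ((fun w => seed W j w) : history W (neon_all_src j) -> U).
  by apply: measurable_history_seed; left; right.
have msign : mfunT ((fun w => sign W j w) : history W (neon_all_src j) -> R).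
  by apply: measurable_history_sign; right.
pose neonv w := F (neon_scsg_update f L2 c gamma n2 neon W w j y) - Fmin
    + mu * (neon_scsg_direction f n2 neon W w j y != 0)%:R.
have mneonv : mfunT (neonv : history W (neon_all_src j) -> R).
  exact: (measurable_neon_value (om := fun w : history W (neon_all_src j) => w)).
have mphi : mfunT phi.
  apply/measurable_EFinP.
  apply: (measurable_fun_ifT (f := fun p : history W (check_src j) * history W (neon_all_src j) =>
    met p.1 j y)).
  - exact: (measurableT_comp mC measurable_fst).
  - exact: (measurableT_comp mneonv measurable_snd).
  - exact: measurable_cst.
have phi0 p : (0 <= phi p)%E by rewrite lee_fin.
have -> : (\int[P]_w (F (after_check w j y) - Fmin + mu * (~~ stops w j y)%:R)%:E =
    \int[P]_w \int[P]_w' phi (w, w'))%E.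
  rewrite -(freeze (vd_independent vd) (@check_neon_disjoint j) mphi phi0).
  apply: eq_integral => w _; rewrite /phi /psi/= /after_check /stops.
  by case: (met w j y); rewrite //= mulr1.
have mnO : mfunT neonv.
  exact: (measurable_from_history (W := W) (J := neon_all_src j)).
have mCO : mfunT (fun w => met w j y).
  exact: (measurable_from_history (W := W) (J := check_src j)).
have gl0 := loss_gain_ge0.
set K0 := F y - Fmin + (neon_gain L2 gamma c + neon_loss L1 L2 gamma c) * fail.
have K00 : 0 <= K0 by rewrite addr_ge0// mulr_ge0// ltW.
have neonv_le : (\int[P]_w (neonv w)%:E <= K0%:E)%E.
  apply: le_trans (neon_one_step L1_gt0 L2_gt0 sa gamma_gt0 c_gt0 vd ng FminP j y).
  apply: ge0_le_integral => //.
  - by move=> w _; rewrite lee_fin addr_ge0 ?subr_ge0// mulr_ge0.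
  - exact/measurable_EFinP.
  - by apply/measurable_EFinP; exact: (measurable_neon_value (om := id)).
  - by move=> w _; rewrite lee_fin lerD2l ler_wpM2r.
have inner w : (\int[P]_w' phi (w, w') <= (K0 + mu * (~~ met w j y)%:R)%:E)%E.
  rewrite /phi /psi /=; case: (met w j y) => /=; first by rewrite mulr0 addr0.
  rewrite integral_cst//= probability_setT mule1 lee_fin mulr1 lerD2r lerDl.
  by rewrite mulr_ge0// ltW.
have mnmet : mfunT (fun w => ~~ met w j y) by exact: measurable_neg.
have mnmetR := measurable_bool_natr mnmet (R := R).
have minner : mfunT ((fun w => \int[P]_w' phi (w, w'))%E : Omega -> \bar R).
  by apply: (measurable_from_history (W := W) (J := check_src j)); exact: measurable_freeze mphi phi0.
have inner0 w : (0 <= \int[P]_w' phi (w, w'))%E by apply: integral_ge0 => w' _.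
have mK : mfunT (fun w => K0 + mu * (~~ met w j y)%:R).
  by apply: measurable_funD => //; exact: measurable_funM.
apply: le_trans (ge0_le_integralR P minner mK inner0 inner) _.
rewrite (ge0_integralRD P (g := fun=> K0))//; last 2 first.
- exact: measurable_funM.
- by move=> w; rewrite mulr_ge0.
rewrite integral_cst//= probability_setT mule1 ge0_integralRZ// integral_bool//.
have -> : ((K0 + mu * (fail + 4 / eps ^+ 2 * enorm (grad F y) ^+ 2))%:E =
  K0%:E + mu%:E * (fail + 4 / eps ^+ 2 * enorm (grad F y) ^+ 2)%:E)%E by [].
rewrite leeD2l// lee_wpmul2l//.
have e2 : 0 <= 4 / eps ^+ 2 * enorm (grad F y) ^+ 2.
  by rewrite mulr_ge0 ?sqr_ge0// divr_ge0 ?sqr_ge0.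
(* As in Markov's inequality, the indicator of [enorm (grad F y) > eps / 2] is at most [4 / eps^2]
   times the squared norm; this is the form in which the epoch can pay for it. *)
have [gy|gy] := leP (enorm (grad F y)) (eps / 2).
  apply: le_trans (check_fails j gy) _; by rewrite lee_fin lerDl.
apply: le_trans (probability_le1 P _) _; first exact: measurable_bool_set.
rewrite lee_fin; apply: (@le_trans _ _ (4 / eps ^+ 2 * (eps / 2) ^+ 2)).
  by apply: le_of_eq; field; rewrite gt_eqF.
rewrite ler_wpDl ?(ltW fail_gt0)// ler_wpM2l ?divr_ge0 ?sqr_ge0//.
by rewrite lerXn2r ?nnegrE ?enorm_ge0 ?divr_ge0 ?(ltW eps_gt0)// ltW.
Qed.

End check_descent.

(** Transfers a bound at each fixed point to a point [X] determined by draws independent of those in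
    [h], on an event [r] determined by the same draws as [X]. *)
Lemma freeze_le J1 J2 (X : Omega -> borel_rV R d) (r : Omega -> bool)
    (h : borel_rV R d -> Omega -> R) (g : borel_rV R d -> R) :
  J1 `&` J2 = set0 ->
  mfunT (X : history W J1 -> borel_rV R d) ->
  mfunT (r : history W J1 -> bool) ->
  mfunT (fun p : borel_rV R d * history W J2 => h p.1 p.2) ->
  mfunT g -> (forall x w, 0 <= h x w) ->
  (forall x, (\int[P]_w (h x w)%:E <= (g x)%:E)%E) ->
  (\int[P]_w ((r w)%:R * h (X w) w)%:E <= \int[P]_w ((r w)%:R * g (X w))%:E)%E.
Proof.
move=> J12 mX mr mh mg h0 hg.
pose phi (p : history W J1 * history W J2) : \bar R := ((r p.1)%:R * h (X p.1) p.2)%:E.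
have mphi : mfunT phi.
  apply/measurable_EFinP; apply: measurable_funM.
    exact: (measurableT_comp (measurable_bool_natr mr) measurable_fst).
  apply: (measurableT_comp mh (g := fun p : history W J1 * history W J2 => (X p.1, p.2))).
  apply: measurable_fun_pair; last exact: measurable_snd.
  exact: (measurableT_comp mX measurable_fst).
have phi0 p : (0 <= phi p)%E by rewrite lee_fin mulr_ge0.
have mXO : mfunT X by exact: (measurable_from_history (W := W) (J := J1)).
have mrO : mfunT r by exact: (measurable_from_history (W := W) (J := J1)).
have mhx x : mfunT (h x).
  apply: (measurable_from_history (W := W) (J := J2)).
  apply: (measurableT_comp mh (g := fun w : history W J2 => (x, w))).
  exact: measurable_pair1.
rewrite [leLHS](freeze (vd_independent vd) J12 mphi phi0).
apply: ge0_le_integralR.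
- apply: (measurable_from_history (W := W) (J := J1)); exact: measurable_freeze mphi phi0.
- apply: measurable_funM; first exact: measurable_bool_natr.
  exact: measurableT_comp.
- by move=> w; apply: integral_ge0 => w' _.
- move=> w; rewrite /phi /= ge0_integralRZ//.
  by rewrite EFinM lee_wpmul2l// lee_fin.
Qed.

Definition epoch_src j : set source := [set t | match t with
  | SampleSrc i Epoch _ | SampleSrc i (Inner _) _ | LengthSrc i => i = j
  | _ => False end].
Definition rest_src j : set source := check_src j `|` neon_all_src j.

Let epoch_rest_disjoint j : epoch_src j `&` rest_src j = set0.
Proof.
by rewrite -subset0 => t [ht hr]; case: hr ht => [[i ->]|[[[i ->]|->]|->]].
Qed.

Lemma measurable_epoch_point (dT : measure_display) (T : measurableType dT)
    (om : T -> Omega) (X : T -> borel_rV R d) j :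
  mfunT X ->
  mfunT (fun t => epoch_length W j (om t)) ->
  (forall i, mfunT (fun t => sample W j Epoch i (om t))) ->
  (forall k i, mfunT (fun t => sample W j (Inner k) i (om t))) ->
  mfunT (fun t => epoch_point (om t) j (X t) : borel_rV R d).
Proof. exact: (measurable_scsg_call sa). Qed.

Lemma measurable_epoch_point_src j x :
  mfunT ((fun w => epoch_point w j x) : history W (epoch_src j) -> borel_rV R d).
Proof.
apply: (measurable_epoch_point (om := fun w : history W (epoch_src j) => w)
  (X := cst (x : borel_rV R d))); first exact: measurable_cst.
- by apply: measurable_history_length.
- by move=> i; apply: measurable_history_sample.
- by move=> k i; apply: measurable_history_sample.
Qed.

Let rest_check j i : mfunT
  (fun p : borel_rV R d * history W (rest_src j) => sample W j Check i p.2).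
Proof.
apply: (measurableT_comp _ measurable_snd); apply: measurable_history_sample.
by left; exists i.
Qed.
Let rest_curv j i : mfunT
  (fun p : borel_rV R d * history W (rest_src j) => sample W j Curv i p.2).
Proof.
apply: (measurableT_comp _ measurable_snd); apply: measurable_history_sample.
by right; left; left; exists i.
Qed.
Let rest_seed j : mfunT
  (fun p : borel_rV R d * history W (rest_src j) => seed W j p.2).
Proof.
apply: (measurableT_comp _ measurable_snd); apply: measurable_history_seed.
by right; left; right.
Qed.
Let rest_sign j : mfunT
  (fun p : borel_rV R d * history W (rest_src j) => sign W j p.2).
Proof.
by apply: (measurableT_comp _ measurable_snd); apply: measurable_history_sign; right; right.
Qed.

Section drift.
Variable mu : R.
Hypotheses (mu_ge0 : 0 <= mu) (mu_gain : mu <= neon_gain L2 gamma c).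
Hypothesis mu_rate : mu * (4 / eps ^+ 2) <= descent_rate L1 c' m1 b.
Let gl := neon_gain L2 gamma c + neon_loss L1 L2 gamma c.
Let rate := descent_rate L1 c' m1 b.
Let extra := rate * (V / m1%:R) + (gl + mu) * fail.

(** The squared gradient charged after the check is evaluated at the epoch's output, where
    [descent_rate] times the same square is available. What remains is the large-batch noise and a
    multiple of [fail]. *)
Lemma one_iteration j x :
  (\int[P]_w (F (after_check w j (epoch_point w j x)) - Fmin
     + mu * (~~ stops w j (epoch_point w j x))%:R)%:E
   <= (F x - Fmin + extra)%:E)%E.
Proof.
pose h (y : borel_rV R d) w := F (after_check w j y) - Fmin + mu * (~~ stops w j y)%:R.
pose g (y : borel_rV R d) := F y - Fmin + gl * fail
  + mu * (fail + 4 / eps ^+ 2 * enorm (grad F y) ^+ 2).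
have mg : mfunT g.
  have mF := measurable_objective sa (Y := fun y : borel_rV R d => y) (@measurable_id _ _ _).
  have mgF := measurable_grad_objective L2_ge0 sa (Y := fun y : borel_rV R d => y) (@measurable_id _ _ _).
  apply: measurable_funD; first by apply: measurable_funD => //; exact: measurable_funB.
  apply: measurable_funM => //; apply: measurable_funD => //; apply: measurable_funM => //.
  exact: measurable_enorm_sqr.
have mh : mfunT (fun p : borel_rV R d * history W (rest_src j) => h p.1 p.2).
  have mst : mfunT (fun p : borel_rV R d * history W (rest_src j) =>
      stops p.2 j p.1).
    exact: (measurable_stops (om := fun p : borel_rV R d * history W (rest_src j) => p.2)
      measurable_fst (@rest_check j) (@rest_curv j) (@rest_seed j)).
  apply: measurable_funD.
    apply: measurable_funB => //; apply: (measurable_objective sa).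
    exact: (measurable_after_check
      (om := fun p : borel_rV R d * history W (rest_src j) => p.2)
      measurable_fst (@rest_check j) (@rest_curv j) (@rest_seed j) (@rest_sign j)).
  by apply: measurable_funM => //; apply: measurable_bool_natr; apply: measurable_neg.
have h0 y w : 0 <= h y w by rewrite addr_ge0 ?subr_ge0// mulr_ge0.
have hg y : (\int[P]_w (h y w)%:E <= (g y)%:E)%E.
  exact: (after_check_descent mu_ge0).
have := freeze_le (r := fun=> true) (@epoch_rest_disjoint j) (measurable_epoch_point_src (j := j) x)
  (measurable_cst _) mh mg h0 hg.
rewrite [leLHS](eq_integral (fun w => (h (epoch_point w j x) w)%:E)); last first.
  by move=> w _; rewrite mul1r.
move=> /le_trans; apply.
rewrite (eq_integral (fun w => (g (epoch_point w j x))%:E)); last by move=> w _; rewrite mul1r.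
have mE : mfunT ((fun w => epoch_point w j x) : Omega -> borel_rV R d).
  by apply: (measurable_from_history (W := W) (J := epoch_src j)); exact: measurable_epoch_point_src.
have gl0 : 0 <= gl.
  by rewrite addr_ge0// divr_ge0 ?mulr_ge0 ?exprn_ge0 ?(ltW c_gt0) ?(ltW gamma_gt0)
    ?(ltW L2_gt0) ?(ltW L1_gt0).
have rate0 : 0 <= rate.
  by rewrite divr_ge0 ?mulr_ge0 ?(ltW L1_gt0) ?(ltW c'_gt0)// ltW// (epoch_ratio_gt0 b_m1).
have K0 : 0 <= (gl + mu) * fail by rewrite mulr_ge0 ?(ltW fail_gt0)// addr_ge0.
pose e w : R := F (epoch_point w j x) - Fmin + rate * enorm (grad F (epoch_point w j x)) ^+ 2.
have e0 w : 0 <= e w by rewrite addr_ge0 ?subr_ge0// mulr_ge0// sqr_ge0.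
have me : mfunT e.
  apply: measurable_funD; first by apply: measurable_funB => //; exact: (measurable_objective sa).
  apply: measurable_funM => //; apply: measurable_enorm_sqr.
  exact: (measurable_grad_objective L2_ge0 sa).
apply: (@le_trans _ _ (\int[P]_w (e w + (gl + mu) * fail)%:E)%E).
  apply: ge0_le_integralR => //.
  - by apply/measurable_EFinP; exact: (measurableT_comp mg mE).
  - exact: measurable_funD.
  - move=> w; apply: le_trans (hg _); apply: integral_ge0 => w' _; rewrite lee_fin//.
  - move=> w; rewrite lee_fin /g /e.
    have : mu * (4 / eps ^+ 2) * enorm (grad F (epoch_point w j x)) ^+ 2 <=
           rate * enorm (grad F (epoch_point w j x)) ^+ 2.
      by rewrite ler_wpM2r// sqr_ge0.
    by set q := enorm _ ^+ 2; set z := F _; lra.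
rewrite ge0_integralRD// integral_cst//= probability_setT mule1 /extra addrA EFinD.
rewrite leeD2r//.
exact: (scsg_epoch_descent L2_ge0 sa vd L1_gt0 c'_gt0 c'_le b_m1 FminP).
Qed.

End drift.

Definition sosp (y : 'rV[R]_d) : bool :=
  (enorm (grad F y) <= 3 / 2 * eps) && (- (2 * gamma) <= lambda_min (hess F y)).

Lemma sospP y : reflect (second_order_stationary F (3 / 2 * eps) (2 * gamma) y) (sosp y).
Proof. exact: andP. Qed.

Lemma measurable_sosp : mfunT (sosp : borel_rV R d -> bool).
Proof.
apply: measurable_and.
  apply: measurable_ler_bool; last exact: measurable_cst.
  apply: measurable_enorm; exact: (measurable_grad_objective L2_ge0 sa).
apply: (measurable_fun_bool true); rewrite setTI.
apply: (measurable_lambda_min_ge (H := fun y : borel_rV R d => hess F y)).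
  by rewrite mulr_ge0// ltW.
by move=> i k; exact: (measurable_hess_objective L2_ge0 sa).
Qed.

Lemma iteration_bad_stop j x :
  (\int[P]_w ((stops w j (epoch_point w j x) && ~~ sosp (epoch_point w j x))%:R : R)%:E
   <= fail%:E)%E.
Proof.
pose h (y : borel_rV R d) w : R := (stops w j y && ~~ sosp y)%:R.
have mst : mfunT (fun p : borel_rV R d * history W (rest_src j) =>
    stops p.2 j p.1).
  exact: (measurable_stops (om := fun p : borel_rV R d * history W (rest_src j) => p.2)
    measurable_fst (@rest_check j) (@rest_curv j) (@rest_seed j)).
have mh : mfunT (fun p : borel_rV R d * history W (rest_src j) => h p.1 p.2).
  apply: measurable_bool_natr; apply: measurable_and => //; apply: measurable_neg.
  exact: (measurableT_comp measurable_sosp measurable_fst).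
have mstO y : mfunT (fun w => stops w j y).
  by apply: (measurable_stops (om := id) (Y := cst (y : borel_rV R d))).
have hg y : (\int[P]_w (h y w)%:E <= fail%:E)%E.
  rewrite /h; case: sospP => so /=.
    rewrite (eq_integral (fun=> 0%E)) ?integral0 ?lee_fin ?(ltW fail_gt0)//.
    by move=> w _; rewrite andbF.
  rewrite (eq_integral (fun w => ((stops w j y)%:R : R)%:E)); last by move=> w _; rewrite andbT.
  rewrite integral_bool//; exact: bad_stop.
have := freeze_le (r := fun=> true) (g := fun=> fail) (@epoch_rest_disjoint j)
  (measurable_epoch_point_src (j := j) x) (measurable_cst _) mh (measurable_cst _)
  (fun y w => ler0n _ _) hg.
rewrite [leLHS](eq_integral (fun w => (h (epoch_point w j x) w)%:E)); last first.
  by move=> w _; rewrite mul1r.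
move=> /le_trans; apply.
rewrite (eq_integral (fun=> fail%:E)); last by move=> w _; rewrite mul1r.
by rewrite integral_cst//= probability_setT mule1.
Qed.

Definition run_x (w : Omega) j : 'rV[R]_d :=
  neonA_x f L2 eps gamma c (scsg_call f L1 c' m1 b W w) (check_batch s W w)
    (curv_batch n2 W w) (neon_call neon W w) (signs W w) x1 j.

Definition run_reached (w : Omega) j : bool :=
  reached f L2 eps gamma c (scsg_call f L1 c' m1 b W w) (check_batch s W w)
    (curv_batch n2 W w) (neon_call neon W w) (signs W w) x1 j.

Definition run_cost (w : Omega) j x : R :=
  (scsg_call_cost m1 b W w j + s
   + (if met w j (epoch_point w j x)
      then neon_cost f (curv_batch n2 W w) (neon_call neon W w) j (epoch_point w j x)
      else 0))%:R.

Lemma run_reached0 w : run_reached w 0.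
Proof. by apply/forallP => -[]. Qed.

Lemma run_reachedS w j :
  run_reached w j.+1 = run_reached w j && ~~ stops w j (epoch_point w j (run_x w j)).
Proof.
apply/forallP/andP => [h|[/forallP h hj] i].
  split; last exact: (h ord_max).
  by apply/forallP => i; exact: (h (widen_ord (leqnSn j) i)).
have [->|ij] := eqVneq i ord_max; first exact: hj.
have lij : (i < j)%N.
  by have := ltn_ord i; rewrite ltnS leq_eqVlt => /predU1P[ij'|//]; case/eqP: ij; exact: val_inj.
exact: (h (Ordinal lij)).
Qed.

Definition source_index (t : source) : nat := match t with
  | SampleSrc i _ _ | LengthSrc i | SeedSrc i | SignSrc i => i end.
Definition past j : set source := [set t | (source_index t < j)%N].
Definition now j : set source := [set t | source_index t = j].

Let past_now j : past j `&` now j = set0.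
Proof. by rewrite -subset0 => t [/[swap] <-]; rewrite /past/= ltnn. Qed.

Let now_past j k : (j < k)%N -> now j `<=` past k.
Proof. by move=> jk t /= tj; rewrite /past /= tj. Qed.

Section measurability.
Context {dT : measure_display} {T : measurableType dT}.
Variables (om : T -> Omega) (j : nat) (X : T -> borel_rV R d).
Hypothesis mX : mfunT X.
Hypothesis mS : forall r i, mfunT (fun t => sample W j r i (om t)).
Hypothesis mN : mfunT (fun t => epoch_length W j (om t)).
Hypothesis mU : mfunT (fun t => seed W j (om t)).

Lemma measurable_run_y :
  mfunT (fun t => epoch_point (om t) j (X t) : borel_rV R d).
Proof. by apply: measurable_epoch_point => //; move=> k; exact: mS. Qed.

Lemma measurable_run_stops :
  mfunT (fun t => stops (om t) j (epoch_point (om t) j (X t))).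
Proof. exact: (measurable_stops measurable_run_y (mS Check) (mS Curv) mU). Qed.

Lemma measurable_run_next : mfunT (fun t => sign W j (om t)) ->
  mfunT
    (fun t => after_check (om t) j (epoch_point (om t) j (X t)) : borel_rV R d).
Proof.
exact: (measurable_after_check measurable_run_y (mS Check) (mS Curv) mU).
Qed.

Lemma measurable_call_cost :
  mfunT (fun t => (scsg_call_cost m1 b W (om t) j)%:R : R).
Proof.
rewrite [X in measurable_fun _ X](_ : _ = fun t =>
  (m1 + 2 * b * epoch_length W j (om t))%N%:R : R); last first.
  by apply/funext => t; rewrite /scsg_call_cost /scsg_cost size_tuple.
exact: (measurableT_comp (f := fun k : nat => (m1 + 2 * b * k)%N%:R : R)).
Qed.

Lemma measurable_run_cost : mfunT (fun t => run_cost (om t) j (X t)).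
Proof.
have mY := measurable_run_y.
have mm := measurable_met mY (mS Check).
have mc := measurable_call_cost.
rewrite [X in measurable_fun _ X](_ : _ = fun t =>
  (scsg_call_cost m1 b W (om t) j)%:R + s%:R + (if met (om t) j (epoch_point (om t) j (X t))
   then (neon_cost f (curv_batch n2 W (om t)) (neon_call neon W (om t)) j
     (epoch_point (om t) j (X t)))%:R else 0)); last first.
  by apply/funext => t; rewrite /run_cost !natrD; case: (met _ _ _).
apply: measurable_funD; first exact: measurable_funD.
apply: measurable_fun_ifT => //.
exact: (measurable_neon_cost ng mY (mS Curv) mU).
Qed.

End measurability.

Section at_history.
Variables (J : set source) (j : nat).
Hypothesis nowJ : now j `<=` J.

Lemma history_now_sample r i : mfunT (sample W j r i : history W J -> Xi).
Proof. by apply: measurable_history_sample; exact: nowJ. Qed.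
Lemma history_now_length : mfunT (epoch_length W j : history W J -> nat).
Proof. by apply: measurable_history_length; exact: nowJ. Qed.
Lemma history_now_seed : mfunT (seed W j : history W J -> U).
Proof. by apply: measurable_history_seed; exact: nowJ. Qed.
Lemma history_now_sign : mfunT (sign W j : history W J -> R).
Proof. by apply: measurable_history_sign; exact: nowJ. Qed.

End at_history.

Lemma measurable_run_x k j : (j <= k)%N ->
  mfunT ((fun w => run_x w j) : history W (past k) -> borel_rV R d).
Proof.
elim: j => [_|j IH jk]; first exact: measurable_cst.
have nowJ := now_past jk.
apply: (measurable_run_next (om := fun w : history W (past k) => w) (IH (ltnW jk))).
- exact: history_now_sample.
- exact: history_now_length.
- exact: history_now_seed.
- exact: history_now_sign.
Qed.

Lemma measurable_run_reached k j : (j <= k)%N ->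
  mfunT ((fun w => run_reached w j) : history W (past k) -> bool).
Proof.
elim: j => [_|j IH jk].
  rewrite [X in measurable_fun _ X](_ : _ = cst true); first exact: measurable_cst.
  by apply/funext => w; rewrite run_reached0.
have nowJ := now_past jk.
under eq_fun do rewrite run_reachedS.
apply: measurable_and; first exact: IH (ltnW jk).
apply: measurable_neg.
apply: (measurable_run_stops (om := fun w : history W (past k) => w) (measurable_run_x (ltnW jk))).
- exact: history_now_sample.
- exact: history_now_length.
- exact: history_now_seed.
Qed.

Let mxO j : mfunT ((fun w => run_x w j) : Omega -> borel_rV R d).
Proof.
by apply: (measurable_from_history (W := W) (J := past j)); exact: measurable_run_x.
Qed.

Let mrO j : mfunT (fun w => run_reached w j).
Proof.
by apply: (measurable_from_history (W := W) (J := past j)); exact: measurable_run_reached.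
Qed.

Let nowS j r i : mfunT
  (fun p : borel_rV R d * history W (now j) => sample W j r i p.2).
Proof. by apply: (measurableT_comp _ measurable_snd); exact: history_now_sample. Qed.
Let nowN j : mfunT
  (fun p : borel_rV R d * history W (now j) => epoch_length W j p.2).
Proof. by apply: (measurableT_comp _ measurable_snd); exact: history_now_length. Qed.
Let nowU j : mfunT
  (fun p : borel_rV R d * history W (now j) => seed W j p.2).
Proof. by apply: (measurableT_comp _ measurable_snd); exact: history_now_seed. Qed.
Let nowZ j : mfunT
  (fun p : borel_rV R d * history W (now j) => sign W j p.2).
Proof. by apply: (measurableT_comp _ measurable_snd); exact: history_now_sign. Qed.

Let mrun_sosp j : mfunT (fun w => sosp (epoch_point w j (run_x w j))).
Proof.
apply: (measurableT_comp measurable_sosp).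
apply: (measurable_from_history (W := W) (J := past j.+1)).
have nowJ := now_past (ltnSn j).
apply: (measurable_run_y (om := fun w : history W (past j.+1) => w)
  (measurable_run_x (leqnSn j))); [exact: history_now_sample|exact: history_now_length].
Qed.

Let mrun_stops j : mfunT (fun w => stops w j (epoch_point w j (run_x w j))).
Proof.
apply: (measurable_from_history (W := W) (J := past j.+1)).
have nowJ := now_past (ltnSn j).
apply: (measurable_run_stops (om := fun w : history W (past j.+1) => w)
    (measurable_run_x (leqnSn j))).
- exact: history_now_sample.
- exact: history_now_length.
- exact: history_now_seed.
Qed.

(** Reaching iteration [j] and the value of [x_j] depend on earlier draws only. This is the step
    behind Wald's argument, and it serves the drift, the bad stops and the cost alike. *)
Lemma reached_le j (h : borel_rV R d -> Omega -> R) (g : borel_rV R d -> R) :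
  mfunT (fun p : borel_rV R d * history W (now j) => h p.1 p.2) ->
  mfunT g -> (forall x w, 0 <= h x w) ->
  (forall x, (\int[P]_w (h x w)%:E <= (g x)%:E)%E) ->
  (\int[P]_w ((run_reached w j)%:R * h (run_x w j) w)%:E <=
   \int[P]_w ((run_reached w j)%:R * g (run_x w j))%:E)%E.
Proof.
exact: (freeze_le (past_now j) (measurable_run_x (leqnn j)) (measurable_run_reached (leqnn j))).
Qed.

Definition reach_prob j : R := fine (P [set w | run_reached w j]).

Lemma reach_probE j : P [set w | run_reached w j] = (reach_prob j)%:E.
Proof. by rewrite fineK// fin_num_measure//; exact: measurable_bool_set. Qed.

Lemma reach_prob_ge0 j : 0 <= reach_prob j.
Proof. exact: fine_ge0. Qed.

Lemma integral_reached j (k : R) : 0 <= k ->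
  (\int[P]_w ((run_reached w j)%:R * k)%:E = (k * reach_prob j)%:E)%E.
Proof.
move=> k0; rewrite (eq_integral (fun w => (k * (run_reached w j)%:R)%:E)); last first.
  by move=> w _; rewrite mulrC.
rewrite ge0_integralRZ//; last exact: measurable_bool_natr.
by rewrite integral_bool// reach_probE.
Qed.

(** * Summation over the run *)

Section potential.
Variable mu : R.
Hypotheses (mu_gt0 : 0 < mu) (mu_gain : mu <= neon_gain L2 gamma c).
Hypothesis mu_rate : mu * (4 / eps ^+ 2) <= descent_rate L1 c' m1 b.
Hypothesis mu_extra : descent_rate L1 c' m1 b * (V / m1%:R)
  + (neon_gain L2 gamma c + neon_loss L1 L2 gamma c + mu) * fail <= mu / 2.
Let mu_ge0 : 0 <= mu. Proof. exact: ltW. Qed.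

(** The restriction to reached iterations matters: [run_x] is continued formally after a return. *)
Definition potential j : \bar R :=
  (\int[P]_w ((run_reached w j)%:R * (F (run_x w j) - Fmin))%:E)%E.

Lemma potential_ge0 j : (0 <= potential j)%E.
Proof. by apply: integral_ge0 => w _; rewrite lee_fin mulr_ge0// subr_ge0. Qed.

Lemma integral_reachedD j (k : R) : 0 <= k ->
  (\int[P]_w ((run_reached w j)%:R * (F (run_x w j) - Fmin + k))%:E =
   potential j + (k * reach_prob j)%:E)%E.
Proof.
move=> k0; rewrite -integral_reached// -ge0_integralRD.
- by apply: eq_integral => w _; rewrite mulrDr.
- apply: measurable_funM; first exact: measurable_bool_natr.
  by apply: measurable_funB => //; exact: (measurable_objective sa).
- by apply: measurable_funM => //; exact: measurable_bool_natr.
- by move=> w; rewrite mulr_ge0// subr_ge0.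
- by move=> w; rewrite mulr_ge0.
Qed.

(** Reaching [j.+1] means reaching [j] without stopping there. When the run stops, the left
    integrand vanishes while the right one keeps a nonnegative gap [F - Fmin]. *)
Lemma potential_drift j :
  (potential j.+1 + (mu * reach_prob j.+1)%:E <= potential j + (mu / 2 * reach_prob j)%:E)%E.
Proof.
rewrite -!integral_reachedD ?divr_ge0//.
pose h (x : borel_rV R d) w := F (after_check w j (epoch_point w j x)) - Fmin
  + mu * (~~ stops w j (epoch_point w j x))%:R.
pose g (x : borel_rV R d) := F x - Fmin + mu / 2.
have h0 x w : 0 <= h x w by rewrite addr_ge0 ?subr_ge0// mulr_ge0.
have mh : mfunT (fun p : borel_rV R d * history W (now j) => h p.1 p.2).
  apply: measurable_funD.
    apply: measurable_funB => //; apply: (measurable_objective sa).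
    exact: (measurable_run_next (om := fun p : borel_rV R d * history W (now j) => p.2)
      measurable_fst (@nowS j) (@nowN j) (@nowU j) (@nowZ j)).
  apply: measurable_funM => //; apply: measurable_bool_natr; apply: measurable_neg.
  exact: (measurable_run_stops (om := fun p : borel_rV R d * history W (now j) => p.2)
      measurable_fst (@nowS j) (@nowN j) (@nowU j)).
have mg : mfunT g.
  apply: measurable_funD => //; apply: measurable_funB => //.
  exact: (measurable_objective sa (Y := fun y : borel_rV R d => y) (@measurable_id _ _ _)).
have hg x : (\int[P]_w (h x w)%:E <= (g x)%:E)%E.
  apply: le_trans (one_iteration mu_ge0 mu_gain mu_rate j x) _.
  by rewrite lee_fin lerD2l.
apply: le_trans (reached_le mh mg h0 hg).
apply: ge0_le_integral => //.
- by move=> w _; rewrite lee_fin mulr_ge0// addr_ge0// subr_ge0.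
- apply/measurable_EFinP; apply: measurable_funM; first exact: measurable_bool_natr.
  by apply: measurable_funD => //; apply: measurable_funB => //; exact: (measurable_objective sa).
- apply/measurable_EFinP; apply: measurable_funM; first exact: measurable_bool_natr.
  apply: measurable_funD.
    by apply: measurable_funB => //; exact: (measurable_objective sa (mxO j.+1)).
  apply: measurable_funM => //; apply: measurable_bool_natr; apply: measurable_neg.
  exact: mrun_stops.
- move=> w _; rewrite lee_fin run_reachedS /h -/(after_check w j (epoch_point w j (run_x w j))).
  case: (run_reached w j) => /=; last by rewrite !mul0r.
  case: (stops w j _) => /=; rewrite ?mul0r ?mul1r ?mulr1//.
  by rewrite mulr0 addr0 subr_ge0.
Qed.

(** Each iteration collects [mu] times the probability of continuing and gives back at most [mu / 2]
    times that of being reached; the other half accumulates in the sum. *)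
Lemma potential_sum n :
  (potential n + (mu * reach_prob n + mu / 2 * \sum_(j < n) reach_prob j)%:E
   <= (F x1 - Fmin + mu)%:E)%E.
Proof.
elim: n => [|n IH].
  rewrite big_ord0 mulr0 addr0 -integral_reachedD//.
  rewrite (eq_integral (fun=> (F x1 - Fmin + mu)%:E)); last first.
    by move=> w _; rewrite run_reached0 mul1r.
  by rewrite integral_cst//= probability_setT mule1.
apply: le_trans IH; rewrite big_ord_recr/=.
move: (potential_drift n); move: (potential n) (potential n.+1) (reach_prob n)
  (reach_prob n.+1) (\sum_(j < n) reach_prob j) => p p1 r r1 S drift.
have -> : mu * r + mu / 2 * S = mu / 2 * r + (mu / 2 * S + mu / 2 * r).
  by rewrite {1}(splitr mu) mulrDl -addrA [mu / 2 * S + _]addrC.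
rewrite [mu / 2 * (S + r)]mulrDr.
by rewrite EFinD addeA [X in (_ <= _ + X)%E]EFinD addeA leeD2r.
Qed.

Definition mean_iterations : R := 2 * (F x1 - Fmin) / mu + 2.

Lemma sum_reach_prob n : \sum_(j < n) reach_prob j <= mean_iterations.
Proof.
have : ((mu / 2 * \sum_(j < n) reach_prob j)%:E <= (F x1 - Fmin + mu)%:E)%E.
  apply: le_trans (potential_sum n); rewrite EFinD addeA.
  apply: leeDr; rewrite adde_ge0 ?potential_ge0// lee_fin mulr_ge0//.
  exact: reach_prob_ge0.
rewrite lee_fin => h; rewrite -(ler_pM2l (x := mu / 2)) ?divr_gt0//.
apply: le_trans h _; apply: le_of_eq; rewrite /mean_iterations.
by field; rewrite gt_eqF.
Qed.

(** Uniformly bounded partial sums exclude a positive lower bound on the terms. This gives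
    termination up to an arbitrarily small probability. *)
Lemma reach_prob_small e : 0 < e -> exists n, reach_prob n <= e.
Proof.
move=> e0; apply: contrapT => h.
have ge n : e <= reach_prob n.
  by rewrite leNgt; apply/negP => lt; apply: h; exists n; exact: ltW.
have sm n : n%:R * e <= mean_iterations.
  apply: le_trans (sum_reach_prob n); rewrite mulr_natl -[n in _ *+ n]card_ord -sumr_const.
  by apply: ler_sum => i _.
have B0 : 0 <= mean_iterations.
  by apply: le_trans (sum_reach_prob 0); rewrite big_ord0.
have := archi_boundP (divr_ge0 B0 (ltW e0)).
by rewrite ltr_pdivrMr// ltNge sm.
Qed.

Let returns_good (w : Omega) j := [&& run_reached w j,
  stops w j (epoch_point w j (run_x w j)) & sosp (epoch_point w j (run_x w j))].
Let returns_bad (w : Omega) j := [&& run_reached w j,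
  stops w j (epoch_point w j (run_x w j)) & ~~ sosp (epoch_point w j (run_x w j))].

Let measurable_good j : measurable [set w | returns_good w j].
Proof. by apply: measurable_bool_set; do 2 apply: measurable_and => //. Qed.

Let measurable_bad j : mfunT (fun w => returns_bad w j).
Proof. by do 2 apply: measurable_and => //; apply: measurable_neg. Qed.

Lemma returns_bad_prob j : (P [set w | returns_bad w j] <= (fail * reach_prob j)%:E)%E.
Proof.
rewrite -integral_bool// -integral_reached ?(ltW fail_gt0)//.
pose h (x : borel_rV R d) w : R :=
  (stops w j (epoch_point w j x) && ~~ sosp (epoch_point w j x))%:R.
have mh : mfunT (fun p : borel_rV R d * history W (now j) => h p.1 p.2).
  apply: measurable_bool_natr; apply: measurable_and.
    exact: (measurable_run_stops (om := fun p : borel_rV R d * history W (now j) => p.2)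
      measurable_fst (@nowS j) (@nowN j) (@nowU j)).
  apply: measurable_neg; apply: (measurableT_comp measurable_sosp).
  exact: (measurable_run_y (om := fun p : borel_rV R d * history W (now j) => p.2)
      measurable_fst (@nowS j) (@nowN j)).
have hg x : (\int[P]_w (h x w)%:E <= fail%:E)%E.
  exact: iteration_bad_stop.
apply: le_trans (reached_le mh (measurable_cst fail) (fun _ _ => ler0n _ _) hg).
apply: le_of_eq; apply: eq_integral => w _.
by rewrite /returns_bad /h; case: (run_reached w j); rewrite ?mul1r ?mul0r.
Qed.

Lemma stopped_good_or_bad n w : ~~ run_reached w n ->
  (exists j, returns_good w j) \/ exists2 j, (j < n)%N & returns_bad w j.
Proof.
elim: n => [|n IH]; first by rewrite run_reached0.
rewrite run_reachedS negb_and negbK; case: (boolP (run_reached w n)) => /= rn.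
  move=> st; case: (boolP (sosp (epoch_point w n (run_x w n)))) => so.
    by left; exists n; rewrite /returns_good rn st.
  by right; exists n => //; rewrite /returns_bad rn st.
by move=> _; have [|[j jn bj]] := IH rn; [left|right; exists j; rewrite // ltnW].
Qed.

Definition success : set Omega := [set w | exists y : 'rV[R]_d,
  neon_scsg_returns f L1 L2 c' c eps gamma m1 b s n2 neon W x1 w y /\
  second_order_stationary F (3 / 2 * eps) (2 * gamma) y].

Lemma successE : success = \bigcup_j [set w | returns_good w j].
Proof.
apply/seteqP; split=> w.
  by move=> [y [[j [rj sj ->]] so]]; exists j => //; apply/and3P; split => //; exact/sospP.
move=> [j _ /and3P[rj sj so]]; exists (epoch_point w j (run_x w j)).
by split; [exists j|exact/sospP].
Qed.

(** Failure means still running at a late iteration, with probability at most [e], or a bad stop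
    before it. Each bad stop costs [fail] times the probability of being reached, so the union bound
    involves the mean number of iterations. *)
Lemma success_prob e : 0 < e ->
  ((1 - (e + fail * mean_iterations))%:E <= P success)%E.
Proof.
move=> e0; have [n rn] := reach_prob_small e0.
have mS : measurable success by rewrite successE; exact: bigcupT_measurable.
have mB : measurable (\big[setU/set0]_(j < n) [set w | returns_bad w j]).
  by apply: bigsetU_measurable => j _; exact: measurable_bool_set.
have mR : measurable [set w | run_reached w n] by exact: measurable_bool_set.
have sub : ~` success `<=`
    [set w | run_reached w n] `|` \big[setU/set0]_(j < n) [set w | returns_bad w j].
  move=> w ns; case: (boolP (run_reached w n)) => rw; first by left.
  right; have [[j gj]|[j jn bj]] := stopped_good_or_bad rw.
    by case: ns; rewrite successE; exists j.
  by rewrite -(bigcup_mkord n (fun j => [set w | returns_bad w j])); exists j.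
have : (P (~` success) <= (e + fail * mean_iterations)%:E)%E.
  apply: (@le_trans _ _ (P ([set w | run_reached w n] `|`
      \big[setU/set0]_(j < n) [set w | returns_bad w j]))).
    apply: le_measure; rewrite ?inE//; [exact: measurableC|exact: measurableU].
  apply: le_trans (measureU2 _ _ _) _ => //; rewrite EFinD leeD//.
    by have := reach_probE n; rewrite -lee_fin in rn; move=> /= ->.
  apply: (@le_trans _ _ (\sum_(j < n) P [set w | returns_bad w j])%E).
    exact: (Boole_inequality P (A := fun j => [set w | returns_bad w j])
      (fun j _ => measurable_bool_set (measurable_bad j))).
  apply: (@le_trans _ _ (\sum_(j < n) (fail * reach_prob j)%:E)%E).
    by apply: lee_sum => j _; exact: returns_bad_prob.
  by rewrite sumEFin lee_fin -mulr_sumr ler_pM2l// sum_reach_prob.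
have -> : P (~` success) = (1 - P success)%E by exact: probability_setC.
rewrite -(fineK (fin_num_measure P _ mS)) -EFinB !lee_fin.
by move=> ?; rewrite lerBlDl -lerBlDr.
Qed.

(** Any realization bounds a natural number by [Tn], and there is one since [P] has mass 1. *)
Lemma neon_bound_ge0 : 0 <= Tn.
Proof.
have [E|/set0P[w0 _]] := eqVneq [set: Omega] set0.
  have : (P setT = 1)%E by exact: probability_setT.
  by rewrite E measure0 => /eqP; rewrite eq_sym onee_eq0.
exact: le_trans (ler0n _ _) (ng_cost ng w0 0%N x1).
Qed.

Lemma integral_run_cost j x :
  (\int[P]_w (run_cost w j x)%:E <= (3 * m1%:R + s%:R + Tn)%:E)%E.
Proof.
have Tn0 := neon_bound_ge0.
have mcost : mfunT (fun w => (scsg_call_cost m1 b W w j)%:R : R).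
  exact: (measurable_call_cost (om := id)).
apply: (@le_trans _ _ (\int[P]_w ((scsg_call_cost m1 b W w j)%:R + (s%:R + Tn))%:E)%E).
  apply: ge0_le_integral => //.
  - by move=> w _; rewrite lee_fin.
  - apply/measurable_EFinP.
    exact: (measurable_run_cost (om := id) (X := cst (x : borel_rV R d)) (measurable_cst _)).
  - by apply/measurable_EFinP; exact: measurable_funD.
  - move=> w _; rewrite lee_fin /run_cost !natrD -addrA lerD2l lerD2l.
    case: (met _ _ _); last exact: Tn0.
    exact: (ng_cost ng).
rewrite (ge0_integralRD P (h := fun=> s%:R + Tn))//; last by move=> w; rewrite addr_ge0.
rewrite integral_cst//= probability_setT mule1.
have -> : (3 * m1%:R + s%:R + Tn)%:E = ((3 * m1%:R)%:E + (s%:R + Tn)%:E)%E.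
  by rewrite -EFinD addrA.
apply: leeD2r; exact: (scsg_mean_cost vd b_m1).
Qed.

(** The cost is a series of nonnegative terms, so expectation and sum commute; each term is at most
    the mean cost of one iteration times the probability of reaching it. *)
Lemma mean_total_cost :
  (\int[P]_w neon_scsg_cost f L1 L2 c' c eps gamma m1 b s n2 neon W x1 w
   <= (mean_iterations * (3 * m1%:R + s%:R + Tn))%:E)%E.
Proof.
have Tn0 := neon_bound_ge0.
set Kc := 3 * m1%:R + s%:R + Tn.
have Kc0 : 0 <= Kc by rewrite !addr_ge0// mulr_ge0.
pose u j w : \bar R := ((run_reached w j)%:R * run_cost w j (run_x w j))%:E.
have u0 j w : (0 <= u j w)%E by rewrite lee_fin mulr_ge0.
have mu_ j : mfunT (u j).
  apply/measurable_EFinP; apply: measurable_funM; first exact: measurable_bool_natr.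
  exact: (measurable_run_cost (om := id) (mxO j)).
have -> : (\int[P]_w neon_scsg_cost f L1 L2 c' c eps gamma m1 b s n2 neon W x1 w =
    \int[P]_w \sum_(j <oo) u j w)%E.
  apply: eq_integral => w _; apply: eq_eseriesr => j _.
  rewrite /u /run_cost -/(run_reached w j); case: (run_reached w j); last by rewrite mul0r.
  by rewrite mul1r /iteration_cost /check_batch size_tuple.
rewrite integral_nneseries//; apply: nneseries_le => [j|n].
  by apply: integral_ge0 => w _; exact: u0.
apply: (@le_trans _ _ (\sum_(j < n) (Kc * reach_prob j)%:E)%E).
  apply: lee_sum => j _; rewrite -integral_reached//.
  apply: (reached_le (h := fun x w => run_cost w j x) (g := fun=> Kc)) => //.
  - exact: (measurable_run_cost (om := fun p : borel_rV R d * history W (now j) => p.2)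
      measurable_fst (@nowS j) (@nowN j) (@nowU j)).
  - by move=> x; exact: integral_run_cost.
by rewrite sumEFin lee_fin -mulr_sumr mulrC ler_wpM2r// sum_reach_prob.
Qed.

End potential.

End iteration.

(** * The decrease guaranteed by one epoch *)

Section decrease.
Context {R : realType} {d : nat} {dO dX dU : measure_display}.
Context {Omega : measurableType dO} {P : probability Omega R}.
Context {Xi : measurableType dX} {U : measurableType dU}.
Variables (D : probability Xi R) (f : 'rV[R]_d -> Xi -> R) (W : draws P Xi U).
Variables (L1 L2 Delta G V : R) (x1 : 'rV[R]_d).
Hypotheses (L1_gt0 : 0 < L1) (L2_ge0 : 0 <= L2).
Hypothesis sa : standing_assumptions D f L1 L2 Delta G V x1.
Variables (c' eps Fmin : R) (m1 b : nat).
Hypotheses (c'_gt0 : 0 < c') (c'_le : c' <= 1 / 6) (b_m1 : (0 < b <= m1)%N).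
Hypothesis vd : valid_draws D m1 b W.
Let F := objective D f.
Hypothesis FminP : forall x, Fmin <= F x.

(** In the epoch inequality the mean squared gradient contributes at least [eps^2], and the noise
    takes back at most half of it. *)
Lemma epoch_guarantees_decrease j : V / m1%:R <= eps ^+ 2 / 2 ->
  guarantees_decrease P F (fun w => scsg_call f L1 c' m1 b W w j) eps
    (descent_rate L1 c' m1 b * (eps ^+ 2 / 2)).
Proof.
move=> Vm x; set rate := descent_rate L1 c' m1 b.
have rate0 : 0 <= rate.
  by rewrite divr_ge0 ?mulr_ge0 ?(ltW L1_gt0) ?(ltW c'_gt0)// ltW// (epoch_ratio_gt0 b_m1).
pose y w : borel_rV R d := (scsg_call f L1 c' m1 b W w j x).1.
rewrite -[X in (X <= _)%E -> _]/((eps ^+ 2)%:E) => gy.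
have my : mfunT y.
  apply: (measurable_scsg_call sa c' m1 b (om := id) (X := cst (x : borel_rV R d))) => //.
have mF : mfunT (fun w => F (y w) - Fmin).
  by apply: measurable_funB => //; exact: (measurable_objective sa).
have mg : mfunT (fun w => enorm (grad F (y w)) ^+ 2).
  by apply: measurable_enorm_sqr; exact: (measurable_grad_objective L2_ge0 sa).
have := scsg_epoch_descent L2_ge0 sa vd L1_gt0 c'_gt0 c'_le b_m1 FminP j x.
rewrite -/rate -[X in (X <= _)%E -> _]/(\int[P]_w (F (y w) - Fmin + rate * enorm (grad F (y w)) ^+ 2)%:E)%E.
rewrite ge0_integralRD//; last 3 first.
- exact: measurable_funM.
- by move=> w; rewrite subr_ge0.
- by move=> w; rewrite mulr_ge0// sqr_ge0.
rewrite ge0_integralRZ//; last by move=> w; rewrite sqr_ge0.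
set IF := (\int[P]_w (F (y w) - Fmin)%:E)%E => h.
have IF0 : (0 <= IF)%E by apply: integral_ge0 => w _; rewrite lee_fin subr_ge0.
have {h} h : (IF + (rate * eps ^+ 2)%:E <= (F x - Fmin + rate * (V / m1%:R))%:E)%E.
  apply: le_trans h; rewrite leeD2l// EFinM lee_wpmul2l//.
have IFfin : IF \is a fin_num.
  rewrite ge0_fin_numE//; apply: le_lt_trans (ltry (F x - Fmin + rate * (V / m1%:R))).
  by apply: le_trans h; rewrite leeDl// lee_fin mulr_ge0// sqr_ge0.
(* The integrand of the conclusion is signed; integrability, from the bound on [IF], must come
   before the splitting of the difference. *)
have iF : P.-integrable setT (fun w => (F (y w) - Fmin)%:E).
  apply/integrableP; split; first exact/measurable_EFinP.
  rewrite (eq_integral (fun w => (F (y w) - Fmin)%:E)) -?ge0_fin_numE//.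
  by move=> w _; rewrite gee0_abs// lee_fin subr_ge0.
have iC : P.-integrable setT (fun=> (F x - Fmin)%:E).
  exact: integrableR_cst.
have -> : (\int[P]_w (F (scsg_call f L1 c' m1 b W w j x).2 - F x)%:E = IF - (F x - Fmin)%:E)%E.
  transitivity (\int[P]_w ((F (y w) - Fmin)%:E - (F x - Fmin)%:E))%E.
    apply: eq_integral => w _; rewrite -EFinB; congr EFin.
    by rewrite -/F /= opprB addrA subrK.
  by rewrite integralB// integral_cst//= probability_setT mule1.
move: h; rewrite -(fineK IFfin) -EFinD -EFinB !lee_fin.
have : rate * (V / m1%:R) <= rate * (eps ^+ 2 / 2) by exact: ler_wpM2l.
have -> : rate * eps ^+ 2 = rate * (eps ^+ 2 / 2) + rate * (eps ^+ 2 / 2).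
  by rewrite -mulrDr -splitr.
move: (rate * (eps ^+ 2 / 2)) (rate * _) (fine IF) (F x) => A B I Fx; lra.
Qed.

End decrease.

(** * The common scale of the iteration and sample bounds *)

Section scaling.
Context {R : realType}.

Lemma log_factor_ge1 (d : nat) (eps gamma delta : R) : (0 < d)%N ->
  0 < eps <= 1 -> 0 < gamma <= 1 -> 0 < delta < 1 -> 1 <= log_factor d eps gamma delta.
Proof.
move=> d0 /andP[e0 e1] /andP[g0 g1] /andP[l0 l1]; rewrite /log_factor -!addrA lerDl.
have inv_ln (x : R) : 0 < x -> x <= 1 -> 0 <= ln x^-1.
  by move=> x0 x1; rewrite ln_ge0// invf_ge1.
by rewrite !addr_ge0// ?inv_ln ?ln_ge0 ?ler1n// ltW.
Qed.

Lemma maxrXn (x y : R) n : 0 <= x -> 0 <= y ->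
  Num.max (x ^+ n) (y ^+ n) = Num.max x y ^+ n.
Proof.
move=> x0 y0; case: (leP x y) => xy; first by rewrite max_r// lerXn2r ?nnegrE.
by rewrite max_l// lerXn2r ?nnegrE// ltW.
Qed.

Variables (eps gamma : R) (b : nat).
Hypotheses (eps_gt0 : 0 < eps) (gamma_gt0 : 0 < gamma) (b_gt0 : (0 < b)%N).

(** The two maxima of the statement are powers of this one quantity: its square is the iteration
    bound, and the cube of its quotient by [b^(1/6)] the epoch size. Hence a sample size of the
    stated order supports the stated number of iterations. *)
Definition bound_root : R :=
  Num.max (b%:R `^ (1 / 6) / (eps `^ (1 / 3)) ^+ 2) ((gamma `^ (1 / 2)) ^+ 3)^-1.

Let bR : 0 < b%:R :> R. Proof. by rewrite ltr0n. Qed.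

(** Replaces fractional powers by integer powers of [eps^(1/3)], [gamma^(1/2)] and [b^(1/6)], after
    which field arithmetic applies. *)
Lemma powR_expr (z t u : R) n : 0 < z -> u = n%:R * t -> z `^ u = (z `^ t) ^+ n.
Proof. by move=> z0 ->; rewrite mulrC powRrM powR_mulrn// powR_ge0. Qed.

Let epsE : eps = (eps `^ (1 / 3)) ^+ 3.
Proof. by rewrite -(@powR_expr _ _ 1)// ?powRr1 ?ltW//; field. Qed.
Let gammaE : gamma = (gamma `^ (1 / 2)) ^+ 2.
Proof. by rewrite -(@powR_expr _ _ 1)// ?powRr1 ?ltW//; field. Qed.

Lemma bound_root_gt0 : 0 < bound_root.
Proof. by rewrite lt_max divr_gt0 ?exprn_gt0// ?powR_gt0. Qed.

Lemma iteration_boundE : iteration_bound eps gamma b = bound_root ^+ 2.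
Proof.
rewrite /bound_root -maxrXn ?divr_ge0 ?invr_ge0 ?exprn_ge0 ?powR_ge0//.
rewrite /iteration_bound (@powR_expr b%:R (1 / 6) (1 / 3) 2)//; last by field.
rewrite (@powR_expr eps (1 / 3) (4 / 3) 4)//; last by field.
congr Num.max; first by rewrite expr_div_n -exprM.
by rewrite {1}gammaE exprVn -!exprM div1r.
Qed.

Lemma epoch_size_boundE : epoch_size_bound eps gamma b = (bound_root / b%:R `^ (1 / 6)) ^+ 3.
Proof.
have B0 : 0 < b%:R `^ (1 / 6) :> R by exact: powR_gt0.
have E0 : 0 < eps `^ (1 / 3) by exact: powR_gt0.
have G0 : 0 < gamma `^ (1 / 2) by exact: powR_gt0.
rewrite /bound_root expr_div_n -maxrXn ?divr_ge0 ?invr_ge0 ?exprn_ge0 ?powR_ge0//.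
rewrite maxr_pMl ?invr_ge0 ?exprn_ge0 ?powR_ge0//.
rewrite /epoch_size_bound {1}epsE (@powR_expr b%:R (1 / 6) (1 / 2) 3)//; last by field.
rewrite (@powR_expr gamma (1 / 2) (9 / 2) 9)//; last by field.
by congr Num.max; field; rewrite !gt_eqF.
Qed.

Lemma iteration_bound_ge1 : eps <= 1 -> 1 <= iteration_bound eps gamma b.
Proof.
move=> e1; rewrite /iteration_bound le_max; apply/orP; left.
have third (x y : R) : 0 <= x -> x <= y -> x `^ (1 / 3) <= y `^ (1 / 3).
  by move=> x0 xy; rewrite ge0_ler_powR ?nnegrE// (le_trans x0).
rewrite ler_pdivlMr ?powR_gt0// [leLHS]mul1r; apply: (@le_trans _ _ 1).
  rewrite (@powR_expr eps (1 / 3) (4 / 3) 4)//; last by field.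
  apply: exprn_ile1; first exact: powR_ge0.
  by have := third eps 1 (ltW eps_gt0) e1; rewrite powR1.
by have := third 1 b%:R ler01; rewrite powR1 ler1n; exact.
Qed.

Lemma iteration_bound_gamma : (iteration_bound eps gamma b)^-1 <= gamma ^+ 3.
Proof.
rewrite invf_ple ?posrE ?exprn_gt0//; last by rewrite iteration_boundE exprn_gt0 ?bound_root_gt0.
by rewrite le_max; apply/orP; right; rewrite div1r.
Qed.

(** [j / B^3] is the guaranteed order of [1 / tau] for the prescribed sample size. Only the first
    branch of the maximum defining [j] is needed for the decrease in [eps]. *)
Lemma bound_root_decrease :
  eps `^ (4 / 3) / b%:R `^ (1 / 3) <= eps ^+ 2 * (bound_root / (b%:R `^ (1 / 6)) ^+ 3).
Proof.
have B0 : 0 < b%:R `^ (1 / 6) :> R by exact: powR_gt0.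
have E0 : 0 < eps `^ (1 / 3) by exact: powR_gt0.
have : b%:R `^ (1 / 6) / (eps `^ (1 / 3)) ^+ 2 <= bound_root by rewrite le_max lexx.
rewrite (@powR_expr eps (1 / 3) (4 / 3) 4)//; last by field.
rewrite (@powR_expr b%:R (1 / 6) (1 / 3) 2)//; last by field.
have -> : eps ^+ 2 = (eps `^ (1 / 3)) ^+ 3 ^+ 2 by rewrite -epsE.
move: bound_root => r; move: B0 E0; set B := b%:R `^ _; set E := eps `^ _.
move=> B0 E0; rewrite ler_pdivrMr ?exprn_gt0// => h.
have -> : E ^+ 4 / B ^+ 2 = E ^+ 4 / B ^+ 3 * B by field; rewrite gt_eqF.
have -> : (E ^+ 3) ^+ 2 * (r / B ^+ 3) = E ^+ 4 / B ^+ 3 * (r * E ^+ 2) by field; rewrite gt_eqF.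
by rewrite ler_pM2l ?divr_gt0 ?exprn_gt0.
Qed.

End scaling.

(** * Comparison of the drift [mu] with gain, rate and noise *)

Section constants.
Context {R : realType}.

(** In cubes: [tau^3 q^3 = b q^3 / m1 <= b], and [b] is the sixth power of [b^(1/6)]. *)
Lemma epoch_ratio_le (m1 b : nat) (q : R) : (0 < b <= m1)%N -> 0 < q -> q ^+ 3 <= m1%:R ->
  epoch_ratio m1 b * q <= (b%:R `^ (1 / 6)) ^+ 2.
Proof.
move=> bm q0 qm; have b0 : 0 < b%:R :> R by rewrite ltr0n; case/andP: bm.
have t0 : 0 < epoch_ratio m1 b :> R by exact: epoch_ratio_gt0.
have B0 : 0 < b%:R `^ (1 / 6) :> R by exact: powR_gt0.
rewrite -(@ler_pXn2r _ 3) ?nnegrE ?mulr_ge0 ?exprn_ge0 ?(ltW q0) ?(ltW t0) ?(ltW B0)//.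
rewrite exprMn epoch_ratio_cube -exprM -(@powR_expr _ _ _ 1)//; last by field.
rewrite powRr1 ?(ltW b0)// -mulrA ler_piMr ?(ltW b0)//.
rewrite mulrC ler_pdivrMr ?mul1r//; exact: lt_le_trans (exprn_gt0 _ q0) qm.
Qed.

Lemma ratio_rate (L1 c' t q B : R) : 0 < L1 -> 0 < c' -> 0 < t -> 0 < q -> 0 < B ->
  t * q <= B ^+ 2 -> c' / (2 * L1) * (q / B ^+ 2) <= c' / (2 * L1 * t).
Proof.
move=> L0 c0 t0 q0 B0 tq.
have -> : c' / (2 * L1 * t) = c' / (2 * L1) * t^-1 by rewrite invfM mulrA.
rewrite ler_pM2l ?divr_gt0 ?mulr_gt0//.
by rewrite ler_pdivrMr ?exprn_gt0// mulrC ler_pdivlMr// mulrC.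
Qed.

Variables (L1 L2 c' V K m0 kk lam j B t c gamma eps : R).
Hypotheses (L1_gt0 : 0 < L1) (L2_gt0 : 0 < L2) (c'_gt0 : 0 < c') (V_gt0 : 0 < V) (K_gt0 : 0 < K)
  (m0_gt0 : 0 < m0) (kk_ge1 : 1 <= kk) (lam_ge1 : 1 <= lam) (j_gt0 : 0 < j) (B_gt0 : 0 < B)
  (t_gt0 : 0 < t) (gamma_gt0 : 0 < gamma) (eps_gt0 : 0 < eps).
Let q := kk * lam ^+ 2 * (j / B).
Hypothesis tq : t * q <= B ^+ 2.

Let lam_gt0 : 0 < lam. Proof. exact: lt_le_trans lam_ge1. Qed.
Let kk_gt0 : 0 < kk. Proof. exact: lt_le_trans kk_ge1. Qed.
Let q_gt0 : 0 < q. Proof. by rewrite !mulr_gt0 ?invr_gt0 ?exprn_gt0. Qed.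
Let q_ge : j / B <= q.
Proof.
apply: ler_peMl; first by rewrite divr_ge0 ?ltW.
by rewrite mulr_ege1// exprn_ege1.
Qed.

Lemma rate_ge : c' / (2 * L1) * (j / B ^+ 3) <= c' / (2 * L1 * t).
Proof.
apply: le_trans (ratio_rate L1_gt0 c'_gt0 t_gt0 q_gt0 B_gt0 tq).
have -> : j / B ^+ 3 = j / B / B ^+ 2 by field; rewrite gt_eqF.
rewrite ler_pM2l ?divr_gt0 ?mulr_gt0//.
by rewrite ler_pM2r ?invr_gt0 ?exprn_gt0.
Qed.

(** The lower bound on [c] costs [(K lam)^3], and [gamma^3 >= 1 / J] supplies the factor
    [1 / j^2]. *)
Lemma gain_ge : m0 <= 1 / (3 * L2 ^+ 2 * K ^+ 3) -> (K * lam)^-1 <= c ->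
  (j ^+ 2)^-1 <= gamma ^+ 3 ->
  m0 / (lam ^+ 3 * j ^+ 2) <= c ^+ 3 * gamma ^+ 3 / (3 * L2 ^+ 2).
Proof.
move=> m0K Kc jg.
apply: (@le_trans _ _ (((K * lam)^-1) ^+ 3 * (j ^+ 2)^-1 / (3 * L2 ^+ 2))).
  have -> : (K * lam)^-1 ^+ 3 * (j ^+ 2)^-1 / (3 * L2 ^+ 2) =
      1 / (3 * L2 ^+ 2 * K ^+ 3) / (lam ^+ 3 * j ^+ 2).
    by field; rewrite !gt_eqF.
  by rewrite ler_pM2r// invr_gt0 mulr_gt0 ?exprn_gt0.
rewrite ler_pM2r ?invr_gt0 ?mulr_gt0 ?exprn_gt0//.
have Kl : 0 < (K * lam)^-1 by rewrite invr_gt0 mulr_gt0.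
apply: ler_pM => //; first by rewrite exprn_ge0// ltW.
  by rewrite invr_ge0 exprn_ge0// ltW.
by rewrite lerXn2r ?nnegrE ?(ltW Kl)// (le_trans (ltW Kl)).
Qed.

(** From [1 / eps^2 <= (j / B)^3] the charge is at most [4 m0 j / B^3], the order of the rate;
    [m0 <= c' / (8 L1)] settles the constant. *)
Lemma rate_ge_drift : m0 <= c' / (8 * L1) -> 1 / eps ^+ 2 <= (j / B) ^+ 3 ->
  m0 / (lam ^+ 3 * j ^+ 2) * (4 / eps ^+ 2) <= c' / (2 * L1 * t).
Proof.
move=> m0c ej; apply: le_trans rate_ge.
apply: (@le_trans _ _ (m0 / j ^+ 2 * (4 * (j / B) ^+ 3))); last first.
  have -> : m0 / j ^+ 2 * (4 * (j / B) ^+ 3) = (4 * m0) * (j / B ^+ 3).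
    by field; rewrite !gt_eqF.
  rewrite ler_pM2r ?divr_gt0 ?exprn_gt0//.
  have -> : c' / (2 * L1) = 4 * (c' / (8 * L1)) by field; rewrite gt_eqF.
  by rewrite ler_pM2l.
apply: ler_pM.
- by rewrite divr_ge0 ?mulr_ge0 ?exprn_ge0 ?ltW.
- by rewrite divr_ge0 ?exprn_ge0 ?ltW.
- rewrite ler_pM2l// lef_pV2 ?posrE ?mulr_gt0 ?exprn_gt0//.
  by rewrite ler_peMl ?exprn_ge0 ?exprn_ege1 ?(ltW j_gt0).
- by rewrite ler_pM2l// -div1r.
Qed.

(** Eliminating [m], the noise is proportional to [t^2 / B^6], and [t <= B^2 / q] makes it at most a
    constant over [kk^2 lam^4 j^2]. The [lam^2] in [q] thus beats the [lam^3] in the drift, and [kk]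
    absorbs the constant. *)
Lemma noise_le (m : R) : 0 < m -> t ^+ 3 = B ^+ 6 / m -> 2 * c' * V / (L1 * m0) <= kk ->
  c' / (2 * L1 * t) * (V / m) <= m0 / (lam ^+ 3 * j ^+ 2) / 4.
Proof.
move=> m_gt0 t3 hkk.
have -> : c' / (2 * L1 * t) * (V / m) = c' * V / (2 * L1) * (t ^+ 2 / B ^+ 6).
  have -> : m = B ^+ 6 / t ^+ 3 by rewrite t3; field; rewrite !gt_eqF.
  by field; rewrite !gt_eqF.
have tB : t <= B ^+ 2 / q by rewrite ler_pdivlMr.
have t2 : t ^+ 2 <= (B ^+ 2 / q) ^+ 2.
  by rewrite lerXn2r ?nnegrE ?(le_trans (ltW t_gt0) tB) ?(ltW t_gt0).
apply: (@le_trans _ _ (c' * V / (2 * L1) * ((B ^+ 2 / q) ^+ 2 / B ^+ 6))).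
  by rewrite ler_pM2l ?divr_gt0 ?mulr_gt0// ler_pM2r ?invr_gt0 ?exprn_gt0.
have -> : c' * V / (2 * L1) * ((B ^+ 2 / q) ^+ 2 / B ^+ 6) =
    (2 * c' * V / (L1 * m0)) / kk ^+ 2 / lam * (m0 / (lam ^+ 3 * j ^+ 2) / 4).
  by rewrite /q; field; rewrite !gt_eqF.
apply: ler_piMl.
  by rewrite !divr_ge0 ?mulr_ge0 ?exprn_ge0 ?ltW.
rewrite ler_pdivrMr// mul1r; apply: le_trans lam_ge1.
rewrite ler_pdivrMr ?exprn_gt0// mul1r; apply: le_trans hkk _.
by rewrite expr2 ler_peMl// ltW.
Qed.

End constants.

(** * Choice of the constants and assembly of the four conclusions *)

Theorem corollary7 (R : realType) (L1 L2 Delta G V c' K : R) (r : nat)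
  (L1_gt0 : 0 < L1) (L2_gt0 : 0 < L2) (G_gt0 : 0 < G) (V_gt0 : 0 < V)
  (c'_gt0 : 0 < c') (c'_le : c' <= 1 / 6) (K_gt0 : 0 < K) :
  exists (omega k1 k0 : R) (p1 p0 : nat),
  [/\ 0 < omega, 0 < k1 & 0 < k0] /\
  forall (K1 : R) (r1 : nat), exists (k : R) (p : nat),
  forall (d : nat) (dO dX dU : measure_display) (Omega : measurableType dO)
    (Xi : measurableType dX) (U : measurableType dU)
    (P : probability Omega R) (D : probability Xi R)
    (f : 'rV[R]_d -> Xi -> R) (x1 : 'rV[R]_d) (W : draws P Xi U)
    (neon : U -> 'rV[R]_d -> fo_proc R d)
    (eps gamma delta fail c C Tn : R) (m1 b s n2 : nat),
  let Lam := log_factor d eps gamma delta in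
  let M := epoch_size_bound eps gamma b in
  let J := iteration_bound eps gamma b in
  let F := objective D f in
  (0 < d)%N ->
  0 < eps <= 1 -> 0 < gamma <= 1 -> 0 < delta < 1 ->
  standing_assumptions D f L1 L2 Delta G V x1 ->
  (0 < b <= m1)%N ->
  k1 * Lam ^+ p1 * M <= m1%:R <= K1 * Lam ^+ r1 * M ->
  valid_draws D m1 b W ->
  0 < fail <= k0 * delta / (Lam ^+ p0 * J) ->
  (0 < s)%N -> s%:R <= K * Lam ^+ r / eps ^+ 2 ->
  check_guarantee D f eps s W fail ->
  (0 < n2)%N -> (K * Lam ^+ r)^-1 <= c <= 1 -> (K * Lam ^+ r)^-1 <= C ->
  neon_guarantee D f L2 c gamma n2 neon W C Tn fail ->
  [/\ forall j, guarantees_decrease P F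
        (fun w => scsg_call f L1 c' m1 b W w j)
        eps (omega * (eps `^ (4 / 3) / b%:R `^ (1 / 3))),
      forall j, (\int[P]_w ((scsg_call_cost m1 b W w j)%:R : R)%:E
                 <= (k * Lam ^+ p * M)%:E)%E,
      ((1 - delta)%:E <= P [set w | exists y : 'rV[R]_d,
         neon_scsg_returns f L1 L2 c' c eps gamma m1 b s n2 neon W x1 w y /\
         second_order_stationary F (3 / 2 * eps) (2 * gamma) y])%E
    & (\int[P]_w neon_scsg_cost f L1 L2 c' c eps gamma m1 b s n2 neon W x1 w
       <= (k * Lam ^+ p *
           (J * (Tn + 1 / eps ^+ 2
                 + 1 / (gamma `^ (9 / 2) * b%:R `^ (1 / 2)))))%:E)%E].
Proof.
(* The drift will be [mu = m0 / (lam^3 J)]; the two entries are the constants allowed by the NEON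
   gain and by the descent rate. *)
pose m0 := Num.min (1 / (3 * L2 ^+ 2 * K ^+ 3)) (c' / (8 * L1)).
have m0_gt0 : 0 < m0 by rewrite lt_min !divr_gt0 ?mulr_gt0 ?exprn_gt0.
have m0K : m0 <= 1 / (3 * L2 ^+ 2 * K ^+ 3) by rewrite ge_min lexx.
have m0c : m0 <= c' / (8 * L1) by rewrite ge_min lexx orbT.
clearbody m0.
(* The summands give, in turn, [q >= j / B], the noise condition [V / m1 <= eps^2 / 2] of the
   decrease, and the noise bound [mu / 4] of the drift. *)
pose kk := 1 + 2 * V + 2 * c' * V / (L1 * m0).
have noise0 : 0 < 2 * c' * V / (L1 * m0) by rewrite divr_gt0 ?mulr_gt0.
have kk_ge1 : 1 <= kk by rewrite /kk; move: noise0; move: (_ / _) => z z0; lra.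
have kkV : 2 * V <= kk by rewrite /kk; move: noise0; move: (_ / _) => z z0; lra.
have kkn : 2 * c' * V / (L1 * m0) <= kk by rewrite /kk; move: noise0; move: (_ / _) => z z0; lra.
clearbody kk; have kk_gt0 : 0 < kk by exact: lt_le_trans kk_ge1.
(* A bound on gain, loss and [mu] together, uniform in [c], [gamma <= 1]. *)
pose gl := 1 / (3 * L2 ^+ 2) + L1 / (2 * L2 ^+ 2) + m0.
have gl_gt0 : 0 < gl by rewrite !addr_gt0 ?divr_gt0 ?mulr_gt0 ?exprn_gt0.
(* The mean number of iterations divided by [lam^3 J]. The absolute value is there because no
   objective has been given yet that would make [Delta] nonnegative. *)
pose it := 2 * `|Delta| / m0 + 2.
have it0 : 0 <= 2 * `|Delta| / m0 by rewrite divr_ge0 ?mulr_ge0 ?(ltW m0_gt0).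
have it_ge2 : 2 <= it by rewrite lerDr.
have it_gt0 : 0 < it by apply: lt_le_trans it_ge2.
(* The first entry keeps the charge for failures below [mu / 4] per iteration, the second keeps the
   probability of a bad stop over the run below [delta / 2]. *)
pose k0 := Num.min (m0 / 4 / gl) (1 / 2 / it).
have k0_gt0 : 0 < k0 by rewrite lt_min !divr_gt0.
have k0gl : gl * k0 <= m0 / 4 by rewrite mulrC -ler_pdivlMr// ge_min lexx.
have k0it : k0 * it <= 1 / 2 by rewrite -ler_pdivlMr// ge_min lexx orbT.
clearbody k0.
(* [6 r] comes from [q^3], which contains [(lam^2)^3], and [3 r] from the [lam^3] in [mu]. The rate
   constant [c' / (2 L1)] is halved by the noise. *)
exists (c' / (4 * L1)), (kk ^+ 3), k0, (6 * r)%N, (3 * r)%N; split.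
  by rewrite divr_gt0 ?mulr_gt0 ?exprn_gt0.
(* The iterations contribute [lam^3], hence [3 r]. The cost of one iteration contributes [r + r1],
   which dominates the exponents of the epoch size and of the check. *)
move=> K1 r1; exists (it * (3 * `|K1| + K + 1)), (4 * r + r1)%N.
move=> d dO dX dU Omega Xi U P D f x1 W neon eps gamma delta fail c C Tn m1 b s n2 Lam M J F.
move=> d0 eps01 gamma01 delta01 sa bm /andP[m1_ge m1_le] vd /andP[fail_gt0 fail_le] s0 s_le cg
  n20 /andP[c_ge c_le] C_ge ng.
have Lam_ge1 : 1 <= Lam by exact: log_factor_ge1.
have [eps_gt0 eps_le1] := andP eps01; have [gamma_gt0 gamma_le1] := andP gamma01.
have [delta_gt0 delta_lt1] := andP delta01.
have [b_gt0 b_le] := andP bm.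
have m1_gt0 : 0 < m1%:R :> R by rewrite ltr0n; exact: leq_trans b_le.
have Lam_gt0 : 0 < Lam by exact: lt_le_trans Lam_ge1.
have LamX n m : (n <= m)%N -> Lam ^+ n <= Lam ^+ m by move=> nm; exact: ler_weXn2l.
pose lam := Lam ^+ r; have lam_ge1 : 1 <= lam by exact: exprn_ege1.
have lam_gt0 : 0 < lam by exact: lt_le_trans lam_ge1.
pose B : R := b%:R `^ (1 / 6); have B_gt0 : 0 < B by rewrite powR_gt0// ltr0n.
pose j := bound_root eps gamma b.
have j_gt0 : 0 < j by exact: bound_root_gt0.
have JE : J = j ^+ 2 by exact: iteration_boundE.
have ME : M = (j / B) ^+ 3 by exact: epoch_size_boundE.
have J_ge1 : 1 <= J by exact: iteration_bound_ge1.
have J_gt0 : 0 < J by exact: lt_le_trans J_ge1.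
pose A := 1 / eps ^+ 2; pose A' := 1 / (gamma `^ (9 / 2) * b%:R `^ (1 / 2)).
have A_ge0 : 0 <= A by rewrite divr_ge0 ?exprn_ge0// ltW.
have A'_ge0 : 0 <= A' by rewrite divr_ge0 ?mulr_ge0 ?powR_ge0.
have AM : A <= M by rewrite le_max lexx.
have MA : M <= A + A' by rewrite ge_max lerDl A'_ge0 lerDr A_ge0.
have M_gt0 : 0 < M by rewrite ME exprn_gt0// divr_gt0.
(* As M = (j / B)^3, the hypothesis on m1 reads q^3 <= m1. *)
pose q := kk * lam ^+ 2 * (j / B).
have q_gt0 : 0 < q by rewrite !mulr_gt0 ?exprn_gt0 ?invr_gt0.
have q3 : q ^+ 3 <= m1%:R.
  have lam6 : Lam ^+ (6 * r) = (lam ^+ 2) ^+ 3 by rewrite -exprM mulnC exprM.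
  by apply: le_trans m1_ge; rewrite ME lam6 -!exprMn.
pose t : R := epoch_ratio m1 b.
have t_gt0 : 0 < t by exact: epoch_ratio_gt0.
have tq : t * q <= B ^+ 2 by exact: epoch_ratio_le.
have BE : B ^+ 6 = b%:R.
  by rewrite -(@powR_expr _ _ _ 1) ?ltr0n// ?powRr1//; field.
have t3 : t ^+ 3 = B ^+ 6 / m1%:R by rewrite BE; exact: epoch_ratio_cube.
pose mu := m0 / (lam ^+ 3 * J).
have mu_gt0 : 0 < mu by rewrite divr_gt0 ?mulr_gt0 ?exprn_gt0.
have c_gt0 : 0 < c by apply: lt_le_trans c_ge; rewrite invr_gt0 mulr_gt0 ?exprn_gt0.
have mu_le : mu <= m0.
  by rewrite ler_pdivrMr ?mulr_gt0 ?exprn_gt0// ler_peMr ?(ltW m0_gt0)// mulr_ege1// exprn_ege1.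
have Jg : (j ^+ 2)^-1 <= gamma ^+ 3 by rewrite -JE; exact: iteration_bound_gamma.
have mu_gain : mu <= neon_gain L2 gamma c.
  by rewrite /mu JE; exact: (gain_ge L2_gt0 K_gt0 lam_ge1 j_gt0 m0K c_ge Jg).
have ej : 1 / eps ^+ 2 <= (j / B) ^+ 3 by rewrite -ME.
have mu_rate : mu * (4 / eps ^+ 2) <= descent_rate L1 c' m1 b.
  rewrite /mu JE; exact: (rate_ge_drift L1_gt0 c'_gt0 m0_gt0 kk_ge1 lam_ge1 j_gt0 B_gt0 t_gt0 eps_gt0 tq m0c ej).
have noise : descent_rate L1 c' m1 b * (V / m1%:R) <= mu / 4.
  rewrite /mu JE; exact: (noise_le L1_gt0 c'_gt0 V_gt0 m0_gt0 kk_ge1 lam_ge1 j_gt0 B_gt0 t_gt0 tq m1_gt0 t3 kkn).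
have fail_le' : fail <= k0 / (lam ^+ 3 * J) * delta.
  apply: le_trans fail_le _; rewrite -exprM (mulnC r); apply: le_of_eq.
  by rewrite mulrAC.
have gl_le : neon_gain L2 gamma c + neon_loss L1 L2 gamma c + mu <= gl.
  rewrite lerD// lerD//.
    rewrite ler_pM2r ?invr_gt0 ?mulr_gt0 ?exprn_gt0// -exprMn.
    by rewrite exprn_ile1 ?mulr_ge0 ?mulr_ile1// ltW.
  rewrite ler_pM2r ?invr_gt0 ?mulr_gt0 ?exprn_gt0// -mulrA -exprMn.
  rewrite ler_piMr ?(ltW L1_gt0)//.
  by rewrite exprn_ile1 ?mulr_ge0 ?mulr_ile1// ltW.
have mu_extra : descent_rate L1 c' m1 b * (V / m1%:R)
    + (neon_gain L2 gamma c + neon_loss L1 L2 gamma c + mu) * fail <= mu / 2.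
  have fail_mu : gl * fail <= mu / 4.
    apply: (@le_trans _ _ (gl * (k0 / (lam ^+ 3 * J)))).
      rewrite ler_pM2l//; apply: le_trans fail_le' _.
      by rewrite ler_piMr ?(ltW delta_lt1)// divr_ge0 ?mulr_ge0 ?exprn_ge0 ?ltW.
    rewrite mulrA /mu [leRHS]mulrAC ler_pM2r// invr_gt0 mulr_gt0 ?exprn_gt0//.
  have gl_fail : (neon_gain L2 gamma c + neon_loss L1 L2 gamma c + mu) * fail <= gl * fail.
    by rewrite ler_pM2r.
  apply: le_trans (lerD noise (le_trans gl_fail fail_mu)) _.
  by apply: le_of_eq; field.
have [xmin [FminP gap]] := sa_initial_gap sa.
have gap' : F x1 - F xmin <= `|Delta| by apply: le_trans gap _; exact: ler_norm.
pose iters := mean_iterations D f x1 (F xmin) mu.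
have iters_ge0 : 0 <= iters.
  by rewrite addr_ge0// divr_ge0 ?(ltW mu_gt0)// mulr_ge0// subr_ge0 FminP.
have iters_le : iters <= it * (lam ^+ 3 * J).
  rewrite /iters /mean_iterations /it [leRHS]mulrDl; apply: lerD; last first.
    by rewrite ler_peMr// mulr_ege1// exprn_ege1.
  have -> : 2 * `|Delta| / m0 * (lam ^+ 3 * J) = 2 * `|Delta| / mu.
    by rewrite /mu; field; rewrite !gt_eqF.
  by rewrite ler_pM2r ?invr_gt0// ler_pM2l.
split.
- move=> i x gx.
  have Vm : V / m1%:R <= eps ^+ 2 / 2.
    rewrite ler_pdivrMr// mulrAC ler_pdivlMr// mulrC.
    apply: (@le_trans _ _ (kk ^+ 3)).
      by apply: le_trans kkV _; rewrite -[leLHS]expr1 ler_weXn2l.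
    rewrite mulrC -ler_pdivrMr ?exprn_gt0// -[leLHS]mul1r mulrCA.
    apply: le_trans m1_ge; rewrite -mulrA ler_pM2l ?exprn_gt0//.
    apply: le_trans AM _; rewrite ler_peMl ?(ltW M_gt0)// exprn_ege1//.
  have dec := epoch_guarantees_decrease L1_gt0 (ltW L2_gt0) sa c'_gt0 c'_le bm vd FminP Vm gx.
  apply: le_trans dec _; rewrite lee_fin lerN2.
  rewrite -/(descent_rate _ _ _ _).
  apply: (@le_trans _ _ (c' / (2 * L1) * (j / B ^+ 3) * (eps ^+ 2 / 2))); last first.
    rewrite ler_pM2r ?divr_gt0 ?exprn_gt0//.
    exact: (rate_ge L1_gt0 c'_gt0 kk_ge1 lam_ge1 j_gt0 B_gt0 t_gt0 tq).
  have -> : c' / (2 * L1) * (j / B ^+ 3) * (eps ^+ 2 / 2) =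
      c' / (4 * L1) * (eps ^+ 2 * (j / B ^+ 3)) by field; rewrite !gt_eqF.
  rewrite ler_pM2l ?divr_gt0 ?mulr_gt0//; exact: bound_root_decrease.
- move=> i; apply: le_trans (scsg_mean_cost vd bm i) _; rewrite lee_fin.
  rewrite -!mulrA; apply: (@le_trans _ _ (3 * (`|K1| * (Lam ^+ r1 * M)))).
    rewrite ler_pM2l//; apply: le_trans m1_le _; rewrite -mulrA ler_pM2r ?ler_norm//.
    by rewrite mulr_gt0 ?exprn_gt0.
  rewrite !mulrA ler_pM2r//; apply: ler_pM.
  + by rewrite mulr_ge0.
  + by rewrite exprn_ge0// ltW.
  + apply: (@le_trans _ _ (3 * `|K1| + K + 1)); first by rewrite -addrA lerDl addr_ge0// ltW.
    by rewrite ler_peMl ?(le_trans _ it_ge2) ?ler1n// !addr_ge0 ?mulr_ge0// ltW.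
  + by rewrite LamX// leq_addl.
(* Half of [delta] is spent on not having stopped, the other half on bad stops. *)
- apply: le_trans (success_prob L1_gt0 L2_gt0 sa eps_gt0 gamma_gt0 c_gt0 fail_gt0 c'_gt0 c'_le
    bm vd cg ng FminP mu_gt0 mu_gain mu_rate mu_extra (e := delta / 2) _); last by rewrite divr_gt0.
  rewrite lee_fin lerB// [leRHS](splitr delta) lerD2l.
  apply: (@le_trans _ _ (k0 / (lam ^+ 3 * J) * delta * (it * (lam ^+ 3 * J)))).
    by apply: ler_pM => //; exact: ltW.
  have -> : k0 / (lam ^+ 3 * J) * delta * (it * (lam ^+ 3 * J)) = k0 * it * delta.
    by field; rewrite !gt_eqF.
  by rewrite [leRHS]mulrC ler_pM2r// -div1r.
- apply: le_trans (mean_total_cost L1_gt0 L2_gt0 sa eps_gt0 gamma_gt0 c_gt0 fail_gt0 c'_gt0 c'_le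
    bm vd cg ng FminP mu_gt0 mu_gain mu_rate mu_extra) _.
  rewrite lee_fin.
  have Tn0 := neon_bound_ge0 x1 ng.
  (* A common majorant for the epoch size, the check size and [Tn], up to the factors [|K1|], [K]
     and 1. *)
  pose Q := Lam ^+ (r1 + r) * (Tn + A + A').
  have TA0 : 0 <= Tn + A + A' by rewrite !addr_ge0.
  have Q0 : 0 <= Q by rewrite mulr_ge0// exprn_ge0// ltW.
  have QE n : (n <= r1 + r)%N -> forall z, z <= Tn + A + A' -> Lam ^+ n * z <= Q.
    move=> nr z zA; apply: (@le_trans _ _ (Lam ^+ n * (Tn + A + A'))).
      by rewrite ler_pM2l ?exprn_gt0.
    by apply: ler_wpM2r => //; exact: LamX.
  have m1Q : 3 * m1%:R <= 3 * `|K1| * Q.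
    rewrite -mulrA ler_pM2l//; apply: le_trans m1_le _; rewrite -mulrA.
    apply: (@le_trans _ _ (`|K1| * (Lam ^+ r1 * M))).
      by rewrite ler_pM2r ?ler_norm// mulr_gt0 ?exprn_gt0.
    apply: ler_wpM2l => //; apply: QE; first exact: leq_addr.
    by apply: le_trans MA _; rewrite -addrA lerDr.
  have sQ : s%:R <= K * Q.
    apply: le_trans s_le _; rewrite -div1r -/A -mulrA ler_pM2l//.
    by apply: QE; [exact: leq_addl|rewrite addrAC lerDr addr_ge0].
  have TQ : Tn <= Q.
    have := QE 0%N (leq0n _) Tn; rewrite expr0 mul1r; apply.
    by rewrite -addrA lerDl addr_ge0.
  apply: (@le_trans _ _ (it * (lam ^+ 3 * J) * ((3 * `|K1| + K + 1) * Q))).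
    apply: ler_pM => //.
    + by rewrite !addr_ge0// mulr_ge0.
    + have -> : (3 * `|K1| + K + 1) * Q = 3 * `|K1| * Q + K * Q + Q by ring.
      exact: lerD (lerD m1Q sQ) TQ.
  rewrite -/A -/A'; apply: le_of_eq.
  have -> : Lam ^+ (4 * r + r1) = lam ^+ 3 * Lam ^+ (r1 + r).
    by rewrite /lam -exprM -exprD; congr (_ ^+ _); ring.
  rewrite /Q; ring.
Qed.
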